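(* Let $\mathcal{H}$ be a separable Hilbert space (of finite or infinite dimension) over $\mathbb{F}=\mathbb{R}$ or $\mathbb{C}$. Let $1\le p<\infty$ and let $q$ satisfy $1/p+1/q=1$ (with $q=\infty$ if $p=1$). Let $A$ be a set, let $\{\mathbf{A}_\alpha\}_{\alpha\in A}\subset\mathcal{S}_p$ be self-adjoint operators and $\{\beta_\alpha\}_{\alpha\in A}\subset\mathbb{F}$, and let $$\mathcal{C}=\{\mathbf{P}\in\mathcal{P}_q : \operatorname{Tr}\mathbf{P}\mathbf{A}_\alpha=\beta_\alpha\text{ for every }\alpha\in A\}.$$ Let $\mathbf{P}\in\mathcal{C}$. Then the following three statements are equivalent: 1. $\mathbf{P}$ is an extreme point of $\mathcal{C}$. 2. There exists no nonzero self-adjoint $\mathbf{X}\in\mathcal{S}$ such that $\mathcal{R}(\mathbf{X})\subset\overline{\mathcal{R}(\mathbf{P})}$ and $$\operatorname{Tr}\sqrt{\mathbf{P}}\mathbf{A}_\alpha\sqrt{\mathbf{P}}\,\mathbf{X}=0\quad\text{for every }\alpha\in A.$$ 3. The real linear span of $\{\sqrt{\mathbf{P}}\mathbf{A}_\alpha\sqrt{\mathbf{P}}\}_{\alpha\in A}$ is dense (in the trace norm) in the real vector space of self-adjoint trace-class operators on $\mathcal{H}$ with range contained in $\overline{\mathcal{R}(\mathbf{P})}$.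
   Context: $\mathcal{S}$ denotes the bounded linear operators on $\mathcal{H}$. For $1\le p<\infty$, $\mathcal{S}_p$ is the Schatten class (trace ideal) of compact operators $\mathbf{A}$ on $\mathcal{H}$ with $\operatorname{Tr}|\mathbf{A}|^p<\infty$, where $|\mathbf{A}|=(\mathbf{A}^*\mathbf{A})^{1/2}$; $\mathcal{S}_1$ is the space of trace-class operators; $\mathcal{S}_\infty$ is the space of compact operators. $\mathcal{P}$ is the set of positive operators (self-adjoint with $\langle x,\mathbf{P}x\rangle\ge0$ for all $x$), and $\mathcal{P}_q=\mathcal{P}\cap\mathcal{S}_q$. $\mathcal{R}(\cdot)$ denotes the range and the bar denotes norm closure in $\mathcal{H}$. A point of a convex set $\mathcal{C}$ is extreme if it cannot be written as $\alpha p_1+(1-\alpha)p_2$ with $\alpha\in(0,1)$ and distinct $p_1,p_2\in\mathcal{C}$. *)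

(* Defs.v *)
From HB Require Import structures.
From mathcomp Require Import all_boot all_order all_algebra.
From mathcomp Require Import sesquilinear.
From mathcomp Require Import complex.
From mathcomp Require Import all_classical all_reals all_analysis.

Set Implicit Arguments.
Unset Strict Implicit.
Unset Printing Implicit Defensive.

Import Order.TTheory GRing.Theory Num.Theory.
Import numFieldNormedType.Exports.

Local Open Scope classical_set_scope.
Local Open Scope ring_scope.

(* The scalar field is R or R[i], for R a model of the real numbers. *)
Variant scalar_kind := RealScalars | ComplexScalars.

Definition scalar_field (R : realType) (k : scalar_kind) : numFieldType :=
  match k with
  | RealScalars => R : numFieldType
  | ComplexScalars => R[i] : numFieldType
  end.

Definition scalar_conj (R : realType) (k : scalar_kind) :
    involutive_rmorphism (scalar_field R k) :=
  match k return involutive_rmorphism (scalar_field R k) with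
  | RealScalars => (@idfun R : involutive_rmorphism R)
  | ComplexScalars => (@Num.conj R[i] : involutive_rmorphism R[i])
  end.

Definition of_real (R : realType) (k : scalar_kind) :
    {rmorphism R -> scalar_field R k} :=
  match k return {rmorphism R -> scalar_field R k} with
  | RealScalars => (@idfun R : {rmorphism R -> R})
  | ComplexScalars => (real_complex R : {rmorphism R -> R[i]})
  end.

Definition extreme_point (K : numFieldType) (V : lmodType K)
    (C : set V) (x : V) : Prop :=
  C x /\
  ~ exists (a : K) (p1 p2 : V),
      [/\ 0 < a < 1, C p1, C p2, p1 <> p2 & x = a *: p1 + (1 - a) *: p2].

(* Finite linear combinations with real coefficients; the scalars that are
   [Num.real] in [scalar_field R k] are those in the image of R. *)
Definition real_span (K : numFieldType) (V : lmodType K) (I : Type)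
    (v : I -> V) : set V :=
  [set w | exists (n : nat) (c : 'I_n -> K) (i : 'I_n -> I),
     (forall j, c j \is Num.real) /\ w = \sum_(j < n) c j *: v (i j)].

Definition separable_space (T : topologicalType) : Prop :=
  exists D : set T, countable D /\ dense D.

Section Operators.
Context (R : realType) (k : scalar_kind).
Local Notation K := (scalar_field R k).
Context (H : completeNormedModType K) (dot : {dot H for @scalar_conj R k}).
Implicit Types (A B P S T : H -> H) (e : nat -> H).

(* Makes [dot] (linear in its first argument) the inner product of a Hilbert
   space: completeness is that of [H]. *)
Definition norm_from_dot : Prop := forall x : H, `|x| ^+ 2 = dot x x.

Definition bounded_op A : Prop :=
  linear A /\ exists M : K, forall x, `|A x| <= M * `|x|.

Definition compact_op A : Prop :=
  linear A /\ precompact (A @` [set x | `|x| <= 1]).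

Definition is_adjoint A B : Prop := forall x y, dot (A x) y = dot x (B y).

Definition selfadjoint A : Prop := is_adjoint A A.

Definition positive_op P : Prop :=
  [/\ bounded_op P, selfadjoint P & forall x, 0 <= dot x (P x)].

(* [adjoint], [op_sqrt], [op_power] and [trace] are total functions, picking an
   object by its defining property, which is satisfied by exactly one object in
   the cases of interest: [A] bounded for [adjoint A], [P] positive for
   [op_sqrt P], [T] compact positive and r > 0 for [op_power T r], and [A]
   trace class for [trace A]. *)
Definition adjoint A : H -> H := get [set B | is_adjoint A B].

Definition op_sqrt P : H -> H := get [set S | positive_op S /\ S \o S = P].

Definition op_abs A : H -> H := op_sqrt (adjoint A \o A).

(* Functional calculus for a compact positive operator: T ^ r acts as s ^ r on
   the eigenspace of T for s, including s = 0, where 0 `^ r = 0. Eigenvectors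
   span a dense subspace, hence uniqueness. *)
Definition op_power T (r : R) : H -> H :=
  get [set B | bounded_op B /\
    forall (s : R) (x : H), 0 <= s ->
      T x = of_real R k s *: x -> B x = of_real R k (s `^ r) *: x].

(* Zero vectors are allowed in the enumeration, so that one indexing type covers
   every (finite or countably infinite) dimension: the nonzero terms of [e] form
   a maximal orthonormal system. *)
Definition orthonormal_basis e : Prop :=
  [/\ forall i j, i != j -> dot (e i) (e j) = 0,
      forall i, e i = 0 \/ dot (e i) (e i) = 1 &
      forall x, (forall i, dot x (e i) = 0) -> x = 0].

Definition has_trace A (t : K) : Prop :=
  forall e, orthonormal_basis e ->
    series (fun n => dot (A (e n)) (e n)) @ \oo --> t.

Definition trace A : K := get [set t | has_trace A t].

(* For a positive operator B the terms of the series are nonnegative, so that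
   Tr B < +oo means that it converges. *)
Definition schatten (p : \bar R) A : Prop :=
  match p with
  | r%:E => compact_op A /\ exists t : K, has_trace (op_power (op_abs A) r) t
  | +oo%E => compact_op A
  | -oo%E => False
  end.

Definition trace_class A : Prop := schatten 1%E A.

Definition trace_norm A : K := trace (op_abs A).

Definition trace_norm_dense_in (E V : set (H -> H)) : Prop :=
  E `<=` V /\
  forall Y, V Y -> forall eps : K, 0 < eps ->
    exists2 Z, E Z & trace_norm (Y - Z) < eps.

Definition feasible_set (q : \bar R) (I : Type) (A : I -> H -> H)
    (b : I -> K) : set (H -> H) :=
  [set P | [/\ positive_op P, schatten q P &
               forall i, trace (P \o A i) = b i]].

Definition selfadjoint_trace_class_in (W : set H) : set (H -> H) :=
  [set Y | [/\ trace_class Y, selfadjoint Y & range Y `<=` W]].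

End Operators.

(* Main.v *)
(* If P = a p1 + (1 - a) p2 in the feasible set, then p1 and p2 are bounded by
   multiples of P, so D = p1 - p2 factors as sqrt P X sqrt P with X self-adjoint,
   bounded and with range in the closure of the range of P (Douglas). Conversely
   such an X gives P + r D >= 0 for small |r|, and
   Tr (D A_i) = Tr (sqrt P A_i sqrt P X). Hence P is extreme iff no nonzero X
   annihilates all the sqrt P A_i sqrt P. By Hahn-Banach this is density of
   their real span, once every real functional on the self-adjoint trace-class
   operators with range in the closure of the range of P that is bounded for the
   trace norm is known to be Y |-> Tr (Y X) for such an X. *)
Require Import Defs.
From mathcomp Require Import all_boot all_order all_algebra.
From mathcomp Require Import sesquilinear complex ring lra.
From mathcomp Require Import all_classical all_reals all_analysis.
Import Order.TTheory GRing.Theory Num.Theory.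
Import numFieldNormedType.Exports.
Local Open Scope classical_set_scope.
Local Open Scope ring_scope.
Set Implicit Arguments.
Unset Strict Implicit.
Unset Printing Implicit Defensive.

(** [has_trace] asks for the same limit in every orthonormal basis, and this shapes most of the
    work: the existence of Tr P A and the identity Tr (D A) = Tr (sqrt P A sqrt P X) have to hold in
    all bases. The remedy is to write the operators involved as products of two Hilbert-Schmidt
    operators: the sum of the |T e_n|^2 does not depend on the basis by Parseval, and polarization
    carries this over to products. The factors come from eigenvalues. Roots, absolute values and
    powers of compact self-adjoint operators are diagonal in an eigenbasis, and two eigenbases are
    compared through the weights |<e_n, f_m>|^2, whose row and column sums are at most 1. The same
    weights show that 0 <= B <= 2 P keeps B in the Schatten class of P, so that perturbed points
    remain feasible. Self-adjoint operators form only a real space, even over complex scalars; the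
    Riesz and Hahn-Banach theorems are therefore proved in real-linear form. *)

Lemma ultra_fmap T U (f : T -> U) (F : set_system T) :
  UltraFilter F -> UltraFilter (f @ F).
Proof.
move=> FU; split; first exact: fmap_proper_filter.
move=> G GF fFG; rewrite predeqE => A; split; last exact: fFG.
move=> GA; have [//|FnA] := in_ultra_setVsetC (f @^-1` A) FU.
have : G (~` A) by exact: fFG.
by move=> GnA; have /filter_ex [? []] : G (A `&` ~` A) by exact: filterI.
Qed.

(** * Real and complex scalars *)

Section Scalars.
Context (R : realType).
Implicit Types (k : scalar_kind) (a b : R).

Definition sre k : scalar_field R k -> R :=
  match k return scalar_field R k -> R with
  | RealScalars => id
  | ComplexScalars => @complex.Re R
  end.
Arguments sre {k}.

Lemma sreD k (x y : scalar_field R k) : sre (x + y) = sre x + sre y.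
Proof. by case: k x y => // -[a b] [c d]. Qed.

Lemma sreN k (x : scalar_field R k) : sre (- x) = - sre x.
Proof. by case: k x => // -[a b]. Qed.

Lemma sreB k (x y : scalar_field R k) : sre (x - y) = sre x - sre y.
Proof. by rewrite sreD sreN. Qed.

Lemma sre0 k : sre (0 : scalar_field R k) = 0.
Proof. by case: k. Qed.

Lemma sre_sum k I (r : seq I) (P : pred I) (F : I -> scalar_field R k) :
  sre (\sum_(i <- r | P i) F i) = \sum_(i <- r | P i) sre (F i).
Proof. by apply: big_morph; [exact: sreD|exact: sre0]. Qed.

Lemma sre_of_real k a : sre (of_real R k a) = a.
Proof. by case: k. Qed.

Lemma of_real_inj k : injective (of_real R k).
Proof. by move=> a b /(congr1 sre); rewrite !sre_of_real. Qed.

Lemma sreZ k a (x : scalar_field R k) : sre (of_real R k a * x) = a * sre x.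
Proof. by case: k x => //= -[c d] /=; rewrite mul0r subr0. Qed.

Lemma of_real_sre k (x : scalar_field R k) :
  x \is Num.real -> of_real R k (sre x) = x.
Proof. by case: k x => //= x xR; rewrite RRe_real. Qed.

Lemma of_real_real k a : of_real R k a \is Num.real.
Proof.
case: k => /=; first exact: (@num_real R a).
by apply/complex_realP; exists a.
Qed.

Lemma of_real_le k a b : (of_real R k a <= of_real R k b) = (a <= b).
Proof. by case: k => //=; rewrite lecR. Qed.

Lemma of_real_lt k a b : (of_real R k a < of_real R k b) = (a < b).
Proof. by case: k => //=; rewrite ltcR. Qed.

Lemma of_real_ge0 k a : (0 <= of_real R k a) = (0 <= a).
Proof. by rewrite -(rmorph0 (of_real R k)) of_real_le. Qed.

Lemma of_real_gt0 k a : (0 < of_real R k a) = (0 < a).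
Proof. by rewrite -(rmorph0 (of_real R k)) of_real_lt. Qed.

Lemma of_real_eq0 k a : (of_real R k a == 0) = (a == 0).
Proof. exact: fmorph_eq0. Qed.

Lemma conj_of_real k a : scalar_conj R k (of_real R k a) = of_real R k a.
Proof. by case: k => //; exact: conjc_real. Qed.

Lemma sre_conj k (x : scalar_field R k) : sre (scalar_conj R k x) = sre x.
Proof. by case: k x => // -[a b]. Qed.

Lemma mul_conj k (x : scalar_field R k) : x * scalar_conj R k x = `|x| ^+ 2.
Proof.
case: k x => [x|x]; last by rewrite sqr_normc.
by rewrite -normrX ger0_norm ?sqr_ge0.
Qed.

Lemma sre_le_norm k (x : scalar_field R k) : `|sre x| <= sre `|x|.
Proof.
case: k x => // x.
have -> : sre `|x| = Num.sqrt (complex.Re x ^+ 2 + complex.Im x ^+ 2).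
  exact: (congr1 (@complex.Re R) (normc_def x)).
case: x => a b /=.
by rewrite -[leLHS]sqrtr_sqr ler_wsqrtr// lerDl sqr_ge0.
Qed.

(** The coordinates of c are the values of f at 1 and at i. [real_riesz] uses this along the line
    spanned by each basis vector. *)
Lemma scalar_riesz k (f : scalar_field R k -> R) :
  (forall x y, f (x + y) = f x + f y) ->
  (forall a x, f (of_real R k a * x) = a * f x) ->
  exists c, forall x, f x = sre (x * scalar_conj R k c).
Proof.
case: k f => f fD fZ /=.
  by exists (f 1) => x; rewrite -[in LHS](mulr1 x) fZ.
exists (f 1 +i* f (0 +i* 1)%C)%C => -[x y] /=.
have -> : (x +i* y)%C = real_complex R x * 1 + real_complex R y * (0 +i* 1)%C.
  by apply/eqP; rewrite mulr1 eq_complex /=; apply/andP; split; apply/eqP; ring.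
by rewrite fD !fZ mulrN opprK.
Qed.

Section Norm.
Context (k : scalar_kind) (V : normedZmodType (scalar_field R k)).
Implicit Types (x y : V).

(** Norms take values in the scalar field itself; this real-valued copy gives access to the order,
    suprema and limits of R for both kinds of scalars. *)
Definition nm x : R := sre `|x|.

Lemma nmE x : `|x| = of_real R k (nm x).
Proof. by rewrite of_real_sre ?normr_real. Qed.

Lemma nm_ge0 x : 0 <= nm x.
Proof. by rewrite -(of_real_ge0 k) -nmE normr_ge0. Qed.

Lemma nmD x y : nm (x + y) <= nm x + nm y.
Proof. by rewrite -(of_real_le k) rmorphD /= -!nmE ler_normD. Qed.

Lemma nmN x : nm (- x) = nm x.
Proof. by rewrite /nm normrN. Qed.

Lemma nmB x y : nm (x - y) = nm (y - x).
Proof. by rewrite -nmN opprB. Qed.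

Lemma nm_eq0 x : (nm x == 0) = (x == 0).
Proof. by rewrite -(of_real_eq0 k) -nmE normr_eq0. Qed.

Lemma nm0 : nm 0 = 0.
Proof. by apply/eqP; rewrite nm_eq0. Qed.

End Norm.

Lemma nmM k (x y : scalar_field R k) : nm (x * y) = nm x * nm y.
Proof. by apply: (@of_real_inj k); rewrite rmorphM /= -!nmE normrM. Qed.

Lemma nm_conj k (x : scalar_field R k) : nm (scalar_conj R k x) = nm x.
Proof.
apply/eqP; rewrite -(@eqrXn2 _ 2%N) ?nm_ge0//; apply/eqP.
apply: (@of_real_inj k); rewrite !rmorphXn /= -!nmE -!mul_conj.
by rewrite rmorphK mulrC.
Qed.

Lemma nm_sqr k (x : scalar_field R k) : nm x ^+ 2 = sre (x * scalar_conj R k x).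
Proof.
apply: (@of_real_inj k).
rewrite mul_conj of_real_sre; last by rewrite realX ?normr_real.
by rewrite rmorphXn /= -nmE.
Qed.

Lemma nm_of_real k a : nm (of_real R k a) = `|a|.
Proof.
apply/eqP; rewrite -(@eqrXn2 _ 2%N) ?nm_ge0// nm_sqr conj_of_real -rmorphM /=.
by rewrite sre_of_real real_normK ?num_real ?expr2.
Qed.

Lemma sre_le_nm k (x : scalar_field R k) : `|sre x| <= nm x.
Proof. exact: sre_le_norm. Qed.

Lemma nmZ k (V : normedModType (scalar_field R k)) c (x : V) :
  nm (c *: x) = nm c * nm x.
Proof. by apply: (@of_real_inj k); rewrite rmorphM /= -!nmE normrZ. Qed.

Lemma nm_cvgP k (V : normedModType (scalar_field R k)) T (F : set_system T)
    {FF : Filter F} (f : T -> V) (y : V) :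
  f @ F --> y <-> forall e : R, 0 < e -> \forall t \near F, nm (f t - y) < e.
Proof.
rewrite cvgrPdistC_lt; split => h e e0.
  have := h (of_real R k e); rewrite of_real_gt0 => /(_ e0).
  by apply: filterS => t; rewrite nmE of_real_lt.
have eE : of_real R k (sre e) = e by rewrite of_real_sre ?gtr0_real.
have := h (sre e); rewrite -(of_real_gt0 k) eE => /(_ e0).
by apply: filterS => t; rewrite nmE -{2}eE of_real_lt.
Qed.

Lemma nm_cauchy k (V : completeNormedModType (scalar_field R k)) T
    (F : set_system T) {FF : ProperFilter F} (f : T -> V) :
  (forall e : R, 0 < e -> exists y, \forall t \near F, nm (f t - y) < e) ->
  cvg (f @ F).
Proof.
move=> h; apply/cauchy_cvgP/cauchyP => e e0.
have eE : of_real R k (sre e) = e by rewrite of_real_sre ?gtr0_real.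
have := h (sre e); rewrite -(of_real_gt0 k) eE => /(_ e0) [y hy].
exists y; apply: filterS hy => t; rewrite nmB => hy.
by rewrite -ball_normE /ball_ /= nmE -eE of_real_lt.
Qed.

Definition sim k : scalar_field R k -> R :=
  match k return scalar_field R k -> R with
  | RealScalars => fun=> 0
  | ComplexScalars => @complex.Im R
  end.
Arguments sim {k}.

Lemma simB k (x y : scalar_field R k) : sim (x - y) = sim x - sim y.
Proof. by case: k x y => [x y|[a b] [c d]] //=; rewrite subr0. Qed.

Lemma sim_le_nm k (x : scalar_field R k) : `|sim x| <= nm x.
Proof.
case: k x => [x|[a b]]; first by rewrite normr0 nm_ge0.
rewrite -(@ler_pXn2r _ 2%N) ?nnegrE ?nm_ge0 ?normr_ge0// real_normK ?num_real//.
by rewrite nm_sqr /= mulrN opprK -!expr2 lerDr sqr_ge0.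
Qed.

Lemma nm_le_sre_sim k (x : scalar_field R k) : nm x <= `|sre x| + `|sim x|.
Proof.
case: k x => [x|[a b]]; first by rewrite normr0 addr0.
rewrite -(@ler_pXn2r _ 2%N) ?nnegrE ?nm_ge0 ?addr_ge0// nm_sqr /= mulrN opprK.
rewrite sqrrD !real_normK ?num_real// -!expr2 addrAC.
by rewrite lerDl mulrn_wge0 ?mulr_ge0.
Qed.

Lemma scalar_cvg k T (F : set_system T) {FF : Filter F}
    (f : T -> scalar_field R k) :
  cvg ((sre \o f) @ F) -> cvg ((sim \o f) @ F) -> cvg (f @ F).
Proof.
move=> /cvg_ex[/= a ha] /cvg_ex[/= b hb].
(* An inequality instead of [sim z = b]: over real scalars [sim] is constantly 0 and the inequality
   holds whatever b is. *)
have [z [za zb]] : exists z : scalar_field R k, sre z = a /\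
    (forall x : scalar_field R k, `|sim (x - z)| <= `|sim x - b|).
  case: k f ha hb => f ha hb /=.
    by exists a; split => // x; rewrite normr0.
  by exists (a +i* b)%C; split => // -[].
apply/cvg_ex; exists z; apply/nm_cvgP => e e0.
have e20 : 0 < e / 2 by rewrite divr_gt0.
move/cvgrPdistC_lt/(_ _ e20) : ha => ha.
move/cvgrPdistC_lt/(_ _ e20) : hb => hb.
apply: filterS2 ha hb => t /= h1 h2.
apply: le_lt_trans (nm_le_sre_sim _) _; rewrite (splitr e) ltrD//.
  by rewrite sreB za.
exact: le_lt_trans (zb _) _.
Qed.

(** Completeness of the scalars, which as a [numFieldType] do not carry it, is inherited from R
    through real and imaginary parts. *)
Lemma scalar_cauchy k T (F : set_system T) {FF : ProperFilter F}
    (f : T -> scalar_field R k) :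
  (forall e : R, 0 < e -> exists y, \forall t \near F, nm (f t - y) < e) ->
  cvg (f @ F).
Proof.
have nmR (x : R^o) : nm (k := RealScalars) x = `|x| by [].
move=> h; apply: scalar_cvg; apply: (@nm_cauchy RealScalars R^o) => e e0.
  have [y hy] := h e e0; exists (sre y); apply: filterS hy => t; apply: le_lt_trans.
  by rewrite nmR /= -sreB sre_le_nm.
have [y hy] := h e e0; exists (sim y); apply: filterS hy => t; apply: le_lt_trans.
by rewrite nmR /= -simB sim_le_nm.
Qed.

(** Bolzano-Weierstrass in ultrafilter form; it is what makes rank-one operators compact. *)
Lemma scalar_bounded_ultra k T (F : set_system T) {FF : UltraFilter F}
    (f : T -> scalar_field R k) (M : R) :
  (\forall t \near F, nm (f t) <= M) -> cvg (f @ F).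
Proof.
have hR (g : T -> R) : (\forall t \near F, `|g t| <= M) -> cvg (g @ F).
  move=> gM; have := @segment_compact R (- M) M; rewrite compact_ultra.
  move=> /(_ (g @ F) (ultra_fmap _ _)) [|x [_ gx]]; last by apply/cvg_ex; exists x.
  by apply: filterS gM => t; rewrite /= in_itv /= ler_norml.
move=> fM; apply: scalar_cvg; apply: hR; apply: filterS fM => t /=; apply: le_trans.
  exact: sre_le_nm.
exact: sim_le_nm.
Qed.

End Scalars.
Arguments sre {R k}.
Arguments sim {R k}.

(** * Series of nonnegative reals *)

Section RealSeries.
Context (R : realType).
Implicit Types (u v : nat -> R).

Lemma sum_le_nneseries u N : (forall n, 0 <= u n) ->
  ((\sum_(0 <= i < N) u i)%:E <= \sum_(i <oo) (u i)%:E)%E.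
Proof.
move=> u0; rewrite -sumEFin; apply: nneseries_lim_ge => i _ _.
by rewrite lee_fin.
Qed.

Lemma nneseries_le_bound u M : (forall n, 0 <= u n) ->
  (forall N, \sum_(0 <= i < N) u i <= M) ->
  (\sum_(i <oo) (u i)%:E <= M%:E)%E.
Proof.
move=> u0 h; apply: lime_le.
  by apply: is_cvg_nneseries => n _ _; rewrite lee_fin.
by near=> n; rewrite sumEFin lee_fin.
Unshelve. all: by end_near. Qed.

Lemma cvg_nneseries u l : series u @ \oo --> l ->
  (\sum_(i <oo) (u i)%:E = l%:E)%E.
Proof.
move=> h; apply/cvg_lim => //.
rewrite [X in X @ _ --> _](_ : _ = EFin \o series u); last first.
  by apply/funext => n /=; rewrite /series /= sumEFin.
by apply: cvg_EFin => //; near=> n.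
Unshelve. all: by end_near. Qed.

(** Bridge between the two kinds of sums in use: series in [\bar R], where double sums can be
    exchanged, and limits of partial sums in R. *)
Lemma nneseries_cvg u : (forall n, 0 <= u n) ->
  (\sum_(i <oo) (u i)%:E < +oo)%E ->
  exists2 l, series u @ \oo --> l & (\sum_(i <oo) (u i)%:E = l%:E)%E.
Proof.
move=> u0 uoo.
have : cvg (series u @ \oo).
  apply: nondecreasing_is_cvgn.
    by apply/nondecreasing_seqP => n; rewrite seriesSr lerDl.
  exists (fine (\sum_(i <oo) (u i)%:E)%E) => _ [n _ <-].
  rewrite -lee_fin fineK ?sum_le_nneseries//.
  rewrite ge0_fin_numE//; apply: nneseries_ge0 => i _ _.
  by rewrite lee_fin.
by move=> /cvg_ex[l ul]; exists l => //; exact: cvg_nneseries.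
Qed.

Lemma nneseries_lt_bound u : (forall n, 0 <= u n) ->
  (\sum_(i <oo) (u i)%:E < +oo)%E ->
  exists2 M, 0 <= M & forall N, \sum_(0 <= i < N) u i <= M.
Proof.
move=> u0 /(nneseries_cvg u0)[l _ ul].
have lN N : \sum_(0 <= i < N) u i <= l by rewrite -lee_fin -ul sum_le_nneseries.
by exists l => //; have := lN 0%N; rewrite big_geq.
Qed.

Lemma nneseries_lty u M : (forall n, 0 <= u n) ->
  (forall N, \sum_(0 <= i < N) u i <= M) -> (\sum_(i <oo) (u i)%:E < +oo)%E.
Proof. by move=> u0 /(nneseries_le_bound u0)/le_lt_trans; apply; rewrite ltry. Qed.

End RealSeries.

(** * Hilbert spaces and orthonormal bases *)

Section Hilbert.
Context (R : realType) (k : scalar_kind).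
Local Notation K := (scalar_field R k).
Local Notation cj := (scalar_conj R k).
Local Notation rc := (of_real R k).

Lemma le_sre (x y : K) : x <= y -> sre x <= sre y.
Proof.
move=> xy; have := xy; rewrite -subr_ge0 => h.
by rewrite -subr_ge0 -sreB -(of_real_ge0 k) of_real_sre ?ger0_real.
Qed.

Section LinearMaps.
Context (V W : lmodType K) (A : V -> W) (lA : linear A).

Lemma linD x y : A (x + y) = A x + A y.
Proof. by have := lA 1 x y; rewrite !scale1r. Qed.

Lemma lin0 : A 0 = 0.
Proof. by have := linD 0 0; rewrite addr0 => /eqP; rewrite -subr_eq subrr => /eqP <-. Qed.

Lemma linZ c x : A (c *: x) = c *: A x.
Proof. by have := lA c x 0; rewrite lin0 !addr0. Qed.

Lemma linN x : A (- x) = - A x.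
Proof. by rewrite -scaleN1r linZ scaleN1r. Qed.

Lemma linB x y : A (x - y) = A x - A y.
Proof. by rewrite linD linN. Qed.

Lemma lin_sum I (r : seq I) (P : pred I) (F : I -> V) :
  A (\sum_(i <- r | P i) F i) = \sum_(i <- r | P i) A (F i).
Proof. by apply: big_morph; [exact: linD|exact: lin0]. Qed.

End LinearMaps.

Context (H : completeNormedModType K) (dot : {dot H for @scalar_conj R k}).
Implicit Types (x y z : H) (c : K) (a : R) (e : nat -> H) (A B : H -> H).

Lemma dotDl x y z : dot (x + y) z = dot x z + dot y z.
Proof. exact: linearDl. Qed.
Lemma dotDr x y z : dot x (y + z) = dot x y + dot x z.
Proof. exact: linearDr. Qed.
Lemma dotNl x y : dot (- x) y = - dot x y.
Proof. exact: linearNl. Qed.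
Lemma dotNr x y : dot x (- y) = - dot x y.
Proof. exact: linearNr. Qed.
Lemma dotBl x y z : dot (x - y) z = dot x z - dot y z.
Proof. exact: linearBl. Qed.
Lemma dotBr x y z : dot x (y - z) = dot x y - dot x z.
Proof. exact: linearBr. Qed.
Lemma dotZl c x y : dot (c *: x) y = c * dot x y.
Proof. exact: linearZl_LR. Qed.
Lemma dotZr c x y : dot x (c *: y) = cj c * dot x y.
Proof. exact: linearZr_LR. Qed.
Lemma dot0l x : dot 0 x = 0.
Proof. exact: linear0l. Qed.
Lemma dot0r x : dot x 0 = 0.
Proof. exact: linear0r. Qed.
Lemma dotC x y : dot x y = cj (dot y x).
Proof. by rewrite hermC expr0 mul1r. Qed.
Lemma dot_suml I (r : seq I) (P : pred I) (F : I -> H) y :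
  dot (\sum_(i <- r | P i) F i) y = \sum_(i <- r | P i) dot (F i) y.
Proof. by apply: (big_morph (dot^~ y)) => [u v|]; rewrite ?dotDl ?dot0l. Qed.
Lemma dot_sumr I (r : seq I) (P : pred I) (F : I -> H) y :
  dot y (\sum_(i <- r | P i) F i) = \sum_(i <- r | P i) dot y (F i).
Proof. by apply: (big_morph (dot y)) => [u v|]; rewrite ?dotDr ?dot0r. Qed.

Lemma sre_dotC x y : sre (dot x y) = sre (dot y x).
Proof. by rewrite dotC sre_conj. Qed.

Lemma nm_dotC x y : nm (dot x y) = nm (dot y x).
Proof. by rewrite dotC nm_conj. Qed.

Context (dot_norm : norm_from_dot dot).

Lemma dotxx x : dot x x = rc (nm x ^+ 2).
Proof. by rewrite -dot_norm rmorphXn /= -nmE. Qed.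

Lemma sre_dotxx x : sre (dot x x) = nm x ^+ 2.
Proof. by rewrite dotxx sre_of_real. Qed.

Lemma dotxx_eq0 x : dot x x = 0 -> x = 0.
Proof.
by move=> /eqP; rewrite dotxx of_real_eq0 sqrf_eq0 nm_eq0 => /eqP.
Qed.

Lemma nm_sqrD x y : nm (x + y) ^+ 2 = nm x ^+ 2 + nm y ^+ 2 + 2 * sre (dot x y).
Proof.
rewrite -!sre_dotxx dotDl !dotDr !sreD (sre_dotC y x); ring.
Qed.

Lemma nm_sqrB x y : nm (x - y) ^+ 2 = nm x ^+ 2 + nm y ^+ 2 - 2 * sre (dot x y).
Proof. by rewrite nm_sqrD nmN dotNr sreN mulrN. Qed.

Lemma cauchy_schwarz x y : nm (dot x y) <= nm x * nm y.
Proof.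
have [->|y0] := eqVneq y 0; first by rewrite dot0r !nm0 mulr0.
have ny : 0 < nm y by rewrite lt_def nm_ge0 nm_eq0 y0.
(* The vector is x minus its orthogonal projection on the line of y. *)
have := sqr_ge0 (nm (x - (rc (nm y ^- 2) * dot x y) *: y)).
rewrite nm_sqrB dotZr rmorphM /= conj_of_real -mulrA sreZ nmZ nmM nm_of_real.
rewrite [cj _ * _]mulrC -nm_sqr ger0_norm ?invr_ge0 ?sqr_ge0// => h.
rewrite -(@ler_pXn2r _ 2%N) ?nnegrE ?mulr_ge0 ?nm_ge0// exprMn.
rewrite -ler_pdivrMr ?exprn_gt0//.
rewrite -subr_ge0; apply: le_trans h _; rewrite le_eqVlt; apply/orP; left; apply/eqP.
by field; rewrite gt_eqF.
Qed.

Lemma sre_dot_le x y : `|sre (dot x y)| <= nm x * nm y.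
Proof. exact: le_trans (sre_le_nm _) (cauchy_schwarz _ _). Qed.

Lemma dot_cvgl T (F : set_system T) {FF : Filter F} (f : T -> H) x y :
  f @ F --> x -> (fun t => dot (f t) y) @ F --> dot x y.
Proof.
move=> /nm_cvgP fx; apply/(@nm_cvgP R k K^o) => d d0.
have y0 : 0 < nm y + 1 by rewrite ltr_wpDl ?nm_ge0.
have := fx (d / (nm y + 1)); rewrite divr_gt0// => /(_ isT).
apply: filterS => t; rewrite ltr_pdivlMr// => h.
rewrite -dotBl; apply: le_lt_trans (cauchy_schwarz _ _) _; apply: le_lt_trans h.
by rewrite ler_wpM2l ?nm_ge0// lerDl.
Qed.

Lemma sre_cvg T (F : set_system T) {FF : Filter F} (f : T -> K) c :
  f @ F --> c -> (fun t => sre (f t)) @ F --> sre c.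
Proof.
move=> /(@nm_cvgP R k K^o) h; apply/cvgrPdistC_lt => d d0.
have := h _ d0; apply: filterS => t; apply: le_lt_trans.
by rewrite -sreB; exact: sre_le_nm.
Qed.

Lemma nm_cvg T (F : set_system T) {FF : Filter F} (f : T -> H) x :
  f @ F --> x -> (fun t => nm (f t)) @ F --> nm x.
Proof.
move=> /nm_cvgP h; apply/cvgrPdistC_lt => d d0.
have := h _ d0; apply: filterS => t; apply: le_lt_trans.
have h1 := nmD (f t - x) x; have h2 := nmD (x - f t) (f t).
rewrite subrK in h1; rewrite subrK nmB in h2.
rewrite ler_norml; apply/andP; split; lra.
Qed.

Lemma cvg_uniq (V : normedModType K) T (F : set_system T) {FF : ProperFilter F}
    (f : T -> V) (x y : V) :
  f @ F --> x -> f @ F --> y -> x = y.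
Proof. by move=> fx fy; apply: cvg_unique fx fy; exact: norm_hausdorff. Qed.

(** A bound with a named real constant. Its sign is left free, hence the occurrences of |C| in later
    bounds; C can be negative only if H is trivial. *)
Definition bounded_by (C : R) A := linear A /\ forall x, nm (A x) <= C * nm x.

Lemma bounded_opP A : bounded_op A <-> exists2 C, 0 <= C & bounded_by C A.
Proof.
split=> [[lA [M hM]]|[C C0 [lA hC]]].
  exists (nm M); first exact: nm_ge0.
  split=> // x; have /le_sre := hM x; rewrite nmE [`|x|]nmE sre_of_real mulrC sreZ.
  move=> /le_trans; apply; rewrite mulrC ler_wpM2r ?nm_ge0//.
  exact: le_trans (ler_norm _) (sre_le_nm _).
by split => //; exists (rc C) => x; rewrite !nmE -rmorphM /= of_real_le.
Qed.

Lemma bounded_cvg C A T (F : set_system T) {FF : Filter F} (f : T -> H) x :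
  bounded_by C A -> f @ F --> x -> (fun t => A (f t)) @ F --> A x.
Proof.
move=> [lA AC] /nm_cvgP fx; apply/nm_cvgP => d d0.
have C0 : 0 < `|C| + 1 by rewrite ltr_wpDl.
have := fx (d / (`|C| + 1)); rewrite divr_gt0// => /(_ isT).
apply: filterS => t; rewrite ltr_pdivlMr// => h.
rewrite -linB//; apply: le_lt_trans (AC _) _; apply: le_lt_trans h.
by rewrite mulrC ler_wpM2l ?nm_ge0// (le_trans (ler_norm _))// lerDl.
Qed.

(** Since zero terms are allowed, [dot (e n) (e n)] is 0 or 1; this is the factor that accompanies
    coordinates in the lemmas below. *)
Definition ons e := (forall i j, i != j -> dot (e i) (e j) = 0) /\
  (forall i, e i = 0 \/ dot (e i) (e i) = 1).

Lemma onb_ons e : orthonormal_basis dot e -> ons e.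
Proof. by case. Qed.

Section Ons.
Context (e : nat -> H) (e_ons : ons e).
Implicit Type (s : nat -> K).

Lemma ons_dotxx x n : dot x (e n) * dot (e n) (e n) = dot x (e n).
Proof. by have [->|->] := e_ons.2 n; rewrite ?dot0r ?mulr0 ?mulr1. Qed.

Lemma ons_nm_le1 n : nm (e n) <= 1.
Proof.
have [->|h] := e_ons.2 n; first by rewrite nm0.
rewrite -(@ler_pXn2r _ 2%N) ?nnegrE ?nm_ge0// -sre_dotxx h.
by rewrite -(rmorph1 rc) sre_of_real expr1n.
Qed.

Lemma ons_dot_sum s n m : dot (\sum_(0 <= i < n) s i *: e i) (e m) =
  if (m < n)%N then s m * dot (e m) (e m) else 0.
Proof.
elim: n => [|n IH]; first by rewrite big_geq// dot0l.
rewrite big_nat_recr//= dotDl IH dotZl ltnS [in RHS]leq_eqVlt.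
have [->|nm_] := eqVneq m n; first by rewrite ltnn add0r.
by rewrite /= (e_ons.1 n m) 1?eq_sym// mulr0 addr0.
Qed.

Lemma ons_nm_sum s n : nm (\sum_(0 <= i < n) s i *: e i) ^+ 2 =
  \sum_(0 <= i < n) nm (s i) ^+ 2 * nm (e i) ^+ 2.
Proof.
elim: n => [|n IH]; first by rewrite !big_geq// nm0 expr0n.
rewrite big_nat_recr//= nm_sqrD IH dotZr ons_dot_sum ltnn mulr0 sre0 mulr0 addr0.
by rewrite big_nat_recr//= nmZ exprMn.
Qed.

Lemma ons_nm_sum_le s n : nm (\sum_(0 <= i < n) s i *: e i) ^+ 2 <=
  \sum_(0 <= i < n) nm (s i) ^+ 2.
Proof.
rewrite ons_nm_sum; apply: ler_sum => i _.
by rewrite ler_piMr ?sqr_ge0// expr_le1// ?ons_nm_le1// nm_ge0.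
Qed.

Lemma ons_nm_tail s m n : (m <= n)%N ->
  nm (\sum_(0 <= i < n) s i *: e i - \sum_(0 <= i < m) s i *: e i) ^+ 2 <=
  \sum_(0 <= i < n) nm (s i) ^+ 2 - \sum_(0 <= i < m) nm (s i) ^+ 2.
Proof.
(* Replacing the first m coefficients by 0 turns the tail into an initial sum, to which
   [ons_nm_sum_le] applies. *)
move=> mn; pose s' i := if (i < m)%N then 0 else s i.
have E (V : zmodType) (f : nat -> V) (g : nat -> V) :
  (forall i, g i = if (i < m)%N then 0 else f i) ->
  \sum_(0 <= i < n) f i - \sum_(0 <= i < m) f i = \sum_(0 <= i < n) g i.
  move=> gE; rewrite (big_cat_nat (leq0n m) mn) [in RHS](big_cat_nat (leq0n m) mn)/=.
  rewrite addrAC subrr add0r [X in _ = X + _]big_nat [X in _ = X + _]big1 ?add0r; last first.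
    by move=> i /andP[_ im]; rewrite gE im.
  by apply: eq_big_nat => i /andP[mi _]; rewrite gE ltnNge mi.
rewrite (E _ _ (fun i => s' i *: e i)); last by move=> i; rewrite /s'; case: ifP; rewrite ?scale0r.
rewrite (E _ _ (fun i => nm (s' i) ^+ 2)); first exact: ons_nm_sum_le.
by move=> i; rewrite /s'; case: ifP => //; rewrite nm0 expr0n.
Qed.

Lemma bessel_eq x n :
  nm (x - \sum_(0 <= i < n) dot x (e i) *: e i) ^+ 2 =
  nm x ^+ 2 - \sum_(0 <= i < n) nm (dot x (e i)) ^+ 2.
Proof.
rewrite nm_sqrB ons_nm_sum dot_sumr sre_sum.
have -> : \sum_(0 <= i < n) nm (dot x (e i)) ^+ 2 * nm (e i) ^+ 2 =
          \sum_(0 <= i < n) nm (dot x (e i)) ^+ 2.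
  apply: eq_bigr => i _.
  have [->|h] := e_ons.2 i; first by rewrite dot0r !nm0 expr0n mulr0.
  by rewrite -[nm (e i) ^+ 2]sre_dotxx h -(rmorph1 rc) sre_of_real mulr1.
have -> : \sum_(0 <= i < n) sre (dot x (dot x (e i) *: e i)) =
          \sum_(0 <= i < n) nm (dot x (e i)) ^+ 2.
  by apply: eq_bigr => i _; rewrite dotZr mulrC nm_sqr.
by ring.
Qed.

Lemma bessel x n : \sum_(0 <= i < n) nm (dot x (e i)) ^+ 2 <= nm x ^+ 2.
Proof. by rewrite -subr_ge0 -bessel_eq sqr_ge0. Qed.

(** The place where completeness of H enters. Constructions by coordinates all rest on it: diagonal
    operators, the Douglas factor, Riesz representatives. *)
Lemma riesz_fischer s M : (forall n, \sum_(0 <= i < n) nm (s i) ^+ 2 <= M) ->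
  exists y, [/\ series (fun i => s i *: e i) @ \oo --> y,
    forall m, dot y (e m) = s m * dot (e m) (e m) & nm y ^+ 2 <= M].
Proof.
move=> sM.
have sq0 i : 0 <= nm (s i) ^+ 2 by exact: sqr_ge0.
have [l ul ule] := nneseries_cvg sq0 (nneseries_lty sq0 sM).
have Sl n : \sum_(0 <= i < n) nm (s i) ^+ 2 <= l.
  by rewrite -lee_fin -ule sum_le_nneseries.
have : cvg (series (fun i => s i *: e i) @ \oo).
  apply: nm_cauchy => d d0.
  move/cvgrPdist_lt : ul => /(_ (d ^+ 2)); rewrite exprn_gt0// => /(_ isT)[N _ hN].
  exists (series (fun i => s i *: e i) N); exists N => // n /= Nn.
  rewrite -(@ltr_pXn2r _ 2%N) ?nnegrE ?nm_ge0 ?ltW//.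
  apply: le_lt_trans (ons_nm_tail s Nn) _.
  apply: le_lt_trans (hN N (leqnn N)); rewrite ger0_norm ?subr_ge0 ?Sl//.
  by rewrite lerD2r Sl.
move=> /cvg_ex[y yl]; exists y; split => // [m|].
  apply: (cvg_uniq (V := K^o) (dot_cvgl (y := e m) yl)).
  apply: cvg_near_cst; exists m.+1 => // n /= mn.
  by rewrite ons_dot_sum mn.
rewrite expr2; apply: cvgr_to_le (cvgM (nm_cvg yl) (nm_cvg yl)) _.
by near=> n; rewrite /= -expr2 (le_trans (ons_nm_sum_le _ _)).
Unshelve. all: by end_near. Qed.

End Ons.

Section Onb.
Context (e : nat -> H) (e_onb : orthonormal_basis dot e).
Let e_ons := onb_ons e_onb.

Lemma onb_ext x y : (forall n, dot x (e n) = dot y (e n)) -> x = y.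
Proof.
case: e_onb => _ _ h xy; apply/eqP; rewrite -subr_eq0; apply/eqP/h => n.
by rewrite dotBl xy subrr.
Qed.

(** The series converges by Bessel and Riesz-Fischer; its limit has the coordinates of x, and
    maximality of the system identifies the two. *)
Lemma onb_expand x : series (fun n => dot x (e n) *: e n) @ \oo --> x.
Proof.
have [y [yl ye _]] := riesz_fischer e_ons (bessel e_ons x).
suff yx : y = x by rewrite -[X in _ --> X]yx.
by apply: onb_ext => n; rewrite ye ons_dotxx.
Qed.

Lemma parseval_cvg x : series (fun n => nm (dot x (e n)) ^+ 2) @ \oo --> nm x ^+ 2.
Proof.
have h := @onb_expand x.
apply/cvgrPdist_lt => d d0.
move/nm_cvgP: h => /(_ (Num.sqrt d)); rewrite sqrtr_gt0 => /(_ d0).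
apply: filterS => n; rewrite nmB -(@ltr_pXn2r _ 2%N) ?nnegrE ?nm_ge0 ?sqrtr_ge0//.
rewrite sqr_sqrtr ?ltW// bessel_eq// => h.
by rewrite ger0_norm// subr_ge0 bessel.
Qed.

Lemma parseval x : (\sum_(n <oo) (nm (dot x (e n)) ^+ 2)%:E = (nm x ^+ 2)%:E)%E.
Proof. exact: cvg_nneseries (@parseval_cvg x). Qed.

Lemma bounded_onb_ext C D A B : bounded_by C A -> bounded_by D B ->
  (forall n, A (e n) = B (e n)) -> A = B.
Proof.
move=> bA bB AB; apply/funext => x.
apply: cvg_uniq (bounded_cvg bA (@onb_expand x)) _.
rewrite (_ : (fun _ => _) = fun n => B (series (fun n => dot x (e n) *: e n) n)).
  exact: bounded_cvg bB (@onb_expand x).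
apply/funext => n; rewrite /series/= (lin_sum bA.1) (lin_sum bB.1).
by apply: eq_bigr => i _; rewrite (linZ bA.1) (linZ bB.1) AB.
Qed.

End Onb.

End Hilbert.

(** * Compact operators and the spectral theorem *)

Section Compactness.
Context (R : realType) (k : scalar_kind).
Local Notation K := (scalar_field R k).
Local Notation cj := (scalar_conj R k).
Local Notation rc := (of_real R k).
Context (H : completeNormedModType K) (dot : {dot H for @scalar_conj R k}).
Context (dot_norm : norm_from_dot dot).
Implicit Types (x y z : H) (c : K) (a : R) (e : nat -> H) (A B : H -> H).

Lemma norm_le1 x : (`|x| <= 1) = (nm x <= 1).
Proof. by rewrite nmE -(rmorph1 rc) of_real_le. Qed.

Lemma nbhs_nmP x (B : set H) :
  nbhs x B <-> exists2 d, 0 < d & forall y, nm (y - x) < d -> B y.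
Proof.
split=> [/nbhs_ballP[d /= d0 dB]|[d d0 dB]].
  have dE : rc (sre d) = d by rewrite of_real_sre ?gtr0_real.
  exists (sre d); first by rewrite -(of_real_gt0 k) dE.
  by move=> y yx; apply: dB; rewrite -ball_normE /ball_ /= nmE nmB -dE of_real_lt.
apply/nbhs_ballP; exists (rc d); rewrite /= ?of_real_gt0// => y.
by rewrite -ball_normE /ball_ /= nmE nmB of_real_lt => /dB.
Qed.

Lemma ultra_ex T (F : set_system T) {FU : UltraFilter F} (P Q : set T) :
  F P -> F Q -> exists2 x, P x & Q x.
Proof. by move=> FP FQ; have [x [Px Qx]] := filter_ex (filterI FP FQ); exists x. Qed.

(** Ultrafilters play the role of bounded sequences: compactness means that images of ultrafilters
    on the unit ball converge, so no subsequence is ever extracted. *)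
Lemma compact_op_ultra A : compact_op A <-> linear A /\
  forall F : set_system H, UltraFilter F -> F [set x | nm x <= 1] -> cvg (A @ F).
Proof.
rewrite /compact_op precompactE compact_ultra /=.
set S := A @` _; split=> -[lA h]; split=> //.
  move=> F FU FB; have FS : F (A @^-1` closure S).
    apply: filterS FB => x /= x1; apply: subset_closure; exists x => //=.
    by rewrite norm_le1.
  have [p [_ pA]] := h (A @ F) (ultra_fmap A FU) FS.
  by apply/cvg_ex; exists p.
move=> G GU GS.
(* [G] contains [closure S] but possibly not [S], so it cannot be pulled back along A directly.
   Thickening each member U by some d > 0 makes the preimages in the unit ball nonempty. *)
pose base (Ud : set H * R) := [set x | nm x <= 1 /\ exists2 u, Ud.1 u & nm (A x - u) < Ud.2].
pose F0 := filter_from [set Ud : set H * R | G Ud.1 /\ 0 < Ud.2] base.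
have F0P : ProperFilter F0.
  apply: filter_from_proper; first apply: filter_from_filter.
  - by exists (setT, 1); split => //; exact: filterT.
  - move=> [U d] [U' d'] [/= GU1 d0] [/= GU' d'0].
    exists (U `&` U', Num.min d d'); first by split => /=; [exact: filterI|rewrite lt_min d0].
    move=> x [x1 [u [Uu U'u]]] /=; rewrite lt_min => /andP[h1 h2].
    by split; split => //; exists u.
  - move=> [U d] [/= GU1 d0]; have [u Uu Su] := ultra_ex GU1 GS.
    have [|_ [[x /= x1 <-] xu]] := Su [set y | nm (y - u) < d].
      by apply/nbhs_nmP; exists d.
    by exists x; split; [rewrite -norm_le1|exists u].
have [F [FU F0F]] := ultraFilterLemma F0P.
have F1 : F [set x | nm x <= 1].
  apply: F0F; exists (setT, 1); first by split => //; exact: filterT.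
  by move=> x [].
have /cvg_ex[p Ap] := h F FU F1.
exists p; split.
  move=> B /Ap FB; have [x /= x1 Bx] := ultra_ex F1 (FB : F (A @^-1` B)).
  by exists (A x); split => //; exists x => //=; rewrite norm_le1.
move=> B /nbhs_nmP[d d0 dB].
have [//|GnB] := in_ultra_setVsetC B GU.
have d20 : 0 < d / 2 by rewrite divr_gt0.
have FB : F (base (~` B, d / 2)) by apply: F0F; exists (~` B, d / 2).
have /Ap Fp : nbhs p [set y | nm (y - p) < d / 2] by apply/nbhs_nmP; exists (d / 2).
have [x [_ [u nBu /= xu]] /= xp] := ultra_ex FB (Fp : F (A @^-1` _)).
exfalso; apply: nBu; apply: dB; rewrite (splitr d).
have -> : u - p = (u - A x) + (A x - p) by rewrite addrA subrK.
by apply: le_lt_trans (nmD _ _) _; rewrite ltrD// nmB.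
Qed.

Lemma scale_cvg T (F : set_system T) {FF : Filter F} (f : T -> H) c x :
  f @ F --> x -> (fun t => c *: f t) @ F --> c *: x.
Proof.
apply: (@bounded_cvg _ _ _ (nm c) (fun x => c *: x)).
by split=> [d y z|y]; rewrite ?nmZ// scalerDr !scalerA mulrC.
Qed.

Lemma ultra_bounded_cvg A F M : UltraFilter F -> compact_op A ->
  F [set x | nm x <= M] -> cvg (A @ F).
Proof.
move=> FU /compact_op_ultra[lA h] FM.
pose N := `|M| + 1; have N0 : 0 < N by rewrite ltr_wpDl.
pose g x := rc N^-1 *: x.
have /cvg_ex[p gp] : cvg (A @ (g @ F)).
  apply: h; first exact: ultra_fmap.
  suff : F (g @^-1` [set x | nm x <= 1]) by [].
  apply: filterS FM => x /= xM; rewrite /g nmZ nm_of_real ger0_norm ?invr_ge0 ?(ltW N0)//.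
  rewrite mulrC ler_pdivrMr// mul1r (le_trans xM)// (le_trans (ler_norm _))//.
  by rewrite lerDl.
apply/cvg_ex; exists (rc N *: p).
have -> : A = (fun x => rc N *: A (g x)).
  apply/funext => x; rewrite /g (linZ lA) scalerA -rmorphM /=.
  by rewrite mulfV ?gt_eqF// rmorph1 scale1r.
exact: (@scale_cvg _ _ _ (A \o g)).
Qed.

(** Otherwise there are u n in the unit ball with |A (u n)| > n; along an ultrafilter that refines
    the filter at infinity the images would converge, with bounded norms. *)
Lemma compact_op_bounded A : compact_op A -> exists2 C, 0 <= C & bounded_by C A.
Proof.
move=> cA; have lA := cA.1; apply: contrapT => h.
have bad n : exists x, nm x <= 1 /\ n%:R < nm (A x).
  apply: contrapT => /forallNP hn; apply: h; exists n%:R => //; split=> // x.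
  have [->|x0] := eqVneq x 0; first by rewrite (lin0 lA) !nm0 mulr0.
  have nx : 0 < nm x by rewrite lt_def nm_ge0 nm_eq0 x0.
  have nE : nm (rc (nm x)^-1 *: x) = 1.
    by rewrite nmZ nm_of_real ger0_norm ?invr_ge0 ?ltW// mulVf ?gt_eqF.
  have := hn (rc (nm x)^-1 *: x); rewrite nE lexx (linZ lA) nmZ nm_of_real.
  rewrite ger0_norm ?invr_ge0 ?(ltW nx)// => /not_andP[//|/negP]; rewrite -leNgt mulrC.
  by rewrite ler_pdivrMr.
have [u hu] := choice bad.
have [G [GU oG]] := ultraFilterLemma (@eventually_filter).
have : cvg (A @ (u @ G)).
  move/compact_op_ultra : cA => [_]; apply; first exact: ultra_fmap.
  suff : G (u @^-1` [set x | nm x <= 1]) by [].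
  by apply: filterS filterT => n _ /=; exact: (hu n).1.
move=> /cvg_ex[p] /nm_cvg /cvgrPdistC_lt/(_ 1 ltr01) Gp.
have Gn : G [set n | (Num.Def.archi_bound (nm p + 1) <= n)%N].
  by apply: oG; exists (Num.Def.archi_bound (nm p + 1)).
have [n /= h1 h2] := ultra_ex (Gp : G (u @^-1` _)) Gn.
have := (hu n).2; apply/negP; rewrite -leNgt.
have /archi_boundP h3 : 0 <= nm p + 1 by rewrite addr_ge0 ?nm_ge0.
apply: (@le_trans _ _ (nm p + 1)); last first.
  by apply: le_trans (ltW h3) _; rewrite ler_nat.
by rewrite -lerBlDl (le_trans (ler_norm _))// ltW.
Qed.

Lemma compact_opD A B : compact_op A -> compact_op B -> compact_op (A + B).
Proof.
move=> cA cB; apply/compact_op_ultra; split.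
  move=> c x y; rewrite !fctE cA.1 cB.1 scalerDr.
  by rewrite addrACA.
move=> F FU F1; apply: is_cvgD; exact: ultra_bounded_cvg F1.
Qed.

Lemma compact_op_compl A B C : compact_op A -> bounded_by C B -> compact_op (B \o A).
Proof.
move=> cA bB; apply/compact_op_ultra; split.
  by move=> c x y /=; rewrite cA.1 bB.1.
move=> F FU /(ultra_bounded_cvg FU cA)/cvg_ex[p Ap].
by apply/cvg_ex; exists (B p); exact: bounded_cvg bB Ap.
Qed.

Lemma compact_op_compr A B C : compact_op A -> bounded_by C B -> compact_op (A \o B).
Proof.
move=> cA bB; apply/compact_op_ultra; split.
  by move=> c x y /=; rewrite bB.1 cA.1.
move=> F FU F1; apply: (@ultra_bounded_cvg A (B @ F) `|C| _ cA).
  exact: ultra_fmap.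
suff : F (B @^-1` [set x | nm x <= `|C|]) by [].
apply: filterS F1 => x /= x1; apply: le_trans (bB.2 _) _.
apply: le_trans (ler_wpM2r (nm_ge0 _) (ler_norm _)) _.
by rewrite -[leRHS]mulr1 ler_wpM2l.
Qed.

Lemma compact_opZ A c : compact_op A -> compact_op (fun x => c *: A x).
Proof.
move=> cA; apply: (@compact_op_compl A (fun x => c *: x) (nm c) cA).
split; first by move=> d x y; rewrite scalerDr !scalerA mulrC.
by move=> x; rewrite nmZ.
Qed.

Lemma compact_op0 : compact_op (fun=> 0 : H).
Proof.
apply/compact_op_ultra; split; first by move=> c x y; rewrite scaler0 addr0.
by move=> F FU _; exact: is_cvg_cst.
Qed.

(* |S x|^2 = <x, S (S x)> *)
Lemma compact_op_sqrt S C : selfadjoint dot S -> bounded_by C S ->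
  compact_op (S \o S) -> compact_op S.
Proof.
move=> sS bS cS; apply/compact_op_ultra; split; first exact: bS.1.
move=> F FU F1; apply: nm_cauchy => d d0.
have /cvg_ex[p Sp] := ultra_bounded_cvg FU cS F1.
have d1 : 0 < d ^+ 2 / 4 by rewrite divr_gt0// exprn_gt0.
have Fp : F [set t | nm ((S \o S) t - p) < d ^+ 2 / 4] by move/nm_cvgP : Sp; exact.
have [x0 h0 /= x01] := ultra_ex Fp F1.
exists (S x0); apply: filterS (filterI Fp F1) => x [/= h1 x1].
rewrite -(@ltr_pXn2r _ 2%N) ?nnegrE ?nm_ge0 ?ltW// -(linB bS.1) -(sre_dotxx dot_norm) sS.
apply: le_lt_trans (ler_norm _) _; apply: le_lt_trans (sre_dot_le dot_norm _ _) _.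
rewrite (linB bS.1) (linB bS.1).
have n1 : nm (S (S x) - S (S x0)) < d ^+ 2 / 2.
  have -> : S (S x) - S (S x0) = (S (S x) - p) + (p - S (S x0)) by rewrite addrA subrK.
  apply: le_lt_trans (nmD _ _) _; rewrite [nm (p - _)]nmB.
  by rewrite /= in h0 h1; lra.
have n2 : nm (x - x0) <= 2 by apply: le_trans (nmD _ _) _; rewrite nmN; lra.
have n3 := nm_ge0 (S (S x) - S (S x0)); have n4 := nm_ge0 (x - x0).
by nra.
Qed.

Section Eigenvector.
Variables (A : H -> H) (cA : compact_op A) (sA : selfadjoint dot A).
Variables (M : set H).
Let L x := forall m, M m -> dot x m = 0.
Hypothesis (L_stable : forall x, L x -> L (A x)).

Let L_lin c x y : L x -> L y -> L (c *: x + y).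
Proof. by move=> Lx Ly m Mm; rewrite dotDl dotZl Lx// Ly// mulr0 addr0. Qed.

(** Let s be the supremum of |A x| over the unit ball of the stable subspace [L]. Along an
    ultrafilter of near-maximizers A x tends to some y with |y| = s, and A (A x) - s^2 x tends to 0,
    so A (A y) = s^2 y. Since A^2 - s^2 = (A - s) (A + s), either A y + s y is an eigenvector for s,
    or it vanishes and y is one for -s. If s = 0, x0 itself serves. *)
Lemma eigenvector_exists x0 : L x0 -> x0 != 0 ->
  exists (a : R) z, [/\ L z, z != 0 & A z = rc a *: z].
Proof.
move=> Lx0 x00; have lA := cA.1.
have [C C0 [_ AC]] := compact_op_bounded cA.
pose E := [set nm (A x) | x in [set x | L x /\ nm x <= 1]].
have L0 : L 0 by move=> m _; rewrite dot0l.
have E0 : E 0 by exists 0; rewrite ?(lin0 lA) ?nm0//; split => //; rewrite nm0.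
have Eub : has_ubound E.
  exists C => _ [x [_ x1] <-]; apply: le_trans (AC _) _.
  by rewrite -[leRHS]mulr1 ler_wpM2l.
have Esup : has_sup E by split => //; exists 0.
set s := sup E.
have s0 : 0 <= s by exact: ub_le_sup.
have As x : L x -> nm (A x) <= s * nm x.
  move=> Lx; have [->|xn0] := eqVneq x 0; first by rewrite (lin0 lA) !nm0 mulr0.
  have nx : 0 < nm x by rewrite lt_def nm_ge0 nm_eq0 xn0.
  have : E (nm (A (rc (nm x)^-1 *: x))).
    exists (rc (nm x)^-1 *: x) => //; split.
      by rewrite -[_ *: _]addr0; exact: L_lin.
    by rewrite nmZ nm_of_real ger0_norm ?invr_ge0 ?nm_ge0// mulVf ?gt_eqF.
  move=> /(ub_le_sup Eub); rewrite -/s (linZ lA) nmZ nm_of_real.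
  by rewrite ger0_norm ?invr_ge0 ?nm_ge0// mulrC ler_pdivrMr.
have [s_eq0|sn0] := eqVneq s 0.
  exists 0, x0; split => //; rewrite rmorph0 scale0r; apply/eqP.
  by rewrite -nm_eq0 eq_le nm_ge0 andbT; have := As _ Lx0; rewrite s_eq0 mul0r.
have spos : 0 < s by rewrite lt_def sn0.
pose base d := [set x | [/\ L x, nm x <= 1 & s - d < nm (A x)]].
pose F0 := filter_from [set d : R | 0 < d] base.
have F0P : ProperFilter F0.
  apply: filter_from_proper; first apply: filter_from_filter.
  - by exists 1 => /=.
  - move=> d d' /= d0 d'0; exists (Num.min d d') => /=; first by rewrite lt_min d0.
    move=> x [Lx x1 h]; split; split => //; apply: le_lt_trans h; rewrite lerD2l lerN2.
      by rewrite ge_min lexx.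
    by rewrite ge_min lexx orbT.
  - move=> d /= d0; have [_ [x [Lx x1] <-] h] := sup_adherent d0 Esup.
    by exists x; split.
have [F [FU F0F]] := ultraFilterLemma F0P.
have Fd d : 0 < d -> F (base d) by move=> d0; apply: F0F; exists d.
have F1 : F [set x | nm x <= 1] by apply: filterS (Fd 1 ltr01) => x [].
have /cvg_ex[y Ay] := ultra_bounded_cvg FU cA F1.
have A_cvg (f : H -> H) z : f @ F --> z -> (fun x => A (f x)) @ F --> A z.
  by move=> fz; apply: bounded_cvg fz; exact: (conj lA AC).
have ny : nm y = s.
  apply: (cvg_unique (@Rhausdorff R) (nm_cvg Ay)).
  apply/cvgrPdistC_lt => d d0; apply: filterS (Fd d d0) => x [Lx x1 h].
  have h2 := As x Lx; have h3 : s * nm x <= s by rewrite ler_piMr.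
  by rewrite ltr_norml; apply/andP; split; lra.
have Ly : L y.
  move=> m Mm; have := dot_cvgl dot_norm (y := m) Ay => h.
  apply: (@cvg_uniq _ _ K^o _ F _ (fun x => dot (A x) m)); first exact: h.
  apply: cvg_near_cst; apply: filterS (Fd 1 ltr01) => x [Lx _ _].
  exact: L_stable.
have AAx0 : (fun x => A (A x) - rc (s ^+ 2) *: x) @ F --> (0 : H).
  apply/nm_cvgP => d d0.
  (* Expanding the square, |A (A x) - s^2 x|^2 <= s^2 (s^2 - |A x|^2) <= 2 s^3 (s - |A x|), which is
     below d^2 once s - |A x| < d^2 / (2 s^3). *)
  have d1 : 0 < d ^+ 2 / (2 * s ^+ 3) by rewrite divr_gt0 ?exprn_gt0 ?mulr_gt0.
  apply: filterS (Fd _ d1) => x [Lx x1]; rewrite subr0 => h.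
  rewrite -(@ltr_pXn2r _ 2%N) ?nnegrE ?nm_ge0 ?ltW//.
  rewrite (nm_sqrB dot_norm) dotZr conj_of_real sreZ sA (sre_dotxx dot_norm) nmZ nm_of_real.
  rewrite ger0_norm ?sqr_ge0//.
  have h1 := As _ (L_stable Lx).
  have h2 := As x Lx; have h3 : nm (A x) <= s by apply: le_trans h2 _; rewrite ler_piMr.
  have h4 : nm (A (A x)) ^+ 2 <= s ^+ 2 * nm (A x) ^+ 2.
    by rewrite -exprMn; rewrite ler_pXn2r ?nnegrE ?mulr_ge0 ?nm_ge0.
  have h5 : (s ^+ 2 * nm x) ^+ 2 <= s ^+ 4.
    rewrite exprMn -exprM ler_piMr ?exprn_ge0// expr_le1// nm_ge0//.
  have h6 : s ^+ 2 - nm (A x) ^+ 2 < d ^+ 2 / s ^+ 2.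
    have -> : s ^+ 2 - nm (A x) ^+ 2 = (s - nm (A x)) * (s + nm (A x)) by ring.
    apply: (@le_lt_trans _ _ ((s - nm (A x)) * (2 * s))).
      by rewrite ler_wpM2l ?subr_ge0//; lra.
    have -> : d ^+ 2 / s ^+ 2 = d ^+ 2 / (2 * s ^+ 3) * (2 * s) by field.
    by rewrite ltr_pM2r ?mulr_gt0//; lra.
  apply: (@le_lt_trans _ _ (s ^+ 2 * (s ^+ 2 - nm (A x) ^+ 2))).
    have -> : s ^+ 2 * (s ^+ 2 - nm (A x) ^+ 2) =
        s ^+ 2 * nm (A x) ^+ 2 + s ^+ 4 - 2 * (s ^+ 2 * nm (A x) ^+ 2) by ring.
    by rewrite lerD2r lerD.
  by move: h6; rewrite ltr_pdivlMr ?exprn_gt0// mulrC.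
have AAy : A (A y) = rc (s ^+ 2) *: y.
  apply/eqP; rewrite -subr_eq0; apply/eqP.
  apply: (@cvg_uniq _ _ H _ F _ (fun x => A (A (A x) - rc (s ^+ 2) *: x))); last first.
    by rewrite -[X in _ --> X](lin0 lA); exact: A_cvg AAx0.
  rewrite (_ : (fun x => _) = (fun x => A (A (A x)) - rc (s ^+ 2) *: A x)).
    apply: cvgB; last exact: scale_cvg.
    by apply: (A_cvg (fun x => A (A x))); exact: (A_cvg A).
  by apply/funext => x; rewrite (linB lA) (linZ lA).
have yn0 : y != 0 by rewrite -nm_eq0 ny.
have [z0|zn0] := eqVneq (A y + rc s *: y) 0.
  exists (- s), y; split => //; rewrite rmorphN scaleNr; apply/eqP.
  by rewrite -subr_eq0 opprK z0.
exists s, (A y + rc s *: y); split => //.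
  by rewrite addrC; apply: L_lin => //; exact: L_stable.
by rewrite (linD lA) AAy (linZ lA) scalerDr scalerA -rmorphM -expr2 addrC.
Qed.

End Eigenvector.

(** A zero vector satisfies the eigenvalue equation for every number; the last clause forces the
    number 0, so that sums of the [a n] count only genuine eigenvectors. *)
Definition eigenbasis A e (a : nat -> R) :=
  [/\ orthonormal_basis dot e, forall n, A (e n) = rc (a n) *: e n &
      forall n, e n = 0 -> a n = 0].

Lemma dot_eq1_neq0 x : dot x x = 1 -> x != 0.
Proof. by move=> h; apply/eqP => x0; move: h; rewrite x0 dot0l => /esym/eqP; rewrite oner_eq0. Qed.

Context (H_separable : separable_space H).

(** Orthogonal unit vectors are at distance sqrt 2, so points of a countable dense set chosen within
    1/2 of them are distinct. The code of the chosen point [g x] serves as the index of x. *)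
Lemma orthonormal_enum (M : set H) : (forall x, M x -> dot x x = 1) ->
  (forall x y, M x -> M y -> x != y -> dot x y = 0) ->
  exists e : nat -> H, [/\ ons dot e, forall n, e n = 0 \/ M (e n) &
    forall x, M x -> exists n, e n = x].
Proof.
move=> M1 M0; have [D [/countable_injP[f finj] dD]] := H_separable.
have near_D x : exists d, D d /\ nm (d - x) < 2^-1.
  have [||d [/= h Dd]] := dD (ball x (rc 2^-1)).
  - by exists x; apply: ballxx; rewrite of_real_gt0 invr_gt0.
  - exact: ball_open.
  - exists d; split => //; move: h.
    by rewrite -ball_normE /ball_ /= nmE nmB of_real_lt.
have [g hg] := choice near_D.
have h_inj x y : M x -> M y -> f (g x) = f (g y) -> x = y.
  move=> Mx My /finj; rewrite !inE => /(_ (hg x).1 (hg y).1) gxy.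
  have [//|xy] := eqVneq x y.
  have : nm (x - y) ^+ 2 = 2.
    rewrite (nm_sqrB dot_norm) -!(sre_dotxx dot_norm) !M1// M0// sre0.
    by rewrite -(rmorph1 rc) sre_of_real; ring.
  have hx := (hg x).2; have hy := (hg y).2; rewrite gxy nmB in hx.
  have : nm (x - y) < 1.
    have -> : x - y = (x - g y) + (g y - y) by rewrite addrA subrK.
    apply: le_lt_trans (nmD _ _) _; lra.
  have := nm_ge0 (x - y); move: (nm _) => t t0 t1 t2; exfalso; clear xy gxy; nra.
pose P n x := M x /\ f (g x) = n.
(* Integers that code no element of [M] receive the default 0, a zero term that [ons] permits. *)
pose e n := xget 0 (P n).
have eP n : e n = 0 \/ P n (e n).
  by rewrite /e; case: xgetP => [x _ Px|_]; [right|left].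
have eM x : M x -> e (f (g x)) = x.
  move=> Mx; rewrite /e; case: xgetP => [y _ [My /esym/h_inj yx]|/(_ x)[]//].
  by rewrite yx.
exists e; split; first split.
- move=> i j ij; have [->|[Mi fi]] := eP i; first by rewrite dot0l.
  have [->|[Mj fj]] := eP j; first by rewrite dot0r.
  by apply: M0 => //; apply: contra_neq ij => eij; rewrite -fi -fj eij.
- by move=> i; have [|[Mi _]] := eP i; [left|right; exact: M1].
- by move=> n; have [|[]] := eP n; [left|right].
- by move=> x Mx; exists (f (g x)); exact: eM.
Qed.

(** By Zorn there is a maximal orthonormal set of eigenvectors. Its orthogonal complement is stable
    under A, so if it were nonzero it would contain a further eigenvector. *)
Lemma spectral A : compact_op A -> selfadjoint dot A ->
  exists e (a : nat -> R), eigenbasis A e a.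
Proof.
move=> cA sA; have lA := cA.1.
pose PM (M : set H) := (forall x, M x -> dot x x = 1 /\ exists a, A x = rc a *: x) /\
  (forall x y, M x -> M y -> x != y -> dot x y = 0).
have [M [[M1 M0] Mmax]] : exists M, PM M /\ forall B : set H, M `<` B -> ~ PM B.
  apply: Zorn_bigcup => F FP Ftot; split.
    by move=> x [X FX Xx]; exact: (FP X FX).1.
  move=> x y [X FX Xx] [Y FY Yy].
  have [XY|YX] := Ftot X Y FX FY; first exact: (FP Y FY).2 (XY _ Xx) Yy.
  exact: (FP X FX).2 Xx (YX _ Yy).
have L_stable x : (forall m, M m -> dot x m = 0) -> forall m, M m -> dot (A x) m = 0.
  by move=> h m Mm; have [_ [a Am]] := M1 m Mm; rewrite sA Am dotZr h// mulr0.
have Mtot x : (forall m, M m -> dot x m = 0) -> x = 0.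
  move=> Lx; apply/eqP/negPn/negP => x0.
  have [a [z [Lz z0 Az]]] := eigenvector_exists cA sA L_stable Lx x0.
  have nz : nm z != 0 by rewrite nm_eq0.
  pose w := rc (nm z)^-1 *: z.
  have ww : dot w w = 1.
    rewrite dotZl dotZr conj_of_real (dotxx dot_norm) -!rmorphM /= expr2.
    by rewrite mulrA mulrACA mulVf// mulr1 rmorph1.
  have Mw m : M m -> dot w m = 0 by move=> Mm; rewrite dotZl Lz// mulr0.
  have wM : ~ M w by move=> /Mw; rewrite ww => /eqP; rewrite oner_eq0.
  apply: (Mmax (M `|` [set w])).
    split; first by move=> ?; left.
    by move=> h; apply: wM; apply: h; right.
  split=> [y [/M1//|->]|y y' [My|->] [My'|->] yy'].
  - by split => //; exists a; rewrite /w (linZ lA) Az !scalerA mulrC.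
  - exact: M0.
  - by rewrite dotC Mw// rmorph0.
  - exact: Mw.
  - by rewrite eqxx in yy'.
have [e [e_ons eM Me]] := orthonormal_enum (fun x Mx => (M1 x Mx).1) M0.
have hA n : exists a, A (e n) = rc a *: e n /\ (e n = 0 -> a = 0).
  have [->|Mn] := eM n; first by exists 0; rewrite (lin0 lA) scaler0.
  have [h [a ha]] := M1 _ Mn; exists a; split => // e0.
  by move: (dot_eq1_neq0 h); rewrite e0 eqxx.
have [a ha] := choice hA.
exists e, a; split=> [|n|n]; [|exact: (ha n).1|exact: (ha n).2].
split; [exact: e_ons.1|exact: e_ons.2|].
move=> x xe; apply: Mtot => m Mm; have [n <-] := Me m Mm; exact: xe.
Qed.

Lemma onb_exists : exists e, orthonormal_basis dot e.
Proof.
have [|e [a []]] := @spectral (fun=> 0) compact_op0; last by exists e.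
by move=> x y; rewrite dot0l dot0r.
Qed.

End Compactness.

(** * Diagonal operators and functional calculus *)

Section Diagonal.
Context (R : realType) (k : scalar_kind).
Local Notation K := (scalar_field R k).
Local Notation cj := (scalar_conj R k).
Local Notation rc := (of_real R k).
Context (H : completeNormedModType K) (dot : {dot H for @scalar_conj R k}).
Context (dot_norm : norm_from_dot dot).
Implicit Types (x y z u v : H) (c : K) (a b : nat -> R) (e : nat -> H) (A B : H -> H).

Lemma dot_injr u v : (forall x, dot x u = dot x v) -> u = v.
Proof.
move=> h; apply/eqP; rewrite -subr_eq0; apply/eqP/(dotxx_eq0 dot_norm).
by rewrite dotBr !h subrr.
Qed.

Lemma adjointC A B : is_adjoint dot A B -> is_adjoint dot B A.
Proof. by move=> h x y; rewrite dotC -h -dotC. Qed.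

Lemma adjoint_unique A B B' : is_adjoint dot A B -> is_adjoint dot A B' -> B = B'.
Proof. by move=> h h'; apply/funext => y; apply: dot_injr => x; rewrite -h h'. Qed.

Lemma adjoint_selfadjoint A : selfadjoint dot A -> adjoint dot A = A.
Proof.
move=> sA; rewrite /adjoint; apply: (@adjoint_unique A) => //.
by apply: (@xgetPex _ _ [set B | is_adjoint dot A B]); exists A.
Qed.

Lemma selfadjointD A B : selfadjoint dot A -> selfadjoint dot B -> selfadjoint dot (A + B).
Proof. by move=> sA sB x y; rewrite !fctE dotDl dotDr sA sB. Qed.

Lemma selfadjointN A : selfadjoint dot A -> selfadjoint dot (- A).
Proof. by move=> sA x y; rewrite !fctE dotNl dotNr sA. Qed.

Lemma selfadjointZ A (r : R) : selfadjoint dot A -> selfadjoint dot (fun x => rc r *: A x).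
Proof. by move=> sA x y; rewrite dotZl dotZr conj_of_real sA. Qed.

Lemma adjoint_comp A A' B B' : is_adjoint dot A A' -> is_adjoint dot B B' ->
  is_adjoint dot (A \o B) (B' \o A').
Proof. by move=> hA hB x y; rewrite /= hA hB. Qed.

Lemma bounded_comp C D A B : 0 <= C -> bounded_by C A -> bounded_by D B ->
  bounded_by (C * D) (A \o B).
Proof.
move=> C0 [lA hA] [lB hB]; split; first by move=> c x y /=; rewrite lB lA.
by move=> x; rewrite /= (le_trans (hA _))// -mulrA ler_wpM2l.
Qed.

Lemma bounded_add C D A B : bounded_by C A -> bounded_by D B -> bounded_by (C + D) (A + B).
Proof.
move=> [lA hA] [lB hB]; split.
  by move=> c x y; rewrite !fctE lA lB scalerDr addrACA.
by move=> x; rewrite !fctE (le_trans (nmD _ _))// mulrDl lerD.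
Qed.

Lemma bounded_scale C c A : bounded_by C A -> bounded_by (nm c * C) (fun x => c *: A x).
Proof.
move=> [lA hA]; split; first by move=> d x y; rewrite lA scalerDr !scalerA mulrC.
by move=> x; rewrite nmZ -mulrA ler_wpM2l ?nm_ge0.
Qed.

Section Basis.
Context (e : nat -> H) (e_onb : orthonormal_basis dot e).
Let e_ons := onb_ons e_onb.

Lemma basis_dot_ext C A u v : bounded_by C A ->
  (forall n, dot (A (e n)) u = dot (e n) v) -> forall x, dot (A x) u = dot x v.
Proof.
move=> bA h x; have ex := onb_expand dot_norm e_onb (x := x).
apply: (cvg_uniq (V := K^o) (dot_cvgl dot_norm (y := u) (bounded_cvg bA ex))).
rewrite (_ : (fun t => _) = (fun n => dot (series (fun n => dot x (e n) *: e n) n) v)).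
  exact: (dot_cvgl dot_norm (y := v) ex).
apply/funext => n; rewrite /series /= (lin_sum bA.1) !dot_suml.
by apply: eq_bigr => i _; rewrite (linZ bA.1) !dotZl h.
Qed.

Lemma basis_adjoint C D A B : bounded_by C A -> bounded_by D B ->
  (forall n m, dot (A (e n)) (e m) = dot (e n) (B (e m))) -> is_adjoint dot A B.
Proof.
move=> bA bB h x y.
rewrite dotC -(@basis_dot_ext _ B x (A x) bB) -?dotC// => m.
by rewrite dotC -(basis_dot_ext bA (fun n => h n m)) -dotC.
Qed.

(** The functional calculus is carried by these operators: [op_sqrt], [op_abs] and [op_power], which
    are chosen by [get], are each recognized as a [diag e] by their action on an eigenbasis. The
    vector picked here exists when a is bounded. *)
Definition diag a x : H :=
  get [set y | forall n, dot y (e n) = rc (a n) * dot x (e n)].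

Lemma diag_aux C a x : (forall n, `|a n| <= C) ->
  (forall n, dot (diag a x) (e n) = rc (a n) * dot x (e n)) /\
  nm (diag a x) ^+ 2 <= C ^+ 2 * nm x ^+ 2.
Proof.
move=> aC; have C0 : 0 <= C by apply: le_trans (aC 0%N).
have [|y [_ ye yn]] := @riesz_fischer R k H dot dot_norm e e_ons
  (fun i => rc (a i) * dot x (e i)) (C ^+ 2 * nm x ^+ 2).
  move=> n; apply: (@le_trans _ _ (\sum_(0 <= i < n) C ^+ 2 * nm (dot x (e i)) ^+ 2)).
    apply: ler_sum => i _; rewrite nmM nm_of_real exprMn ler_wpM2r ?sqr_ge0//.
    by rewrite ler_pXn2r ?nnegrE.
  by rewrite -mulr_sumr ler_wpM2l ?sqr_ge0// bessel.
have yE m : dot y (e m) = rc (a m) * dot x (e m) by rewrite ye -mulrA ons_dotxx.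
have dE : forall n, dot (diag a x) (e n) = rc (a n) * dot x (e n).
  exact: (@getPex _ [set y | forall n, dot y (e n) = rc (a n) * dot x (e n)] (ex_intro _ y yE)).
have -> : diag a x = y by apply: (onb_ext e_onb) => n; rewrite dE yE.
by split.
Qed.

Section Bounded.
Variables (C : R) (a : nat -> R) (aC : forall n, `|a n| <= C).

Lemma dot_diag x n : dot (diag a x) (e n) = rc (a n) * dot x (e n).
Proof. exact: (diag_aux x aC).1. Qed.

Lemma diag_bounded : bounded_by C (diag a).
Proof.
have C0 : 0 <= C by apply: le_trans (aC 0%N).
split=> [c x y|x].
  by apply: (onb_ext e_onb) => n; rewrite !(dotDl, dotZl, dot_diag) mulrDr mulrCA.
by rewrite -(@ler_pXn2r _ 2%N) ?nnegrE ?mulr_ge0 ?nm_ge0// exprMn (diag_aux x aC).2.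
Qed.

Lemma diag_basis n : diag a (e n) = rc (a n) *: e n.
Proof.
apply: (onb_ext e_onb) => m; rewrite dot_diag dotZl.
by have [->//|nm_] := eqVneq m n; rewrite (e_ons.1 n m) 1?eq_sym// !mulr0.
Qed.

Lemma diag_selfadjoint : selfadjoint dot (diag a).
Proof.
apply: (basis_adjoint diag_bounded diag_bounded) => n m.
rewrite !diag_basis dotZl dotZr conj_of_real.
by have [->//|nm_] := eqVneq n m; rewrite (e_ons.1 n m)// !mulr0.
Qed.

Lemma diag_eigenbasis : (forall n, e n = 0 -> a n = 0) -> eigenbasis dot (diag a) e a.
Proof. by move=> h; split=> // n; exact: diag_basis. Qed.

End Bounded.

Lemma diag_comp C D a b : (forall n, `|a n| <= C) -> (forall n, `|b n| <= D) ->
  diag a \o diag b = diag (fun n => a n * b n).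
Proof.
move=> aC bD; apply/funext => x; apply: (onb_ext e_onb) => n.
rewrite /= (dot_diag aC) (dot_diag bD) (@dot_diag (C * D)) ?rmorphM ?mulrA// => m.
by rewrite normrM ler_pM.
Qed.

Lemma diag_unique C D a B : (forall n, `|a n| <= C) -> bounded_by D B ->
  (forall n, B (e n) = rc (a n) *: e n) -> B = diag a.
Proof.
move=> aC bB h; apply: (bounded_onb_ext dot_norm e_onb bB (diag_bounded aC)) => n.
by rewrite h (diag_basis aC).
Qed.

Lemma diag_positive C a : (forall n, `|a n| <= C) -> (forall n, 0 <= a n) ->
  positive_op dot (diag a).
Proof.
move=> aC a0; have C0 : 0 <= C by apply: le_trans (aC 0%N).
split; [by apply/bounded_opP; exists C => //; exact: diag_bounded|exact: diag_selfadjoint aC|].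
have sC n : `|Num.sqrt (a n)| <= Num.sqrt C.
  by rewrite ger0_norm ?sqrtr_ge0// ler_wsqrtr// (le_trans (ler_norm _)).
move=> x; have -> : diag a = diag (fun n => Num.sqrt (a n)) \o diag (fun n => Num.sqrt (a n)).
  rewrite (diag_comp sC sC); congr diag; apply/funext => n.
  by rewrite -expr2 sqr_sqrtr.
by rewrite /= -(diag_selfadjoint sC) (dotxx dot_norm) of_real_ge0 sqr_ge0.
Qed.

End Basis.

Section Eigenbasis.
Context (A : H -> H) (C : R) (e : nat -> H) (a : nat -> R).
Context (bA : bounded_by C A) (eA : eigenbasis dot A e a).
Let e_onb : orthonormal_basis dot e. Proof. by case: eA. Qed.

Lemma eigenbasis_onb : orthonormal_basis dot e.
Proof. exact: e_onb. Qed.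

Lemma eigenbasis0 n : e n = 0 -> a n = 0.
Proof. by case: eA => _ _; exact. Qed.

Lemma eigenbasis_nm n : a n * nm (e n) ^+ 2 = a n.
Proof.
have [en|h] := (onb_ons e_onb).2 n; first by rewrite eigenbasis0// mul0r.
by rewrite -(sre_dotxx dot_norm) h -(rmorph1 rc) sre_of_real mulr1.
Qed.

Lemma eigenvalue_bound n : `|a n| <= `|C|.
Proof.
have [en|h] := (onb_ons e_onb).2 n; first by rewrite eigenbasis0// normr0.
have e1 : nm (e n) = 1.
  apply/eqP; rewrite -(@eqrXn2 _ 2%N) ?nm_ge0// expr1n -(sre_dotxx dot_norm) h.
  by rewrite -(rmorph1 rc) sre_of_real.
have := bA.2 (e n); case: eA => _ -> _; rewrite nmZ nm_of_real e1 !mulr1 => aC.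
exact: le_trans aC (ler_norm _).
Qed.

Lemma eigenbasis_diag : A = diag e a.
Proof.
by apply: (diag_unique e_onb eigenvalue_bound bA) => n; case: eA => _ + _; exact.
Qed.

Lemma dot_eigen x n : dot (A x) (e n) = rc (a n) * dot x (e n).
Proof. by rewrite {1}eigenbasis_diag (dot_diag e_onb eigenvalue_bound). Qed.

Lemma quad_cvg x : series (fun n => a n * nm (dot x (e n)) ^+ 2) @ \oo --> sre (dot (A x) x).
Proof.
have h := sre_cvg (dot_cvgl dot_norm (y := x)
  (bounded_cvg bA (onb_expand dot_norm e_onb (x := x)))).
have -> : series (fun n => a n * nm (dot x (e n)) ^+ 2) =
    fun n => sre (dot (A (series (fun n => dot x (e n) *: e n) n)) x).
  apply/funext => n; rewrite /series/= (lin_sum bA.1) dot_suml sre_sum.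
  apply: eq_bigr => i _; rewrite (linZ bA.1); case: eA => _ -> _.
  by rewrite !dotZl [in RHS]mulrCA [dot (e i) x]dotC sreZ nm_sqr.
exact: h.
Qed.

Lemma eigenvalue_ge0 : (forall x, 0 <= dot x (A x)) -> forall n, 0 <= a n.
Proof.
move=> h n; have := h (e n); case: eA => _ -> _; rewrite dotZr conj_of_real (dotxx dot_norm).
by rewrite -rmorphM /= of_real_ge0 eigenbasis_nm.
Qed.

(** Uniqueness of the positive root, eigenvector by eigenvector. With s = sqrt (a n) > 0, the vector
    y = S (e n) - s e n satisfies S y = - s y, and positivity of S forces y = 0. If s = 0, then |S
    (e n)|^2 = <e n, S (S (e n))> = 0. *)
Lemma op_sqrt_eigen : (forall n, 0 <= a n) -> op_sqrt dot A = diag e (fun n => Num.sqrt (a n)).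
Proof.
move=> a0; set D := diag _ _; have sC n : `|Num.sqrt (a n)| <= Num.sqrt `|C|.
  by rewrite ger0_norm ?sqrtr_ge0// ler_wsqrtr// (le_trans (ler_norm _)) ?eigenvalue_bound.
have DD : positive_op dot D /\ D \o D = A.
  split; first by apply: (diag_positive e_onb sC) => n; exact: sqrtr_ge0.
  rewrite (diag_comp e_onb sC sC) [RHS]eigenbasis_diag; congr diag.
  by apply/funext => n; rewrite -expr2 sqr_sqrtr.
have [[/bounded_opP[M M0 bS] sS S0] SA] :=
  @getPex _ [set S | positive_op dot S /\ S \o S = A] (ex_intro _ D DD).
rewrite -/(op_sqrt dot A) in bS sS S0 SA; set S := op_sqrt dot A in bS sS S0 SA *.
apply: (diag_unique e_onb sC bS) => n; have lS := bS.1.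
have SSe : S (S (e n)) = rc (a n) *: e n.
  by rewrite -[LHS]/((S \o S) (e n)) SA; case: eA => _ + _; exact.
set s := Num.sqrt (a n).
have as2 : a n = s * s by rewrite -expr2 sqr_sqrtr.
have [s0|s0] := eqVneq s 0.
  rewrite s0 rmorph0 scale0r; apply: (dotxx_eq0 dot_norm).
  by rewrite sS SSe as2 s0 mulr0 rmorph0 scale0r dot0r.
apply/eqP; rewrite -subr_eq0; apply/eqP; set y := _ - _.
have Sy : S y = - (rc s *: y).
  by rewrite /y (linB lS) (linZ lS) SSe as2 scalerBr scalerA -rmorphM opprB.
have := S0 y; rewrite Sy dotNr dotZr conj_of_real (dotxx dot_norm) -rmorphM -rmorphN /=.
rewrite of_real_ge0 oppr_ge0 pmulr_rle0 ?lt_def ?s0 ?sqrtr_ge0// => y0.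
by apply/eqP; rewrite -nm_eq0 -sqrf_eq0 eq_le y0 sqr_ge0.
Qed.

Lemma op_power_eigen r : 0 < r -> (forall n, 0 <= a n) ->
  op_power A r = diag e (fun n => a n `^ r).
Proof.
move=> r0 a0; set D := diag _ _.
have sC n : `|a n `^ r| <= `|C| `^ r.
  rewrite ger0_norm ?powR_ge0// ge0_ler_powR ?nnegrE ?(ltW r0)//.
  by rewrite (le_trans (ler_norm _)) ?eigenvalue_bound.
pose Q := [set B | bounded_op B /\ forall (s : R) x, 0 <= s ->
  A x = rc s *: x -> B x = rc (s `^ r) *: x].
have QD : Q D.
  split; first by apply/bounded_opP; exists (`|C| `^ r);
    [exact: powR_ge0|exact: (diag_bounded e_onb sC)].
  move=> s x s0 Ax; apply: (onb_ext e_onb) => n; rewrite (dot_diag e_onb sC) dotZl.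
  have := dot_eigen x n; rewrite Ax dotZl => h.
  have [->|xn] := eqVneq (dot x (e n)) 0; first by rewrite !mulr0.
  by move/(mulIf xn)/of_real_inj : h => ->.
have [/bounded_opP[M M0 bB] hB] : Q (op_power A r).
  by apply: (@xgetPex _ _ Q); exists D.
apply: (diag_unique e_onb sC bB) => n; apply: hB => //.
by case: eA => _ + _; exact.
Qed.

End Eigenbasis.

Lemma op_abs_eigen A C e a : bounded_by C A -> eigenbasis dot A e a ->
  selfadjoint dot A -> op_abs dot A = diag e (fun n => `|a n|).
Proof.
move=> bA eA sA; rewrite /op_abs adjoint_selfadjoint//.
have aC := eigenvalue_bound bA eA; have e_onb := eigenbasis_onb eA.
have bAA : bounded_by (`|C| * `|C|) (A \o A).
  by rewrite (eigenbasis_diag bA eA); apply: bounded_comp => //; exact: diag_bounded.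
have eAA : eigenbasis dot (A \o A) e (fun n => a n * a n).
  split => // [n|n en]; last by rewrite (eigenbasis0 eA en) mulr0.
  case: eA => _ h _; rewrite /= h; have lA := bA.1.
  by rewrite (linZ lA) h scalerA rmorphM.
rewrite (op_sqrt_eigen bAA eAA); last by move=> n; rewrite -expr2 sqr_ge0.
by congr diag; apply/funext => n; rewrite -expr2 sqrtr_sqr.
Qed.

Lemma op_abs_power_eigen A C e a r : bounded_by C A -> eigenbasis dot A e a ->
  selfadjoint dot A -> 0 < r ->
  op_power (op_abs dot A) r = diag e (fun n => `|a n| `^ r).
Proof.
move=> bA eA sA r0; have aC := eigenvalue_bound bA eA; have e_onb := eigenbasis_onb eA.
have aC' n : `| `|a n| | <= `|C| by rewrite normr_id.
have eB : eigenbasis dot (diag e (fun n => `|a n|)) e (fun n => `|a n|).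
  by apply: (diag_eigenbasis e_onb aC') => n en; rewrite (eigenbasis0 eA en) normr0.
by rewrite (op_abs_eigen bA eA sA) (op_power_eigen (diag_bounded e_onb aC') eB r0).
Qed.

End Diagonal.

(** * Hilbert-Schmidt sums and traces *)

Section HilbertSchmidt.
Context (R : realType) (k : scalar_kind).
Local Notation K := (scalar_field R k).
Local Notation cj := (scalar_conj R k).
Local Notation rc := (of_real R k).
Context (H : completeNormedModType K) (dot : {dot H for @scalar_conj R k}).
Context (dot_norm : norm_from_dot dot).
Implicit Types (x y z u v : H) (c t : K) (a b : nat -> R) (e f : nat -> H).
Implicit Types (A B S T X : H -> H).

Lemma conjK c : cj (cj c) = c.
Proof. exact: rmorphK. Qed.

(** The square of the Hilbert-Schmidt norm of T, computed in the basis e. *)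
Definition hs T e : \bar R := (\sum_(n <oo) (nm (T (e n)) ^+ 2)%:E)%E.

(** By Parseval both sides are the double sum of the |<T e_n, f_m>|^2, taken in the two orders. *)
Lemma hs_adjoint T T' e f : is_adjoint dot T T' ->
  orthonormal_basis dot e -> orthonormal_basis dot f -> hs T e = hs T' f.
Proof.
move=> hT e_onb f_onb; rewrite /hs.
transitivity (\sum_(n <oo) \sum_(m <oo) (nm (dot (T (e n)) (f m)) ^+ 2)%:E)%E.
  by apply: eq_eseriesr => n _; rewrite (parseval dot_norm f_onb).
rewrite nneseries_interchange; last by move=> i j; rewrite lee_fin sqr_ge0.
apply: eq_eseriesr => m _; rewrite -(parseval dot_norm e_onb).
by apply: eq_eseriesr => n _; rewrite hT nm_dotC.
Qed.

Lemma hs_indep T T' e f : is_adjoint dot T T' ->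
  orthonormal_basis dot e -> orthonormal_basis dot f -> hs T e = hs T f.
Proof. by move=> hT oe fo; rewrite (hs_adjoint hT oe fo) -(hs_adjoint hT fo fo). Qed.

Lemma hs_cvg T e : (hs T e < +oo)%E ->
  exists2 l, series (fun n => nm (T (e n)) ^+ 2) @ \oo --> l & hs T e = l%:E.
Proof. by move=> h; apply: nneseries_cvg => // n; exact: sqr_ge0. Qed.

Lemma hs_le_lty T S e C : (forall n, nm (S (e n)) <= C * nm (T (e n))) ->
  (hs T e < +oo)%E -> (hs S e < +oo)%E.
Proof.
move=> hS; have sq0 (U : H -> H) n : 0 <= nm (U (e n)) ^+ 2 by exact: sqr_ge0.
move=> /(nneseries_lt_bound (sq0 T))[M M0 hM].
apply: (nneseries_lty (M := C ^+ 2 * M) (sq0 S)) => N.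
apply: le_trans (ler_wpM2l (sqr_ge0 C) (hM N)); rewrite mulr_sumr; apply: ler_sum => n _.
have h := hS n; rewrite -exprMn; have h0 := nm_ge0 (S (e n)); nra.
Qed.

Lemma abs_series_cvg (s : nat -> K) M : (forall N, \sum_(0 <= i < N) nm (s i) <= M) ->
  cvg (series s @ \oo).
Proof.
move=> hM; have s0 n : 0 <= nm (s n) by exact: nm_ge0.
have [l ul ule] := nneseries_cvg s0 (nneseries_lty s0 hM).
apply: scalar_cauchy => d d0.
move/cvgrPdist_lt : ul => /(_ d d0)[N _ hN].
exists (series s N); exists N => // n /= Nn.
have -> : series s n - series s N = \sum_(N <= i < n) s i.
  by rewrite /series /= (big_cat_nat (leq0n N) Nn) /= addrAC subrr add0r.
apply: (@le_lt_trans _ _ (\sum_(N <= i < n) nm (s i))).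
  elim/big_ind2 : _ => [|x1 x2 y1 y2 h1 h2|//]; first by rewrite nm0.
  by apply: le_trans (nmD _ _) _; rewrite lerD.
have hl m : \sum_(0 <= i < m) nm (s i) <= l by rewrite -lee_fin -ule sum_le_nneseries.
have := hN N (leqnn N); rewrite /= ger0_norm ?subr_ge0 ?hl// => h.
apply: le_lt_trans h; have := hl n; rewrite (big_cat_nat (leq0n N) Nn) /= /series /=.
by move: (\sum_(N <= i < n) _) (\sum_(0 <= i < N) _) => *; lra.
Qed.

Lemma hs_pair_cvg T S e : (hs T e < +oo)%E -> (hs S e < +oo)%E ->
  exists t, series (fun n => dot (T (e n)) (S (e n))) @ \oo --> t.
Proof.
have sq0 (U : H -> H) n : 0 <= nm (U (e n)) ^+ 2 by exact: sqr_ge0.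
move=> /(nneseries_lt_bound (sq0 T))[M M0 hM] /(nneseries_lt_bound (sq0 S))[M' M'0 hM'].
apply/cvg_ex/(@abs_series_cvg _ (M + M')) => N.
apply: le_trans (lerD (hM N) (hM' N)); rewrite -big_split /=; apply: ler_sum => n _.
apply: le_trans (cauchy_schwarz dot_norm _ _) _.
have := nm_ge0 (T (e n)); have := nm_ge0 (S (e n)).
move: (nm (T (e n))) (nm (S (e n))) => p q q0 p0.
have := sqr_ge0 (p - q); rewrite sqrrB => h; nra.
Qed.

Lemma scalar_series_scale (s : nat -> K) c t : series s @ \oo --> t ->
  series (fun n => sre (c * s n)) @ \oo --> sre (c * t).
Proof.
move=> st; have ct : (fun n => c * series s n) @ \oo --> c * t.
  by apply: (@cvgM K) => //; exact: cvg_cst.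
have -> : series (fun n => sre (c * s n)) = fun n => sre (c * series s n).
  by apply/funext => n; rewrite /series /= mulr_sumr sre_sum.
exact: sre_cvg ct.
Qed.

Lemma hs_polar T S e c hT hS t :
  series (fun n => nm (T (e n)) ^+ 2) @ \oo --> hT ->
  series (fun n => nm (S (e n)) ^+ 2) @ \oo --> hS ->
  series (fun n => dot (T (e n)) (S (e n))) @ \oo --> t ->
  hs (T + (fun x => c *: S x)) e = (hT + nm c ^+ 2 * hS + 2 * sre (cj c * t))%:E.
Proof.
move=> lT lS lt; apply: cvg_nneseries.
pose proof (cvgD (cvgD lT (cvgM (cvg_cst (nm c ^+ 2)) lS))
  (cvgM (cvg_cst (2 : R)) (scalar_series_scale (c := cj c) lt))) as h.
move: h; apply: cvg_trans; apply: near_eq_cvg; near=> n.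
rewrite /series /= !fctE /= !mulr_sumr -!big_split /=; apply: eq_bigr => i _.
by rewrite (nm_sqrD dot_norm) nmZ exprMn dotZr.
Unshelve. all: by end_near. Qed.

Lemma adjoint_add_scale T T' S S' c : is_adjoint dot T T' -> is_adjoint dot S S' ->
  is_adjoint dot (T + (fun x => c *: S x)) (T' + (fun x => cj c *: S' x)).
Proof.
move=> hT hS x y; rewrite !fctE dotDl dotDr dotZl dotZr hT hS.
by rewrite conjK.
Qed.

(* The two sides are sesquilinear in (T, S) and agree for S = T by
   [hs_adjoint], hence agree by polarization. *)
Lemma hs_pair_adjoint T T' S S' e f t t' :
  is_adjoint dot T T' -> is_adjoint dot S S' ->
  orthonormal_basis dot e -> orthonormal_basis dot f ->
  (hs T e < +oo)%E -> (hs S e < +oo)%E ->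
  series (fun n => dot (T (e n)) (S (e n))) @ \oo --> t ->
  series (fun n => dot (S' (f n)) (T' (f n))) @ \oo --> t' -> t = t'.
Proof.
move=> hT hS oe fo Toe Soe tt tt'.
have [lT cT eT] := hs_cvg Toe; have [lS cS eS] := hs_cvg Soe.
have Tof : (hs T' f < +oo)%E by rewrite -(hs_adjoint hT oe fo).
have Sof : (hs S' f < +oo)%E by rewrite -(hs_adjoint hS oe fo).
have [lT' cT' eT'] := hs_cvg Tof; have [lS' cS' eS'] := hs_cvg Sof.
have ET : lT = lT' by apply: EFin_inj; rewrite -eT -eT'; exact: hs_adjoint.
have ES : lS = lS' by apply: EFin_inj; rewrite -eS -eS'; exact: hs_adjoint.
have ctt' : series (fun n => dot (T' (f n)) (S' (f n))) @ \oo --> cj t'.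
  have -> : series (fun n => dot (T' (f n)) (S' (f n))) =
            fun n => cj (series (fun n => dot (S' (f n)) (T' (f n))) n).
    apply/funext => n; rewrite /series /= rmorph_sum /=.
    by apply: eq_bigr => i _; exact: dotC.
  apply/(@nm_cvgP R k K^o) => d d0; move/(@nm_cvgP R k K^o)/(_ d d0) : tt'.
  by apply: filterS => n; rewrite -rmorphB /= nm_conj.
(* Equating the squared norms of T + c S and of its adjoint leaves only the cross terms. The choice
   c = t - t' at the end turns their difference into |t - t'|^2. *)
have key c : sre (cj c * t) = sre (cj c * t').
  have := hs_adjoint (adjoint_add_scale c hT hS) oe fo.
  rewrite (hs_polar c cT cS tt) (hs_polar (cj c) cT' cS' ctt') ET ES nm_conj => -[].
  have -> : sre (cj (cj c) * cj t') = sre (cj c * t').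
    by rewrite -[LHS]sre_conj rmorphM /= !conjK.
  by move=> /addrI/(mulfI (_ : 2 != 0)) -> //; rewrite pnatr_eq0.
apply/eqP; rewrite -subr_eq0 -nm_eq0 -sqrf_eq0 nm_sqr mulrC mulrBr sreB key subrr //.
Qed.

(** The main source of traces valid in every basis. The terms <S' T f_n, f_n> = <T f_n, S f_n> pair
    two Hilbert-Schmidt operators, and passing twice through [hs_pair_adjoint] replaces one basis by
    another. The same argument gives Tr (S' T) = Tr (T S'). *)
Lemma has_trace_hs T T' S S' e :
  is_adjoint dot T T' -> is_adjoint dot S S' -> orthonormal_basis dot e ->
  (hs T e < +oo)%E -> (hs S e < +oo)%E ->
  exists t, has_trace dot (S' \o T) t /\ has_trace dot (T \o S') t.
Proof.
move=> hT hS oe Te Se.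
have hT' := adjointC hT; have hS' := adjointC hS.
have T'e : (hs T' e < +oo)%E by rewrite -(hs_adjoint hT oe oe).
have S'e : (hs S' e < +oo)%E by rewrite -(hs_adjoint hS oe oe).
have [t tt] := hs_pair_cvg Te Se.
exists t; split=> f fo.
  have Tf : (hs T f < +oo)%E by rewrite -(hs_indep hT oe fo).
  have Sf : (hs S f < +oo)%E by rewrite -(hs_indep hS oe fo).
  have [t1 tt1] := hs_pair_cvg Tf Sf.
  have [t2 tt2] := hs_pair_cvg S'e T'e.
  rewrite (hs_pair_adjoint hT hS oe oe Te Se tt tt2) -(hs_pair_adjoint hT hS fo oe Tf Sf tt1 tt2).
  apply: cvg_trans tt1; apply: near_eq_cvg; near=> n.
  by apply: eq_bigr => i _; rewrite /= hS'.
have T'f : (hs T' f < +oo)%E by rewrite -(hs_indep hT' oe fo).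
have S'f : (hs S' f < +oo)%E by rewrite -(hs_indep hS' oe fo).
have [t1 tt1] := hs_pair_cvg S'f T'f.
rewrite (hs_pair_adjoint hT hS oe fo Te Se tt tt1).
apply: cvg_trans tt1; apply: near_eq_cvg; near=> n.
by apply: eq_bigr => i _; rewrite /= hT.
Unshelve. all: by end_near. Qed.

Section Trace.
Context (e0 : nat -> H) (e0_onb : orthonormal_basis dot e0).

Lemma has_trace_unique A t t' : has_trace dot A t -> has_trace dot A t' -> t = t'.
Proof. by move=> /(_ e0 e0_onb) h /(_ e0 e0_onb) h'; exact: (cvg_uniq (V := K^o) h h'). Qed.

Lemma traceE A t : has_trace dot A t -> trace dot A = t.
Proof.
move=> At; apply: (has_trace_unique _ At).
by apply: (@xgetPex _ _ [set t | has_trace dot A t]); exists t.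
Qed.

End Trace.

Lemma has_traceD A B t t' : has_trace dot A t -> has_trace dot B t' ->
  has_trace dot (A + B) (t + t').
Proof.
move=> At Bt e oe; pose proof (cvgD (At e oe : _ --> (t : K^o)) (Bt e oe)) as h.
move: h; apply: cvg_trans; apply: near_eq_cvg; near=> n.
rewrite !fctE /series /= -big_split; apply: eq_bigr => i _.
by rewrite dotDl.
Unshelve. all: by end_near. Qed.

Lemma has_traceZ A t c : has_trace dot A t -> has_trace dot (fun x => c *: A x) (c * t).
Proof.
move=> At e oe; pose proof (cvgM (cvg_cst (c : K)) (At e oe : _ --> (t : K))) as h.
move: h; apply: cvg_trans; apply: near_eq_cvg; near=> n.
by rewrite /series /= mulr_sumr; apply: eq_bigr => i _; rewrite dotZl.
Unshelve. all: by end_near. Qed.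

Lemma has_traceN A t : has_trace dot A t -> has_trace dot (- A) (- t).
Proof.
move=> /(@has_traceZ _ _ (-1)); rewrite mulN1r.
suff -> : - A = fun x => -1 *: A x by [].
by apply/funext => x; rewrite scaleN1r.
Qed.

Lemma hs_compl T C X e : bounded_by C X -> (hs T e < +oo)%E -> (hs (X \o T) e < +oo)%E.
Proof. by move=> bX; apply: hs_le_lty => n; exact: bX.2. Qed.

Lemma hs_compr T T' C X X' e : is_adjoint dot T T' -> is_adjoint dot X X' ->
  orthonormal_basis dot e ->
  bounded_by C X' -> (hs T e < +oo)%E -> (hs (T \o X) e < +oo)%E.
Proof.
move=> hT hX oe bX Te; rewrite (hs_adjoint (adjoint_comp hT hX) oe oe).
by apply: hs_compl bX _; rewrite -(hs_adjoint hT oe oe).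
Qed.

Lemma hs_diag e b C M : orthonormal_basis dot e -> (forall n, `|b n| <= C) ->
  (forall N, \sum_(0 <= n < N) b n ^+ 2 <= M) -> (hs (diag dot e b) e < +oo)%E.
Proof.
move=> oe bC hM; apply: (nneseries_lty (M := M)); first by move=> n; exact: sqr_ge0.
move=> N; apply: le_trans (hM N); apply: ler_sum => n _.
rewrite (diag_basis dot_norm oe bC) nmZ nm_of_real exprMn real_normK ?num_real//.
by rewrite ler_piMr ?sqr_ge0// expr_le1 ?nm_ge0// (ons_nm_le1 dot_norm (onb_ons oe)).
Qed.

(** A nonnegative summable diagonal is the square of a Hilbert-Schmidt one, so its trace exists in
    all bases; the value is then read off in e. *)
Lemma diag_has_trace e b C l : orthonormal_basis dot e -> (forall n, `|b n| <= C) ->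
  (forall n, 0 <= b n) -> (forall n, e n = 0 -> b n = 0) ->
  series b @ \oo --> l -> has_trace dot (diag dot e b) (rc l).
Proof.
move=> oe bC b0 eb bl; have C0 : 0 <= C by apply: le_trans (bC 0%N).
have sC n : `|Num.sqrt (b n)| <= Num.sqrt C.
  by rewrite ger0_norm ?sqrtr_ge0// ler_wsqrtr// (le_trans (ler_norm _)).
have lb N : \sum_(0 <= n < N) b n <= l.
  by rewrite -lee_fin -(cvg_nneseries bl) sum_le_nneseries.
have Se : (hs (diag dot e (fun n => Num.sqrt (b n))) e < +oo)%E.
  apply: (hs_diag oe sC (M := l)) => N; apply: le_trans (lb N).
  by apply: ler_sum => n _; rewrite sqr_sqrtr.
have sS := diag_selfadjoint dot_norm oe sC.
have [t [ht _]] := has_trace_hs sS sS oe Se Se.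
have DE : diag dot e (fun n => Num.sqrt (b n)) \o diag dot e (fun n => Num.sqrt (b n)) =
    diag dot e b.
  rewrite (diag_comp dot_norm oe sC sC); congr diag; apply/funext => n.
  by rewrite -expr2 sqr_sqrtr.
rewrite DE in ht; suff -> : rc l = t by [].
apply: (cvg_uniq (V := K^o) _ (ht e oe)).
have eD := diag_eigenbasis dot_norm oe bC eb.
have -> : series (fun n => dot (diag dot e b (e n)) (e n)) = fun n => rc (series b n).
  apply/funext => n; rewrite /series /= rmorph_sum /=; apply: eq_bigr => i _.
  rewrite (diag_basis dot_norm oe bC) dotZl (dotxx dot_norm) -rmorphM /=.
  by rewrite (eigenbasis_nm dot_norm eD).
apply/(@nm_cvgP R k K^o) => d d0; move/cvgrPdistC_lt/(_ d d0) : bl.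
by apply: filterS => n; rewrite -rmorphB /= nm_of_real.
Qed.

Section Schatten.
Context (A : H -> H) (C : R) (e : nat -> H) (a : nat -> R).
Context (bA : bounded_by C A) (eA : eigenbasis dot A e a) (sA : selfadjoint dot A).
Let oe := eigenbasis_onb eA.
Let aC := eigenvalue_bound dot_norm bA eA.

Lemma eigen_powR_bound r n : 0 < r -> `| `|a n| `^ r | <= `|C| `^ r.
Proof.
by move=> r0; rewrite ger0_norm ?powR_ge0// ge0_ler_powR ?nnegrE ?(ltW r0)// aC.
Qed.

Lemma eigen_powR0 r n : 0 < r -> e n = 0 -> `|a n| `^ r = 0.
Proof. by move=> r0 en; rewrite (eigenbasis0 eA en) normr0 powR0// gt_eqF. Qed.

(** From here on Schatten membership of a self-adjoint operator is a statement about its sequence of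
    eigenvalues. *)
Lemma schatten_eigen r : 0 < r -> schatten dot r%:E A <->
  compact_op A /\ (\sum_(n <oo) (`|a n| `^ r)%:E < +oo)%E.
Proof.
move=> r0; rewrite /schatten (op_abs_power_eigen dot_norm bA eA sA r0).
have pC n := eigen_powR_bound n r0.
have p0 n : 0 <= `|a n| `^ r by exact: powR_ge0.
have pe n := @eigen_powR0 r n r0.
split=> -[cA]; last first.
  move=> /(nneseries_cvg p0)[l al _]; split=> //; exists (rc l).
  exact: (diag_has_trace oe pC).
move=> [t /(_ e oe)] /sre_cvg h; split => //.
rewrite (@cvg_nneseries _ _ (sre t)) ?ltry//.
move: h; apply: cvg_trans; apply: near_eq_cvg; near=> n.
rewrite /series /= sre_sum; apply: eq_bigr => i _.
have eD := diag_eigenbasis dot_norm oe pC pe.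
rewrite (diag_basis dot_norm oe pC) dotZl (dotxx dot_norm) -rmorphM sre_of_real.
by rewrite (eigenbasis_nm dot_norm eD).
Unshelve. all: by end_near. Qed.

Lemma trace_norm_eigen l : series (fun n => `|a n|) @ \oo --> l ->
  trace_norm dot A = rc l.
Proof.
move=> al; rewrite /trace_norm (op_abs_eigen dot_norm bA eA sA).
apply: (traceE oe); apply: (diag_has_trace (C := `|C|) oe) => // n.
  by rewrite normr_id.
by move=> en; rewrite (eigenbasis0 eA en) normr0.
Qed.

Lemma trace_class_eigen : trace_class dot A <->
  compact_op A /\ (\sum_(n <oo) `|a n|%:E < +oo)%E.
Proof.
rewrite /trace_class schatten_eigen//.
by under eq_eseriesr do rewrite powRr1//.
Qed.

End Schatten.

End HilbertSchmidt.
Arguments has_traceD {R k H dot A B t t'} _ _.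
Arguments has_traceZ {R k H dot A t} c _.
Arguments has_traceN {R k H dot A t} _.

(** * Schatten classes and the Hoelder inequality *)

Section Holder.
Context (R : realType) (k : scalar_kind).
Local Notation K := (scalar_field R k).
Local Notation cj := (scalar_conj R k).
Local Notation rc := (of_real R k).
Context (H : completeNormedModType K) (dot : {dot H for @scalar_conj R k}).
Context (dot_norm : norm_from_dot dot).
Implicit Types (x y z : H) (c : K) (a b s t u v : nat -> R) (e f : nat -> H).
Implicit Types (A B P S T X : H -> H).

Lemma nneseries_le (u v : nat -> \bar R) : (forall n, (0 <= u n)%E) ->
  (forall n, (u n <= v n)%E) -> (\sum_(n <oo) u n <= \sum_(n <oo) v n)%E.
Proof. by move=> u0 uv; apply: lee_nneseries => n *. Qed.

(* With M = max (s^p, t^q) one has s <= M^(1/p) and t <= M^(1/q). *)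
Lemma powR_prod_le (s t al be p q : R) : 0 <= s -> 0 <= t -> 0 <= al -> 0 <= be ->
  0 < p -> 0 < q -> al / p + be / q = 1 ->
  s `^ al * t `^ be <= s `^ p + t `^ q.
Proof.
move=> s0 t0 al0 be0 p0 q0 h.
set M := Num.max (s `^ p) (t `^ q).
have M0 : 0 <= M by rewrite le_max powR_ge0.
have powRE (x r y : R) : 0 < r -> x `^ y = (x `^ r) `^ (y / r) :> R.
  by move=> r0; rewrite -powRrM; congr (_ `^ _); field; rewrite gt_eqF.
rewrite (powRE s p)// (powRE t q)//.
apply: (@le_trans _ _ (M `^ (al / p) * M `^ (be / q))).
  apply: ler_pM; rewrite ?powR_ge0//.
    by rewrite ge0_ler_powR ?nnegrE ?powR_ge0 ?divr_ge0 ?(ltW p0)// le_max lexx.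
  by rewrite ge0_ler_powR ?nnegrE ?powR_ge0 ?divr_ge0 ?(ltW q0)// le_max lexx orbT.
rewrite -powRD ?h ?oner_eq0// powRr1// ge_max lerDl lerDr !powR_ge0//.
Qed.

Lemma parseval_eigen e (s : nat -> R) C x : orthonormal_basis dot e -> (forall n, `|s n| <= C) ->
  ((nm (diag dot e s x) ^+ 2)%:E = \sum_(n <oo) (s n ^+ 2 * nm (dot x (e n)) ^+ 2)%:E)%E.
Proof.
move=> oe sC; rewrite -(parseval dot_norm oe); apply: eq_eseriesr => n _.
by rewrite (dot_diag dot_norm oe sC) nmM nm_of_real exprMn real_normK ?num_real.
Qed.

(** The matrix of the |<e n, f m>|^2 is doubly substochastic: rows here, columns by exchanging the
    bases. It relates eigenvalue sums of operators with different eigenbases. *)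
Lemma onb_weight_le1 e f n : orthonormal_basis dot e -> orthonormal_basis dot f ->
  (\sum_(m <oo) (nm (dot (e n) (f m)) ^+ 2)%:E <= 1)%E.
Proof.
move=> oe fo; rewrite (parseval dot_norm fo) lee_fin expr_le1 ?nm_ge0//.
exact: (ons_nm_le1 dot_norm (onb_ons oe)).
Qed.

Lemma weighted_sum_le e f (u : nat -> R) : orthonormal_basis dot e -> orthonormal_basis dot f ->
  (forall n, 0 <= u n) ->
  (\sum_(n <oo) \sum_(m <oo) (u n * nm (dot (e n) (f m)) ^+ 2)%:E <= \sum_(n <oo) (u n)%:E)%E.
Proof.
move=> oe fo u0; apply: nneseries_le => n.
  by apply: nneseries_ge0 => m _ _; rewrite lee_fin mulr_ge0 ?sqr_ge0.
under eq_eseriesr do rewrite EFinM.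
rewrite nneseriesZl ?lee_fin//; last by move=> m _; rewrite lee_fin sqr_ge0.
by rewrite -[leRHS]mule1 lee_wpmul2l ?lee_fin// onb_weight_le1.
Qed.

Lemma weighted_double_sum_lty e f (u v : nat -> R) (g : nat -> nat -> R) :
  orthonormal_basis dot e -> orthonormal_basis dot f ->
  (forall n, 0 <= u n) -> (forall n, 0 <= v n) ->
  (forall n m, 0 <= g n m <= u n + v m) ->
  (\sum_(n <oo) (u n)%:E < +oo)%E -> (\sum_(n <oo) (v n)%:E < +oo)%E ->
  (\sum_(n <oo) \sum_(m <oo) (g n m * nm (dot (e n) (f m)) ^+ 2)%:E < +oo)%E.
Proof.
move=> oe fo u0 v0 guv uoo voo.
apply: (@le_lt_trans _ _ (\sum_(n <oo) \sum_(m <oo) (u n * nm (dot (e n) (f m)) ^+ 2)%:E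
   + \sum_(n <oo) \sum_(m <oo) (v m * nm (dot (e n) (f m)) ^+ 2)%:E)%E).
  rewrite -nneseriesD; last 2 first.
  - by move=> n _ _; apply: nneseries_ge0 => m _ _; rewrite lee_fin mulr_ge0 ?sqr_ge0.
  - by move=> n _ _; apply: nneseries_ge0 => m _ _; rewrite lee_fin mulr_ge0 ?sqr_ge0.
  apply: nneseries_le => n.
    by apply: nneseries_ge0 => m _ _; rewrite lee_fin mulr_ge0 ?sqr_ge0//; case/andP: (guv n m).
  rewrite -nneseriesD; last 2 first.
  - by move=> m _ _; rewrite lee_fin mulr_ge0 ?sqr_ge0.
  - by move=> m _ _; rewrite lee_fin mulr_ge0 ?sqr_ge0.
  apply: nneseries_le => m; first by rewrite lee_fin mulr_ge0 ?sqr_ge0//; case/andP: (guv n m).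
  by rewrite -EFinD lee_fin -mulrDl ler_wpM2r ?sqr_ge0//; case/andP: (guv n m).
apply: lte_add_pinfty; first exact: le_lt_trans (weighted_sum_le oe fo u0) uoo.
rewrite nneseries_interchange; last by move=> i j; rewrite lee_fin mulr_ge0 ?sqr_ge0.
apply: le_lt_trans voo; apply: le_trans (weighted_sum_le fo oe v0).
rewrite le_eqVlt; apply/orP; left; apply/eqP; apply: eq_eseriesr => n _.
by apply: eq_eseriesr => m _; rewrite nm_dotC.
Qed.

(** The squared Hilbert-Schmidt norm of the product is the sum of s_n^2 t_m^2 |<e_n, f_m>|^2, which
    the additive bound u n + v m reduces to row and column sums. *)
Lemma hs_diag_comp e f (s t u v : nat -> R) C D :
  orthonormal_basis dot e -> orthonormal_basis dot f ->
  (forall n, `|s n| <= C) -> (forall n, `|t n| <= D) ->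
  (forall n, 0 <= u n) -> (forall n, 0 <= v n) ->
  (forall n m, s n ^+ 2 * t m ^+ 2 <= u n + v m) ->
  (\sum_(n <oo) (u n)%:E < +oo)%E -> (\sum_(n <oo) (v n)%:E < +oo)%E ->
  (hs (diag dot e s \o diag dot f t) f < +oo)%E.
Proof.
move=> oe fo sC tD u0 v0 suv uoo voo.
have := weighted_double_sum_lty (g := fun m n => s n ^+ 2 * t m ^+ 2) fo oe v0 u0 _ voo uoo.
move=> h; apply: le_lt_trans (h _); last first.
  by move=> n m; rewrite mulr_ge0 ?sqr_ge0//= addrC.
rewrite /hs; apply: nneseries_le => m; first by rewrite lee_fin sqr_ge0.
have lS := (diag_bounded dot_norm oe sC).1.
rewrite /= (diag_basis dot_norm fo tD) (linZ lS) nmZ nm_of_real exprMn real_normK ?num_real//.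
rewrite EFinM (parseval_eigen _ oe sC) -nneseriesZl; last first.
  by move=> n _; rewrite lee_fin mulr_ge0 ?sqr_ge0.
apply: nneseries_le => n; rewrite -EFinM lee_fin.
  by rewrite mulr_ge0 ?sqr_ge0// mulr_ge0 ?sqr_ge0.
by rewrite mulrA [t m ^+ 2 * _]mulrC.
Qed.

(** A stand-in for the Hoelder inequality adapted to substochastic weights: a product bounded by a
    function of n plus a function of m can be summed against them one index at a time. *)
Definition splits (s t : nat -> R) := exists u v : nat -> R,
  [/\ forall n, 0 <= u n, forall n, 0 <= v n, forall n m, s n * t m <= u n + v m,
      (\sum_(n <oo) (u n)%:E < +oo)%E & (\sum_(n <oo) (v n)%:E < +oo)%E].

(** Factor [diag s] through s1 = |s|^(p/2), which is Hilbert-Schmidt, and s2 = sg s |s|^(1 - p/2).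
    The product of s2 and t is Hilbert-Schmidt by the splitting of s2^2 t^2, and [has_trace_hs]
    concludes. The bound p <= 2 keeps the exponent 1 - p/2 nonnegative, hence s2 bounded. *)
Lemma holder_diag e f (s t : nat -> R) C D p :
  orthonormal_basis dot e -> orthonormal_basis dot f ->
  (forall n, `|s n| <= C) -> (forall n, `|t n| <= D) -> 0 < p -> p <= 2 ->
  (\sum_(n <oo) (`|s n| `^ p)%:E < +oo)%E ->
  splits (fun n => `|s n| `^ (2 - p)) (fun n => t n ^+ 2) ->
  (exists c, has_trace dot (diag dot e s \o diag dot f t) c) /\
  (exists c, has_trace dot (diag dot f t \o diag dot e s) c).
Proof.
move=> oe fo sC tD p0 p2 sp [u [v [u0 v0 suv uoo voo]]].
have C0 : 0 <= C by apply: le_trans (sC 0%N).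
pose s1 n := `|s n| `^ (p / 2); pose s2 n := Num.sg (s n) * `|s n| `^ (1 - p / 2).
have s1C n : `|s1 n| <= C `^ (p / 2).
  by rewrite ger0_norm ?powR_ge0// ge0_ler_powR ?nnegrE ?divr_ge0 ?(ltW p0)//.
have s2C n : `|s2 n| <= C `^ (1 - p / 2).
  rewrite normrM [X in _ * X]ger0_norm ?powR_ge0//.
  apply: (@le_trans _ _ (`|s n| `^ (1 - p / 2))).
    by rewrite ler_piMl ?powR_ge0// normr_sg; case: (s n != 0).
  by rewrite ge0_ler_powR ?nnegrE ?sC// subr_ge0 ler_pdivrMr// mul1r.
have sE : diag dot e s1 \o diag dot e s2 = diag dot e s.
  rewrite (diag_comp dot_norm oe s1C s2C); congr diag; apply/funext => n.
  rewrite /s1 /s2 mulrCA -powRD; last by rewrite addrC subrK oner_eq0.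
  by rewrite addrC subrK powRr1// mulr_sg_norm.
have sE' : diag dot e s2 \o diag dot e s1 = diag dot e s.
  rewrite -sE (diag_comp dot_norm oe s1C s2C) (diag_comp dot_norm oe s2C s1C).
  by congr diag; apply/funext => n; rewrite mulrC.
have S1 := diag_selfadjoint dot_norm oe s1C.
have S2 := diag_selfadjoint dot_norm oe s2C.
have S0 := diag_selfadjoint dot_norm fo tD.
have s1E n : s1 n ^+ 2 = `|s n| `^ p.
  by rewrite /s1 -powR_mulrn ?powR_ge0// -powRrM divfK.
have hs1 : (hs (diag dot e s1) e < +oo)%E.
  have [M M0 hM] := nneseries_lt_bound (fun n => powR_ge0 `|s n| p) sp.
  apply: (hs_diag dot_norm oe s1C (M := M)) => N; apply: le_trans (hM N).
  by apply: ler_sum => n _; rewrite s1E.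
have hs2 : (hs (diag dot e s2 \o diag dot f t) f < +oo)%E.
  apply: (hs_diag_comp oe fo s2C tD u0 v0) => // n m; apply: le_trans (suv n m).
  rewrite ler_wpM2r ?sqr_ge0// /s2 exprMn -[X in _ * X]powR_mulrn ?powR_ge0// -powRrM.
  have -> : (1 - p / 2) * 2%:R = 2 - p by field.
  by rewrite ler_piMl ?powR_ge0// sqr_sg; case: (s n != 0).
have hs1f : (hs (diag dot e s1) f < +oo)%E by rewrite -(hs_indep dot_norm S1 oe fo).
have A2 := adjoint_comp S2 S0.
split.
  have [c [hc _]] := has_trace_hs dot_norm A2 S1 fo hs2 hs1f.
  by exists c; rewrite -sE; exact: hc.
have hs2' : (hs (diag dot f t \o diag dot e s2) f < +oo)%E.
  by rewrite -(hs_adjoint dot_norm A2 fo fo).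
have [c [_ hc]] := has_trace_hs dot_norm (adjointC A2) S1 fo hs2' hs1f.
by exists c; rewrite -sE'; exact: hc.
Qed.

Definition conjugate (p : R) (q : \bar R) := (p = 1 /\ q = +oo%E) \/
  exists q' : R, [/\ q = q'%:E, 1 < p, 1 < q' & p^-1 + q'^-1 = 1].

Lemma conjugateP p q : 1 <= p -> ((p^-1)%:E + q^-1 = 1)%E -> conjugate p q.
Proof.
move=> p1; have p0 : 0 < p by apply: lt_le_trans p1.
case: q => [q| |] //; last first.
  rewrite invey adde0 => -[] /(congr1 (@GRing.inv R)); rewrite invrK invr1.
  by left.
have [->|q0] := eqVneq q 0; first by rewrite inve0.
rewrite inver (negbTE q0) -EFinD => -[] pq; right; exists q.
have qi : q^-1 = 1 - p^-1 by rewrite -pq addrC addKr.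
have pi : 0 < p^-1 by rewrite invr_gt0.
have p1' : p^-1 <= 1 by rewrite invf_le1.
have qi0 : 0 < q^-1.
  by rewrite lt_def invr_eq0 q0 qi subr_ge0.
have qpos : 0 < q by rewrite -invr_gt0.
split => //; last by rewrite -invf_lt1// qi; lra.
by rewrite -invf_lt1//; lra.
Qed.

(* For q = +oo the eigenvalues of the second operator are only bounded. *)
Definition eigen_schatten (q : \bar R) (t : nat -> R) : Prop :=
  match q with
  | r%:E => (\sum_(n <oo) (`|t n| `^ r)%:E < +oo)%E
  | _ => True
  end.

Lemma splits_powR (s t : nat -> R) al be p q : 0 <= al -> 0 <= be -> 0 < p -> 0 < q ->
  al / p + be / q = 1 ->
  (\sum_(n <oo) (`|s n| `^ p)%:E < +oo)%E -> (\sum_(n <oo) (`|t n| `^ q)%:E < +oo)%E ->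
  splits (fun n => `|s n| `^ al) (fun n => `|t n| `^ be).
Proof.
move=> *; exists (fun n => `|s n| `^ p), (fun n => `|t n| `^ q).
by split => // n; rewrite ?powR_ge0// => m; exact: powR_prod_le.
Qed.

Lemma splits_bounded (s t : nat -> R) D : (forall n, 0 <= s n) -> (forall n, t n <= D) -> 0 <= D ->
  (\sum_(n <oo) (s n)%:E < +oo)%E -> splits s t.
Proof.
move=> s0 tD D0 soo; exists (fun n => D * s n), (fun=> 0); split => //.
- by move=> n; rewrite mulr_ge0.
- by move=> n m; rewrite addr0 mulrC ler_wpM2r.
- under eq_eseriesr do rewrite EFinM.
  rewrite nneseriesZl//; last by move=> n _; rewrite lee_fin.
  by rewrite lte_mul_pinfty// ?lee_fin.
- by rewrite eseries0// ltry.
Qed.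

Lemma conjugate_splits (s t : nat -> R) D p q : conjugate p q -> (forall n, `|t n| <= D) ->
  (\sum_(n <oo) (`|s n| `^ p)%:E < +oo)%E -> eigen_schatten q t ->
  splits (fun n => `|s n|) (fun n => `|t n|).
Proof.
move=> [[-> ->] tD|[r [-> p1 r1 pr] tD]] sp /= tq.
  apply: (@splits_bounded _ _ D) => //; first exact: le_trans (tD 0%N).
  by move: sp; under eq_eseriesr do rewrite powRr1//.
have := @splits_powR s t 1 1 p r ler01 ler01.
rewrite !mul1r => /(_ (lt_trans ltr01 p1) (lt_trans ltr01 r1) pr sp tq).
move=> [u [v [u0 v0 h uoo voo]]]; exists u, v; split => // n m.
by have := h n m; rewrite !powRr1.
Qed.

(** The exponents 2 - p and 2 are those of |s| and t in s2^2 t^2 from [holder_diag]; each identity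
    is the balance required by [powR_prod_le], and one of p, r is at most 2. *)
Lemma conjugate_exponents (p r : R) : 1 < p -> 1 < r -> p^-1 + r^-1 = 1 ->
  [/\ 0 < p, 0 < r, (2 - p) / p + 2 / r = 1, (2 - r) / r + 2 / p = 1 & 2 < p -> r <= 2].
Proof.
move=> p1 r1 pr; have p0 : 0 < p by lra.
have r0 : 0 < r by lra.
have rinv : r^-1 = 1 - p^-1 by rewrite -pr addrC addKr.
split => // [||p2].
- by rewrite mulrBl divff ?gt_eqF// rinv; lra.
- by rewrite mulrBl divff ?gt_eqF// rinv; lra.
rewrite -[2]invrK -[r]invrK lef_pV2 ?posrE ?invr_gt0// rinv.
have : p^-1 <= 2^-1 by rewrite lef_pV2 ?posrE// ltW.
by lra.
Qed.

Lemma holder_eigen e f (s t : nat -> R) C D p q :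
  orthonormal_basis dot e -> orthonormal_basis dot f ->
  (forall n, `|s n| <= C) -> (forall n, `|t n| <= D) -> conjugate p q ->
  (\sum_(n <oo) (`|s n| `^ p)%:E < +oo)%E -> eigen_schatten q t ->
  exists c, has_trace dot (diag dot f t \o diag dot e s) c.
Proof.
move=> oe fo sC tD pq sp tq.
have sqE (w : nat -> R) : (fun n => w n ^+ 2) = (fun n => `|w n| `^ 2).
  by apply/funext => n; rewrite -[LHS]real_normK ?num_real// -powR_mulrn.
have [p2|p2] := leP p 2.
  have [] // := @holder_diag e f s t C D p oe fo sC tD _ p2 sp.
    by case: pq => [[->]//|[r [_ p1]]] _ _; rewrite (lt_trans ltr01 p1).
  case: pq tq => [[p1 ->] _|[r [-> p1 r1 pr]] /= tq].
    have D0 : 0 <= D by apply: le_trans (tD 0%N).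
    have p21 : 2 - p = p by rewrite p1; ring.
    apply: (@splits_bounded _ _ (D ^+ 2)); rewrite ?sqr_ge0//.
    - by move=> n; rewrite -[leLHS]real_normK ?num_real// ler_pXn2r ?nnegrE.
    - by rewrite p21.
  have [p0 r0 h _ _] := conjugate_exponents p1 r1 pr.
  by rewrite sqE; apply: (@splits_powR _ _ _ _ p r); rewrite ?subr_ge0.
case: pq tq => [[p1 _]|[r [-> p1 r1 pr]] /= tq].
  by rewrite p1 ltNge ler1n in p2.
have [p0 r0 _ h r2] := conjugate_exponents p1 r1 pr.
(* Here p > 2, so the conjugate exponent r is at most 2 and t is the diagonal to be factored. *)
have [] // := @holder_diag f e t s D C r fo oe tD sC r0 (r2 p2) tq.
by rewrite sqE; apply: (@splits_powR _ _ _ _ r p); rewrite ?subr_ge0 ?r2.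
Qed.

Lemma schatten_eigenE A C e a (q : \bar R) : bounded_by C A -> eigenbasis dot A e a ->
  selfadjoint dot A -> (forall r, q = r%:E -> 0 < r) -> q <> -oo%E ->
  schatten dot q A <-> compact_op A /\ eigen_schatten q a.
Proof.
move=> bA eA sA; case: q => [r| |] //= r0 _; last by split=> [|[]].
exact: (schatten_eigen dot_norm bA eA sA (r0 r erefl)).
Qed.

Lemma conjugate_gt0 p q : conjugate p q ->
  (forall r, q = r%:E -> 0 < r) /\ q <> -oo%E.
Proof.
move=> [[_ ->]|[r [-> _ r1 _]]]; first by split.
by split => // _ [<-]; exact: lt_trans r1.
Qed.

Lemma schatten_compact q A : schatten dot q A -> compact_op A.
Proof. by case: q => [r []| |]. Qed.

(* l <= b/4 if 4 l <= b, and l <= (4 l / b)^(q-1) l otherwise. *)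
Lemma powR_tangent_le (b l q : R) : 0 < b -> 0 <= l -> 1 <= q ->
  l <= b / 4 + (4 / b) `^ (q - 1) * l `^ q.
Proof.
move=> b0 l0 q1; have [lb|bl] := leP l (b / 4).
  by rewrite (le_trans lb)// lerDl mulr_ge0 ?powR_ge0.
have lpos : 0 < l by apply: le_lt_trans bl; rewrite divr_ge0// ltW.
rewrite -[leLHS]add0r lerD ?divr_ge0 ?(ltW b0)//.
have -> : l `^ q = l `^ (q - 1) * l.
  by rewrite -[X in _ * X](powRr1 l0) -powRD ?subrK// (gt_eqF lpos) implybT.
rewrite mulrA ler_peMl// -powRM ?divr_ge0 ?(ltW b0)//.
have h1 : 1 <= 4 / b * l.
  rewrite mulrAC ler_pdivlMr// mul1r; move: bl; rewrite ltr_pdivrMr// mulrC => /ltW.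
  by [].
rewrite -[leLHS](congr1 (@^~ (q - 1)) (@powR1 R)) /= ge0_ler_powR ?nnegrE ?subr_ge0//.
by rewrite mulr_ge0 ?divr_ge0 ?(ltW b0).
Qed.

(** A Jensen-type argument with a generous constant. For an eigenvector f_n of B, b_n <= 2 <P f_n,
    f_n> = 2 sum_m l_m |<f_n, e_m>|^2. [powR_tangent_le] bounds the last sum by b_n / 4 + (4 /
    b_n)^(r-1) L_n, with L_n the sum of the l_m^r |<f_n, e_m>|^2. Absorbing b_n / 2 on the left
    gives b_n^r <= 4 * 4^(r-1) L_n, and the L_n add up to at most the sum of the l_m^r. *)
Lemma schatten_le q P B : (forall r, q = r%:E -> 1 <= r) -> q <> -oo%E ->
  separable_space H -> selfadjoint dot P -> (forall x, 0 <= dot x (P x)) ->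
  schatten dot q P -> compact_op B -> selfadjoint dot B -> (forall x, 0 <= dot x (B x)) ->
  (forall x, sre (dot (B x) x) <= 2 * sre (dot (P x) x)) ->
  schatten dot q B.
Proof.
move=> q1 qN sepH sP P0 Pq cB sB B0 BP.
have cP := schatten_compact Pq.
have [e [l eP]] := spectral dot_norm sepH cP sP.
have [f [b eB]] := spectral dot_norm sepH cB sB.
have [C C0 bP] := compact_op_bounded cP.
have [D D0 bB] := compact_op_bounded cB.
have qpos r : q = r%:E -> 0 < r by move/q1; exact: lt_le_trans.
move/(schatten_eigenE bP eP sP qpos qN) : Pq => [_ Pq].
apply/(schatten_eigenE bB eB sB qpos qN); split => //.
case: q q1 qN qpos Pq => //= r r1 _ rpos lsum.
have {}r1 := r1 r erefl; have {}rpos := rpos r erefl.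
have l0 := eigenvalue_ge0 dot_norm eP P0.
have b0 := eigenvalue_ge0 dot_norm eB B0.
have oe := eigenbasis_onb eP; have of_ := eigenbasis_onb eB.
pose L n : \bar R := (\sum_(m <oo) (l m `^ r * nm (dot (f n) (e m)) ^+ 2)%:E)%E.
have w0 n m : 0 <= l m `^ r * nm (dot (f n) (e m)) ^+ 2 by rewrite mulr_ge0 ?powR_ge0 ?sqr_ge0.
have L0 n : (0 <= L n)%E by apply: nneseries_ge0 => m _ _; rewrite lee_fin.
have lsum' : (\sum_(m <oo) (l m `^ r)%:E < +oo)%E.
  by move: lsum; under eq_eseriesr do rewrite ger0_norm//.
have Lsum : (\sum_(n <oo) L n < +oo)%E.
  apply: le_lt_trans lsum'; rewrite /L nneseries_interchange; last by move=> i j; rewrite lee_fin.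
  apply: le_trans (weighted_sum_le oe of_ (fun n => powR_ge0 (l n) r)).
  rewrite le_eqVlt; apply/orP; left; apply/eqP; apply: eq_eseriesr => n _.
  by apply: eq_eseriesr => m _; rewrite nm_dotC.
apply: (@le_lt_trans _ _ (\sum_(n <oo) ((4 * 4 `^ (r - 1))%:E * L n))%E); last first.
  rewrite nneseriesZl//.
  by rewrite lte_mul_pinfty// ?lee_fin ?mulr_ge0 ?powR_ge0.
apply: nneseries_le => n; rewrite ger0_norm//; first by rewrite lee_fin powR_ge0.
have [->|bn0] := eqVneq (b n) 0.
  by rewrite powR0 ?gt_eqF// mule_ge0// lee_fin mulr_ge0 ?powR_ge0.
have bn : 0 < b n by rewrite lt_def bn0 b0.
have Lfin : L n \is a fin_num.
  rewrite ge0_fin_numE//; apply: le_lt_trans Lsum.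
  by rewrite (@nneseriesD1 _ _ n xpredT)// leeDl// nneseries_ge0.
rewrite -(fineK Lfin) -EFinM lee_fin; set Lr := fine _.
have hsum N : \sum_(0 <= m < N) l m * nm (dot (f n) (e m)) ^+ 2 <=
    b n / 4 + (4 / b n) `^ (r - 1) * Lr.
  apply: (@le_trans _ _ (\sum_(0 <= m < N)
    (b n / 4 + (4 / b n) `^ (r - 1) * l m `^ r) * nm (dot (f n) (e m)) ^+ 2)).
    by apply: ler_sum => m _; rewrite ler_wpM2r ?sqr_ge0// powR_tangent_le.
  under eq_bigr do rewrite mulrDl.
  rewrite big_split /= -mulr_sumr; apply: lerD.
    rewrite -[leRHS]mulr1 ler_wpM2l ?divr_ge0//.
    apply: le_trans (bessel dot_norm (onb_ons oe) _ _) _.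
    by rewrite expr_le1 ?nm_ge0// (ons_nm_le1 dot_norm (onb_ons of_)).
  under eq_bigr do rewrite -mulrA.
  rewrite -mulr_sumr ler_wpM2l ?powR_ge0//.
  by rewrite -lee_fin fineK//; exact: sum_le_nneseries.
have hP : sre (dot (P (f n)) (f n)) <= b n / 4 + (4 / b n) `^ (r - 1) * Lr.
  apply: (cvgr_to_le (quad_cvg dot_norm bP eP (x := f n))).
  by near=> N; exact: hsum.
have hB : b n <= 2 * sre (dot (P (f n)) (f n)).
  apply: le_trans (BP (f n)); case: (eB) => _ -> _.
  by rewrite dotZl sreZ (sre_dotxx dot_norm) (eigenbasis_nm dot_norm eB).
have h1 : b n <= 4 * ((4 / b n) `^ (r - 1) * Lr) by clear - hP hB; lra.
have -> : b n `^ r = b n * b n `^ (r - 1).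
  by rewrite -[X in X * _](powRr1 (ltW bn)) -powRD ?(addrC 1) ?subrK// (gt_eqF bn) implybT.
apply: le_trans (ler_wpM2r (powR_ge0 _ _) h1) _.
rewrite -!mulrA ler_wpM2l// [Lr * _]mulrC mulrA -powRM ?divr_ge0//.
by rewrite divfK.
Unshelve. all: by end_near. Qed.

End Holder.

(** * Square roots and factorization *)

Section SquareRoot.
Context (R : realType) (k : scalar_kind).
Local Notation K := (scalar_field R k).
Local Notation cj := (scalar_conj R k).
Local Notation rc := (of_real R k).
Context (H : completeNormedModType K) (dot : {dot H for @scalar_conj R k}).
Context (dot_norm : norm_from_dot dot) (H_separable : separable_space H).
Implicit Types (x y z u v : H) (c : K) (a b : nat -> R) (e f : nat -> H).
Implicit Types (A B P S T X Z : H -> H).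

Lemma op_sqrt_spectral P : positive_op dot P -> compact_op P ->
  exists e l C, [/\ eigenbasis dot P e l, forall n, 0 <= l n,
    forall n, `|Num.sqrt (l n)| <= C, bounded_by (C * C) P &
    op_sqrt dot P = diag dot e (fun n => Num.sqrt (l n))].
Proof.
move=> [_ sP P0] cP; have [e [l eP]] := spectral dot_norm H_separable cP sP.
have [C C0 bP] := compact_op_bounded cP.
have l0 := eigenvalue_ge0 dot_norm eP P0.
exists e, l, (Num.sqrt C); split => //.
- move=> n; rewrite ger0_norm ?sqrtr_ge0// ler_wsqrtr//.
  rewrite (le_trans (ler_norm _))// (le_trans (eigenvalue_bound dot_norm bP eP n))//.
  by rewrite ger0_norm.
- by rewrite -expr2 sqr_sqrtr.
- exact: op_sqrt_eigen bP eP l0.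
Qed.

Section Sqrt.
Variables (P : H -> H) (posP : positive_op dot P) (cP : compact_op P).
Let S := op_sqrt dot P.
Let W : set H := closure (range P).

Lemma sqrt_selfadjoint : selfadjoint dot S.
Proof.
have [e [l [C [eP l0 sC bP SE]]]] := op_sqrt_spectral posP cP.
by rewrite /S SE; exact: (diag_selfadjoint dot_norm (eigenbasis_onb eP) sC).
Qed.

Lemma sqrt_bounded : exists2 C, 0 <= C & bounded_by C S.
Proof.
have [e [l [C [eP l0 sC bP SE]]]] := op_sqrt_spectral posP cP.
exists C; first exact: le_trans (sC 0%N).
by rewrite /S SE; exact: (diag_bounded dot_norm (eigenbasis_onb eP) sC).
Qed.

Lemma sqrt_sqr : S \o S = P.
Proof.
have [e [l [C [eP l0 sC bP SE]]]] := op_sqrt_spectral posP cP.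
rewrite [RHS](eigenbasis_diag dot_norm bP eP) /S SE.
rewrite (diag_comp dot_norm (eigenbasis_onb eP) sC sC); congr diag.
by apply/funext => n; rewrite -expr2 sqr_sqrtr.
Qed.

Lemma sqrt_linear : linear S.
Proof. by have [C _ []] := sqrt_bounded. Qed.

Lemma sqrt_compact : compact_op S.
Proof.
have [C _ bS] := sqrt_bounded.
by apply: (compact_op_sqrt dot_norm sqrt_selfadjoint bS); rewrite sqrt_sqr.
Qed.

Lemma nm_sqrt x : nm (S x) ^+ 2 = sre (dot (P x) x).
Proof. by rewrite -(sre_dotxx dot_norm) sqrt_selfadjoint -sqrt_sqr sre_dotC. Qed.

(** The closure of the range is the orthogonal complement of the kernel; this turns membership in
    [W] into a condition on coordinates. *)
Lemma closure_range_eigen e l C x : eigenbasis dot P e l -> bounded_by C P ->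
  W x <-> forall n, l n = 0 -> dot x (e n) = 0.
Proof.
move=> eP bP; have oe := eigenbasis_onb eP; have lP := bP.1.
have eE n : P (e n) = rc (l n) *: e n by case: eP.
split=> [Wx n ln|h].
  apply/eqP; rewrite -nm_eq0 eq_le nm_ge0 andbT; apply/ler_addgt0Pl => d d0.
  rewrite addr0; have [|_ [[y _ <-] yx]] := Wx [set y | nm (y - x) < d].
    by apply/nbhs_nmP; exists d.
  have -> : dot x (e n) = dot (x - P y) (e n).
    by rewrite dotBl (dot_eigen dot_norm bP eP) ln rmorph0 mul0r subr0.
  apply: le_trans (cauchy_schwarz dot_norm _ _) _.
  apply: (@le_trans _ _ (nm (x - P y))); last by rewrite nmB ltW.
  by rewrite -[leRHS]mulr1 ler_wpM2l ?nm_ge0// (ons_nm_le1 dot_norm (onb_ons oe)).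
move=> B /nbhs_nmP[d d0 dB].
have /nm_cvgP/(_ d d0)[N _ hN] := onb_expand dot_norm oe (x := x).
exists (series (fun n => dot x (e n) *: e n) N); split; last first.
  by apply: dB; exact: (hN N (leqnn N)).
(* Where l n = 0 the inverse is 0 by convention, which is harmless since that coordinate of x
   vanishes. *)
exists (\sum_(0 <= n < N) (rc (l n)^-1 * dot x (e n)) *: e n) => //.
rewrite (lin_sum lP); apply: eq_bigr => i _; rewrite (linZ lP) eE scalerA.
have [l0|l0] := eqVneq (l i) 0; first by rewrite h// mulr0 mul0r.
by rewrite mulrAC -rmorphM /= mulVf// rmorph1 mul1r.
Qed.

Lemma closure_range_sqrt x : W (S x).
Proof.
have [e [l [C [eP l0 sC bP SE]]]] := op_sqrt_spectral posP cP.
apply/(closure_range_eigen _ eP bP) => n ln.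
by rewrite /S SE (dot_diag dot_norm (eigenbasis_onb eP) sC) ln sqrtr0 rmorph0 mul0r.
Qed.

(** The range of S is dense in [W], so it suffices to test v on it. Taking S w to be a partial
    expansion of v, with squared coefficient sum a, gives a = <v, S w> <= M |S w| <= M sqrt a, hence
    a <= M^2. *)
Lemma closure_range_bound v M : 0 <= M -> W v ->
  (forall y, nm (dot v (S y)) <= M * nm (S y)) -> nm v <= M.
Proof.
move=> M0 Wv h.
have [e [l [C [eP l0 sC bP SE]]]] := op_sqrt_spectral posP cP.
have oe := eigenbasis_onb eP; have lS := sqrt_linear.
move/(closure_range_eigen _ eP bP) : Wv => Wv.
rewrite -(@ler_pXn2r _ 2%N) ?nnegrE ?nm_ge0//.
apply: (cvgr_to_le (parseval_cvg dot_norm oe (x := v))); near=> N.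
pose w := \sum_(0 <= n < N) (rc (Num.sqrt (l n))^-1 * dot v (e n)) *: e n.
have Sw : S w = \sum_(0 <= n < N) dot v (e n) *: e n.
  rewrite (lin_sum lS); apply: eq_bigr => i _.
  rewrite (linZ lS) /S SE (diag_basis dot_norm oe sC) scalerA.
  have [ln|ln] := eqVneq (Num.sqrt (l i)) 0.
    have li : l i = 0 by apply/eqP; rewrite eq_le l0 andbT -sqrtr_eq0 ln.
    by rewrite Wv// mulr0 mul0r.
  by rewrite mulrAC -rmorphM /= mulVf// rmorph1 mul1r.
have E : sre (dot v (S w)) = \sum_(0 <= n < N) nm (dot v (e n)) ^+ 2.
  rewrite Sw dot_sumr sre_sum; apply: eq_bigr => i _.
  by rewrite dotZr mulrC nm_sqr.
have n1 : nm (S w) ^+ 2 <= \sum_(0 <= n < N) nm (dot v (e n)) ^+ 2.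
  by rewrite Sw; exact: (ons_nm_sum_le dot_norm (onb_ons oe)).
have n2 := h w; have n3 : sre (dot v (S w)) <= nm (dot v (S w)).
  exact: le_trans (ler_norm _) (sre_le_nm _).
rewrite /series /= -E; rewrite -E in n1.
have n4 := nm_ge0 (S w).
move: (sre _) (nm (S w)) (nm (dot v (S w))) n1 n2 n3 n4 => a q b n1 n2 n3 n4.
clear - M0 n1 n2 n3 n4; nra.
Unshelve. all: by end_near. Qed.

Lemma closure_range_eq0 v : W v -> (forall y, dot v (S y) = 0) -> v = 0.
Proof.
move=> Wv h; apply/eqP; rewrite -nm_eq0 eq_le nm_ge0 andbT.
by apply: closure_range_bound => // y; rewrite h nm0 mul0r.
Qed.

Lemma douglas Z C M : 0 <= C -> bounded_by M Z -> (forall y, nm (Z y) <= C * nm (S y)) ->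
  exists X, [/\ bounded_by C X, forall v, W (X v) & is_adjoint dot Z (S \o X)].
Proof.
move=> C0 bZ ZC; have lZ := bZ.1.
have [e [l [D [eP l0 sC bP SE]]]] := op_sqrt_spectral posP cP.
have oe := eigenbasis_onb eP; have lS := sqrt_linear.
pose s n := Num.sqrt (l n).
have Se n : S (e n) = rc (s n) *: e n by rewrite /S SE (diag_basis dot_norm oe sC).
(* These coordinates of X v are forced by Z^* = S X when s n is nonzero; the convention 0^-1 = 0
   makes the others vanish, which puts X v in [W]. *)
pose c v n := rc (s n)^-1 * dot v (Z (e n)).
have c_bound v N : \sum_(0 <= n < N) nm (c v n) ^+ 2 <= (C * nm v) ^+ 2.
  (* Chosen so that S w has coefficients c v n: their squared sum is then both |S w|^2 and <v, Z w>,
     and <v, Z w> <= |v| C |S w|. *)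
  pose w := \sum_(0 <= n < N) (rc (s n)^-1 * c v n) *: e n.
  have Sw : S w = \sum_(0 <= n < N) c v n *: e n.
    rewrite (lin_sum lS); apply: eq_bigr => i _; rewrite (linZ lS) Se scalerA.
    have [si|si] := eqVneq (s i) 0; first by rewrite /c si invr0 rmorph0 !mul0r.
    by rewrite mulrAC -rmorphM /= mulVf// rmorph1 mul1r.
  have nSw : nm (S w) ^+ 2 = \sum_(0 <= n < N) nm (c v n) ^+ 2.
    rewrite Sw (ons_nm_sum dot_norm (onb_ons oe)); apply: eq_bigr => i _.
    have [ei|ei] := (onb_ons oe).2 i.
      by rewrite /c ei (lin0 lZ) dot0r mulr0 !nm0 expr0n mulr0.
    by rewrite -[nm (e i) ^+ 2](sre_dotxx dot_norm) ei -(rmorph1 rc) sre_of_real mulr1.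
  have vZw : sre (dot v (Z w)) = \sum_(0 <= n < N) nm (c v n) ^+ 2.
    rewrite (lin_sum lZ) dot_sumr sre_sum; apply: eq_bigr => i _.
    rewrite (linZ lZ) dotZr rmorphM /= conj_of_real nm_sqr /c.
    by congr sre; rewrite mulrAC mulrC mulrA mulrAC mulrC mulrA.
  rewrite -nSw in vZw *.
  have h1 : sre (dot v (Z w)) <= nm v * nm (Z w).
    exact: le_trans (ler_norm _) (sre_dot_le dot_norm _ _).
  have h2 := ZC w; have h3 := nm_ge0 (S w); have h4 := nm_ge0 v.
  have h5 : nm v * nm (Z w) <= nm v * (C * nm (S w)) by rewrite ler_wpM2l.
  have h6 : nm (S w) ^+ 2 <= (C * nm v) * nm (S w).
    by rewrite -vZw (le_trans h1)// (le_trans h5)// mulrCA mulrA.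
  have h7 : nm (S w) <= C * nm v.
    have [->|q0] := eqVneq (nm (S w)) 0; first by rewrite mulr_ge0.
    by move: h6; rewrite expr2 ler_pM2r// lt_def q0.
  by rewrite ler_pXn2r ?nnegrE ?mulr_ge0.
have exX v : exists y, (forall n, dot y (e n) = c v n) /\ nm y <= C * nm v.
  have [y [_ ye yn]] := riesz_fischer dot_norm (onb_ons oe) (c_bound v).
  exists y; split; last by move: yn; rewrite ler_pXn2r ?nnegrE ?mulr_ge0 ?nm_ge0.
  move=> n; rewrite ye; have [en|->] := (onb_ons oe).2 n; last by rewrite mulr1.
  by rewrite /c en (lin0 lZ) dot0r mulr0 mul0r.
have [X hX] := choice exX.
have XE v n : dot (X v) (e n) = c v n by exact: (hX v).1.
exists X; split.
- split=> [d x y|v]; last exact: (hX v).2.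
  apply: (onb_ext oe) => n; rewrite !(dotDl, dotZl, XE) /c !(dotDl, dotZl).
  by rewrite mulrDr mulrCA.
- move=> v; apply/(closure_range_eigen _ eP bP) => n ln.
  by rewrite XE /c /s ln sqrtr0 invr0 rmorph0 mul0r.
move=> y v; apply: (basis_dot_ext dot_norm oe bZ) => n.
rewrite [RHS]dotC /= [dot (S _) _]sqrt_selfadjoint Se dotZr conj_of_real XE /c.
have [sn|sn] := eqVneq (s n) 0; last first.
  by rewrite mulrA -rmorphM mulfV// rmorph1 mul1r -dotC.
have -> : Z (e n) = 0.
  apply/eqP; rewrite -nm_eq0 eq_le nm_ge0 andbT; apply: le_trans (ZC _) _.
  by rewrite Se sn rmorph0 scale0r nm0 mulr0.
by rewrite dot0l sn rmorph0 mul0r rmorph0.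
Qed.

(* Applying [douglas] to D gives X1 with D = S X1 and |X1 v| <= C |S v|;
   applying it to X1 gives X with X1^* = S X, whence D = D^* = S X S. *)
Lemma sandwich_factor D C M : 0 <= C -> bounded_by M D -> selfadjoint dot D ->
  (forall x y, nm (dot (D x) y) <= C * nm (S x) * nm (S y)) ->
  exists X, [/\ bounded_by C X, selfadjoint dot X, forall v, W (X v) & D = S \o X \o S].
Proof.
move=> C0 bD sD DC; have [N N0 bS] := sqrt_bounded; have lS := sqrt_linear.
have sS := sqrt_selfadjoint.
have DS y : nm (D y) <= C * N * nm (S y).
  have [->|q0] := eqVneq (nm (D y)) 0; first by rewrite !mulr_ge0 ?nm_ge0.
  have q1 : 0 < nm (D y) by rewrite lt_def q0 nm_ge0.
  rewrite -(ler_pM2r q1) -expr2 -(sre_dotxx dot_norm).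
  apply: le_trans (ler_norm _) _; apply: le_trans (sre_le_nm _) _.
  apply: le_trans (DC _ _) _; rewrite -!mulrA ler_wpM2l// [leRHS]mulrCA ler_wpM2l ?nm_ge0//.
  exact: bS.2.
have [X1 [bX1 WX1 adj1]] := douglas (mulr_ge0 C0 N0) bD DS.
have SX1 : S \o X1 = D by rewrite (adjoint_unique dot_norm sD adj1).
have X1S v : nm (X1 v) <= C * nm (S v).
  apply: closure_range_bound => // [|y]; first by rewrite mulr_ge0 ?nm_ge0.
  by rewrite -sS -[S (X1 v)]/((S \o X1) v) SX1.
have [X [bX WX adj2]] := douglas C0 bX1 X1S.
have DE : D = S \o X \o S.
  have := adjoint_comp sS adj2; rewrite SX1 => /(adjoint_unique dot_norm sD) ->.
  by [].
exists X; split => //.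
(* Self-adjointness of X is checked on the eigenbasis of P: when the eigenvalue is 0, both X (e m)
   and the e m coordinates of all X v vanish; the other basis vectors lie in the range of S, where S
   X S = D is self-adjoint. *)
have [e [l [E [eP l0 sC bP SE]]]] := op_sqrt_spectral posP cP.
have oe := eigenbasis_onb eP.
have X0 m : l m = 0 -> X (e m) = 0.
  move=> lm; apply: closure_range_eq0 => // y.
  rewrite -sS -[S (X _)]/((S \o X) _) dotC -adj2.
  by have /(closure_range_eigen _ eP bP) -> := WX1 y; rewrite ?rmorph0.
have W0 v m : l m = 0 -> dot (X v) (e m) = 0.
  by move=> lm; have /(closure_range_eigen _ eP bP) -> := WX v.
apply: (basis_adjoint dot_norm oe bX bX) => n m.
have [lm|lm] := eqVneq (l m) 0; first by rewrite W0// X0// dot0r.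
have [ln|ln] := eqVneq (l n) 0.
  by rewrite dotC [RHS]dotC -!dotC X0// dot0l [RHS]dotC W0// rmorph0.
have rng i : l i != 0 -> exists y, e i = S y.
  move=> li; exists (rc (Num.sqrt (l i))^-1 *: e i).
  rewrite (linZ lS) /S SE (diag_basis dot_norm oe sC) scalerA -rmorphM /=.
  by rewrite mulVf ?rmorph1 ?scale1r// sqrtr_eq0 -ltNge lt_def li l0.
have [x ->] := rng n ln; have [y ->] := rng m lm.
by rewrite -sS -[S (X (S x))]/((S \o X \o S) x) -DE sD DE /= sS.
Qed.

End Sqrt.

Lemma selfadjoint_ge0 B x : selfadjoint dot B -> (0 <= dot x (B x)) = (0 <= sre (dot (B x) x)).
Proof.
move=> sB; have E : dot x (B x) = rc (sre (dot (B x) x)).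
  rewrite sB of_real_sre//.
  have : scalar_conj R k (dot x (B x)) = dot x (B x) by rewrite -dotC sB.
  case: k (dot x (B x)) => [z _|[a b]] /=; first exact: num_real.
  by move=> [] /eqP; rewrite eqNr complex_real.
by rewrite E of_real_ge0.
Qed.

(** Cauchy-Schwarz for the form of B, after |sqrt B z| <= sqrt C |sqrt P z|. *)
Lemma positive_form_le P B C x y : positive_op dot P -> compact_op P ->
  positive_op dot B -> compact_op B -> 0 <= C ->
  (forall z, sre (dot (B z) z) <= C * sre (dot (P z) z)) ->
  nm (dot (B x) y) <= C * nm (op_sqrt dot P x) * nm (op_sqrt dot P y).
Proof.
move=> posP cP posB cB C0 h.
have hz z : nm (op_sqrt dot B z) <= Num.sqrt C * nm (op_sqrt dot P z).
  rewrite -(@ler_pXn2r _ 2%N) ?nnegrE ?mulr_ge0 ?nm_ge0 ?sqrtr_ge0//.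
  by rewrite exprMn sqr_sqrtr// !nm_sqrt.
rewrite -(sqrt_sqr posB cB) /= (sqrt_selfadjoint posB cB).
apply: le_trans (cauchy_schwarz dot_norm _ _) _.
apply: (@le_trans _ _ ((Num.sqrt C * nm (op_sqrt dot P x)) * (Num.sqrt C * nm (op_sqrt dot P y)))).
  by apply: ler_pM; rewrite ?nm_ge0.
by rewrite mulrACA -expr2 sqr_sqrtr// mulrA.
Qed.

End SquareRoot.

Lemma le_1D_sqr (R : realType) (s d : R) : s ^+ 2 <= d -> s <= 1 + d.
Proof. by move=> h; have := sqr_ge0 (s - 1); rewrite sqrrB1 => h'; nra. Qed.

(** * Trace-class operators *)

Section TraceClass.
Context (R : realType) (k : scalar_kind).
Local Notation K := (scalar_field R k).
Local Notation cj := (scalar_conj R k).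
Local Notation rc := (of_real R k).
Context (H : completeNormedModType K) (dot : {dot H for @scalar_conj R k}).
Context (dot_norm : norm_from_dot dot) (H_separable : separable_space H).
Implicit Types (x y z u v : H) (c : K) (a b : nat -> R) (e f g h : nat -> H).
Implicit Types (A B P S T X Y Z : H -> H).

Lemma linear_adjoint A B : is_adjoint dot A B -> linear A.
Proof.
move=> hA c x y; apply: (dot_injr dot_norm) => z.
by rewrite dotC [RHS]dotC dotDl dotZl !hA dotDl dotZl.
Qed.

Lemma selfadjoint_dot_real X x : selfadjoint dot X -> dot (X x) x = rc (sre (dot (X x) x)).
Proof.
move=> sX; rewrite of_real_sre//.
have : scalar_conj R k (dot (X x) x) = dot (X x) x by rewrite -dotC sX.
case: k (dot (X x) x) => [z _|[r s]] /=; first exact: num_real.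
by move=> [] /eqP; rewrite eqNr complex_real.
Qed.

(** A polar-like factorization: each factor carries the square root of |A|, and the signs of the
    eigenvalues go into G'. *)
Lemma abs_sqrt_factor A C f a : bounded_by C A -> eigenbasis dot A f a ->
  exists G G', [/\ selfadjoint dot G /\ selfadjoint dot G',
    exists2 D, bounded_by D G & bounded_by D G',
    G' \o G = A, forall n, G (f n) = rc (Num.sqrt `|a n|) *: f n &
    forall n, G' (f n) = rc (Num.sg (a n) * Num.sqrt `|a n|) *: f n].
Proof.
move=> bA eA; have of_ := eigenbasis_onb eA.
have aC := eigenvalue_bound dot_norm bA eA.
have sC n : `|Num.sqrt `|a n| | <= Num.sqrt `|C|.
  by rewrite ger0_norm ?sqrtr_ge0// ler_wsqrtr.
have s'C n : `|Num.sg (a n) * Num.sqrt `|a n| | <= Num.sqrt `|C|.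
  apply: le_trans (sC n); rewrite normrM ler_piMl// normr_sg.
  by case: (a n != 0).
exists (diag dot f (fun n => Num.sqrt `|a n|)).
exists (diag dot f (fun n => Num.sg (a n) * Num.sqrt `|a n|)); split.
- by split; [exact: diag_selfadjoint sC|exact: diag_selfadjoint s'C].
- by exists (Num.sqrt `|C|); [exact: diag_bounded sC|exact: diag_bounded s'C].
- rewrite [RHS](eigenbasis_diag dot_norm bA eA) (diag_comp dot_norm of_ s'C sC).
  congr diag; apply/funext => n; rewrite -mulrA -expr2 sqr_sqrtr//.
  by rewrite mulr_sg_norm.
- by move=> n; rewrite (diag_basis dot_norm of_ sC).
- by move=> n; rewrite (diag_basis dot_norm of_ s'C).
Qed.

Section Pairing.
Variables (p : R) (q : \bar R) (pq : conjugate p q).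
Variables (A P : H -> H).
Hypotheses (Ap : schatten dot p%:E A) (sA : selfadjoint dot A).
Hypotheses (Pq : schatten dot q P).

Let p0 : 0 < p.
Proof. by case: pq => [[->]//|[r [_ p1 _ _]]]; exact: lt_trans p1. Qed.

Lemma schatten_has_trace : selfadjoint dot P -> exists c, has_trace dot (P \o A) c.
Proof.
move=> sP; have cP := schatten_compact Pq; have cA := schatten_compact Ap.
have [e [l eP]] := spectral dot_norm H_separable cP sP.
have [f [a eA]] := spectral dot_norm H_separable cA sA.
have [C C0 bP] := compact_op_bounded cP; have [D D0 bA] := compact_op_bounded cA.
have [q0 qN] := conjugate_gt0 pq.
have [_ lq] := (schatten_eigenE dot_norm bP eP sP q0 qN).1 Pq.
have [_ ap] := (schatten_eigen dot_norm bA eA sA p0).1 Ap.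
rewrite (eigenbasis_diag dot_norm bP eP) (eigenbasis_diag dot_norm bA eA).
apply: (holder_eigen dot_norm (eigenbasis_onb eA) (eigenbasis_onb eP) _ _ pq ap lq).
  exact: (eigenvalue_bound dot_norm bA eA).
exact: (eigenvalue_bound dot_norm bP eP).
Qed.

Hypothesis (posP : positive_op dot P).
Let S := op_sqrt dot P.
Let cP : compact_op P := schatten_compact Pq.

(** Splits S A S as (G' S)^* (G S). The squared Hilbert-Schmidt norms of both factors are dominated
    by the sum of |a_n| l_m |<f_n, e_m>|^2, which is finite because the eigenvalues have conjugate
    summability. *)
Lemma sandwich_hs : exists f a G G', [/\ eigenbasis dot A f a,
    selfadjoint dot G /\ selfadjoint dot G', G' \o G = A,
    (forall n, G (f n) = rc (Num.sqrt `|a n|) *: f n) /\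
    (forall n, G' (f n) = rc (Num.sg (a n) * Num.sqrt `|a n|) *: f n) &
    forall h, orthonormal_basis dot h ->
      (hs (G \o S) h < +oo)%E /\ (hs (G' \o S) h < +oo)%E].
Proof.
have cA := schatten_compact Ap; have [_ sP _] := posP.
have [e [l [E [eP l0 sC bP SE]]]] := op_sqrt_spectral dot_norm H_separable posP cP.
have [f [a eA]] := spectral dot_norm H_separable cA sA.
have [D D0 bA] := compact_op_bounded cA.
have [q0 qN] := conjugate_gt0 pq.
have [_ lq] := (schatten_eigenE dot_norm bP eP sP q0 qN).1 Pq.
have [_ ap] := (schatten_eigen dot_norm bA eA sA p0).1 Ap.
have oe := eigenbasis_onb eP; have of_ := eigenbasis_onb eA.
have [G [G' [[sG sG'] [M bG bG'] GG Gf G'f]]] := abs_sqrt_factor bA eA.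
have sS := sqrt_selfadjoint dot_norm H_separable posP cP.
exists f, a, G, G'; split=> // h oh.
have [u [v [u0 v0 auv uoo voo]]] :=
  conjugate_splits pq (eigenvalue_bound dot_norm bP eP) ap lq.
have key U s : selfadjoint dot U -> bounded_by M U ->
    (forall n, U (f n) = rc (s n) *: f n) -> (forall n, s n ^+ 2 <= `|a n|) ->
    (hs (U \o S) h < +oo)%E.
  move=> sU bU Uf sa.
  have [N sN] : exists N, forall n, `|s n| <= N.
    exists (1 + `|D|) => n; have h1 := eigenvalue_bound dot_norm bA eA n.
    have h2 : `|s n| ^+ 2 <= `|D| by rewrite real_normK ?num_real// (le_trans (sa n)).
    exact: le_1D_sqr h2.
  rewrite (diag_unique dot_norm of_ sN bU Uf) /S SE.
  have hsa := adjoint_comp (diag_selfadjoint dot_norm of_ sN) (diag_selfadjoint dot_norm oe sC).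
  rewrite (hs_indep dot_norm hsa oh oe).
  apply: (hs_diag_comp dot_norm of_ oe sN sC u0 v0 _ uoo voo) => n m.
  apply: le_trans (auv n m); rewrite sqr_sqrtr// (ger0_norm (l0 m)).
  by rewrite ler_wpM2r.
split; [apply: (key _ _ sG bG Gf)|apply: (key _ _ sG' bG' G'f)] => n.
  by rewrite sqr_sqrtr.
by rewrite exprMn sqr_sqrtr// ler_piMl// sqr_sg; case: (a n != 0).
Qed.

(* With A = G' G, both traces equal that of G (S X S) G'. *)
Lemma sandwich_trace X C : bounded_by C X -> selfadjoint dot X ->
  exists2 t, has_trace dot (S \o A \o S \o X) t &
    forall t', has_trace dot (S \o X \o S \o A) t' -> t' = t.
Proof.
move=> bX sX.
have [f [a [G [G' [eA [sG sG'] GG [Gf G'f] GS_hs]]]]] := sandwich_hs.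
have of_ := eigenbasis_onb eA.
have [h1 h2] := GS_hs f of_.
have sS := sqrt_selfadjoint dot_norm H_separable posP cP.
have lG : linear G' := linear_adjoint sG'.
have hT := adjoint_comp (adjoint_comp sG sS) sX.
have hsT : (hs (G \o S \o X) f < +oo)%E.
  exact: (hs_compr dot_norm (adjoint_comp sG sS) sX of_ bX).
have [t [t1 t2]] := has_trace_hs dot_norm hT (adjoint_comp sG' sS) of_ hsT h2.
exists t; first by rewrite -GG.
move=> t' /(_ f of_) t't; have := t2 f of_.
have -> : (fun n => dot ((G \o S \o X \o (S \o G')) (f n)) (f n)) =
          (fun n => dot ((S \o X \o S \o A) (f n)) (f n)).
  (* In an eigenbasis of A both diagonals equal a n <S X S f_n, f_n>, as sg a * sqrt |a| * sqrt |a|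
     = a. *)
  apply/funext => n; rewrite /= sG Gf G'f; case: eA => _ -> _.
  have lin := linear_adjoint (adjoint_comp (adjoint_comp sS sX) sS).
  have linZ' d z : S (X (S (d *: z))) = d *: S (X (S z)) by exact: (linZ lin d z).
  rewrite !linZ' !dotZl dotZr conj_of_real mulrA -rmorphM /=; congr (rc _ * _).
  by rewrite -mulrA -expr2 sqr_sqrtr// mulr_sg_norm.
by move=> h3; exact: (cvg_uniq (V := K^o) t't h3).
Qed.

End Pairing.

(** For Y compact and self-adjoint, the trace norm is the least such M. Unlike the sum of absolute
    eigenvalues, this description is visibly subadditive. *)
Definition quad_bound Y M := forall h, orthonormal_basis dot h ->
  forall N, \sum_(0 <= n < N) `|sre (dot (Y (h n)) (h n))| <= M.

Definition tn Y : R := sre (trace_norm dot Y).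

Lemma trace_class_compact Y : trace_class dot Y -> compact_op Y.
Proof. exact: schatten_compact. Qed.

Lemma trace_norm_tn Y g b : selfadjoint dot Y -> trace_class dot Y ->
  eigenbasis dot Y g b ->
  [/\ trace_norm dot Y = rc (tn Y), series (fun n => `|b n|) @ \oo --> tn Y &
     (\sum_(n <oo) `|b n|%:E = (tn Y)%:E)%E].
Proof.
move=> sY tY eY; have [C C0 bY] := compact_op_bounded (trace_class_compact tY).
have [_ bsum] := (trace_class_eigen dot_norm bY eY sY).1 tY.
have [l bl ble] := nneseries_cvg (fun n => normr_ge0 (b n)) bsum.
have E := trace_norm_eigen dot_norm bY eY sY bl.
by rewrite /tn E sre_of_real ble; split.
Qed.

Lemma tn_ge0 Y : selfadjoint dot Y -> trace_class dot Y -> 0 <= tn Y.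
Proof.
move=> sY tY; have [g [b eY]] := spectral dot_norm H_separable (trace_class_compact tY) sY.
have [_ _] := trace_norm_tn sY tY eY; rewrite -lee_fin => <-.
by apply: nneseries_ge0 => n _ _; rewrite lee_fin.
Qed.

Lemma trace_class_quad_bound Y : selfadjoint dot Y -> trace_class dot Y -> quad_bound Y (tn Y).
Proof.
move=> sY tY h oh N; have cY := trace_class_compact tY.
have [g [b eY]] := spectral dot_norm H_separable cY sY.
have [C C0 bY] := compact_op_bounded cY; have og := eigenbasis_onb eY.
have [_ _ bsum] := trace_norm_tn sY tY eY.
rewrite -lee_fin -bsum.
apply: le_trans (weighted_sum_le dot_norm og oh (fun n => normr_ge0 (b n))).
rewrite nneseries_interchange; last by move=> i j; rewrite lee_fin mulr_ge0 ?sqr_ge0.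
pose w n : \bar R := (\sum_(m <oo) (`|b m| * nm (dot (h n) (g m)) ^+ 2)%:E)%E.
apply: (@le_trans _ _ (\sum_(n <oo) w n)%E); last first.
  rewrite le_eqVlt; apply/orP; left; apply/eqP; apply: eq_eseriesr => n _.
  by apply: eq_eseriesr => m _; rewrite nm_dotC.
have w0 n : (0 <= w n)%E by apply: nneseries_ge0 => m _ _; rewrite lee_fin mulr_ge0 ?sqr_ge0.
apply: (@le_trans _ _ (\sum_(0 <= n < N) w n)%E); last exact: nneseries_lim_ge.
rewrite -sumEFin; apply: lee_sum => n _.
have quad := quad_cvg dot_norm bY eY (x := h n).
have M0 m : 0 <= `|b m| * nm (dot (h n) (g m)) ^+ 2 by rewrite mulr_ge0 ?sqr_ge0.
have [woo|] := eqVneq (w n) +oo%E; first by rewrite woo leey.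
rewrite -ltey => /(nneseries_cvg M0)[L _ wL]; rewrite /w wL lee_fin.
have psum m : \sum_(0 <= i < m) `|b i| * nm (dot (h n) (g i)) ^+ 2 <= L.
  by rewrite -lee_fin -wL sum_le_nneseries.
have qb m : `|series (fun m => b m * nm (dot (h n) (g m)) ^+ 2) m| <= L.
  apply: le_trans (psum m); apply: le_trans (ler_norm_sum _ _ _) _.
  by apply: ler_sum => i _; rewrite normrM (ger0_norm (sqr_ge0 _)).
rewrite ler_norml; apply/andP; split.
  by apply: (cvgr_to_ge quad); near=> m; have := qb m; rewrite ler_norml => /andP[].
by apply: (cvgr_to_le quad); near=> m; have := qb m; rewrite ler_norml => /andP[].
Unshelve. all: by end_near. Qed.

Lemma quad_bound_trace_class Y M : compact_op Y -> selfadjoint dot Y -> quad_bound Y M ->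
  trace_class dot Y /\ tn Y <= M.
Proof.
move=> cY sY YM; have [g [b eY]] := spectral dot_norm H_separable cY sY.
have [C C0 bY] := compact_op_bounded cY; have og := eigenbasis_onb eY.
have bM N : \sum_(0 <= n < N) `|b n| <= M.
  apply: le_trans (YM g og N); apply: ler_sum => n _; case: (eY) => _ -> _.
  by rewrite dotZl sreZ (sre_dotxx dot_norm) (eigenbasis_nm dot_norm eY).
have bsum := nneseries_lty (fun n => normr_ge0 (b n)) bM.
have tY : trace_class dot Y by apply/(trace_class_eigen dot_norm bY eY sY).
split => //; have [_ _ E] := trace_norm_tn sY tY eY.
by rewrite -lee_fin -E; apply: nneseries_le_bound.
Qed.

Lemma quad_boundD Y Z M M' : quad_bound Y M -> quad_bound Z M' -> quad_bound (Y + Z) (M + M').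
Proof.
move=> hY hZ h oh N; apply: le_trans (lerD (hY h oh N) (hZ h oh N)).
by rewrite -big_split /=; apply: ler_sum => n _; rewrite !fctE dotDl sreD ler_normD.
Qed.

Lemma quad_boundZ Y (r : R) M : quad_bound Y M -> quad_bound (fun x => rc r *: Y x) (`|r| * M).
Proof.
move=> hY h oh N; apply: le_trans (ler_wpM2l (normr_ge0 r) (hY h oh N)).
by rewrite mulr_sumr; apply: ler_sum => n _; rewrite dotZl sreZ normrM.
Qed.

Lemma trace_classD Y Z : selfadjoint dot Y -> trace_class dot Y ->
  selfadjoint dot Z -> trace_class dot Z ->
  trace_class dot (Y + Z) /\ tn (Y + Z) <= tn Y + tn Z.
Proof.
move=> sY tY sZ tZ; apply: quad_bound_trace_class.
- by apply: compact_opD; exact: trace_class_compact.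
- exact: selfadjointD.
- by apply: quad_boundD; exact: trace_class_quad_bound.
Qed.

Lemma trace_classZ Y (r : R) : selfadjoint dot Y -> trace_class dot Y ->
  trace_class dot (fun x => rc r *: Y x) /\ tn (fun x => rc r *: Y x) <= `|r| * tn Y.
Proof.
move=> sY tY; apply: quad_bound_trace_class.
- by apply: compact_opZ; exact: trace_class_compact.
- exact: selfadjointZ.
- by apply: quad_boundZ; exact: trace_class_quad_bound.
Qed.

(** Write Y = G' G with Hilbert-Schmidt factors. Then Y X = G' (G X) has a trace, equal to that of G
    X G', whose diagonal in an eigenbasis of Y is b n <X g_n, g_n>; reality and the bound follow. *)
Lemma trace_class_pairing Y X C g b : selfadjoint dot Y -> trace_class dot Y ->
  eigenbasis dot Y g b -> bounded_by C X -> selfadjoint dot X ->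
  exists t : R, [/\ has_trace dot (Y \o X) (rc t),
    series (fun n => b n * sre (dot (X (g n)) (g n))) @ \oo --> t & `|t| <= C * tn Y].
Proof.
move=> sY tY eY bX sX; have cY := trace_class_compact tY.
have [D D0 bY] := compact_op_bounded cY; have og := eigenbasis_onb eY.
have [_ bcvg bsum] := trace_norm_tn sY tY eY.
have b_le N : \sum_(0 <= n < N) `|b n| <= tn Y.
  by rewrite -lee_fin -bsum sum_le_nneseries.
(* A negative C forces H to be trivial, in which case all sums vanish. *)
have C0 : 0 <= C \/ forall x, nm x = 0.
  have [C0|C0] := leP 0 C; [by left|right => x].
  apply/eqP; rewrite eq_le nm_ge0 andbT leNgt; apply/negP => x0.
  have := le_trans (nm_ge0 _) (bX.2 x); rewrite leNgt => /negP; apply.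
  by rewrite pmulr_llt0.
have [G [G' [[sG sG'] [M bG bG'] GG Gg G'g]]] := abs_sqrt_factor bY eY.
have hs_le U (s : nat -> R) : (forall n, U (g n) = rc (s n) *: g n) ->
    (forall n, s n ^+ 2 <= `|b n|) -> (hs U g < +oo)%E.
  move=> Ug sb; apply: (nneseries_lty (M := tn Y)) => [n|N]; first exact: sqr_ge0.
  apply: le_trans (b_le N); apply: ler_sum => n _; apply: le_trans (sb n).
  rewrite Ug nmZ nm_of_real exprMn real_normK ?num_real// ler_piMr ?sqr_ge0//.
  by rewrite expr_le1 ?nm_ge0// (ons_nm_le1 dot_norm (onb_ons og)).
have hG : (hs G g < +oo)%E by apply: (hs_le _ _ Gg) => n; rewrite sqr_sqrtr.
have hG' : (hs G' g < +oo)%E.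
  apply: (hs_le _ _ G'g) => n.
  by rewrite exprMn sqr_sqrtr// ler_piMl// sqr_sg; case: (b n != 0).
have hGX := hs_compr dot_norm sG sX og bX hG.
have [c [c1 c2]] := has_trace_hs dot_norm (adjoint_comp sG sX) sG' og hGX hG'.
have c2g := c2 g og.
have E n : dot ((G \o X \o G') (g n)) (g n) = rc (b n * sre (dot (X (g n)) (g n))).
  rewrite /= sG Gg G'g (linZ bX.1) dotZl dotZr conj_of_real mulrA.
  rewrite rmorphM -(selfadjoint_dot_real (g n) sX) -rmorphM /=; congr (rc _ * _).
  by rewrite -mulrA -expr2 sqr_sqrtr// mulr_sg_norm.
have c2g' : series (fun n => b n * sre (dot (X (g n)) (g n))) @ \oo --> sre c.
  pose proof (sre_cvg c2g) as h; move: h; apply: cvg_trans; apply: near_eq_cvg; near=> n.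
  rewrite /series /= sre_sum; apply: eq_bigr => i _.
  by rewrite -[X in sre X]/(dot ((G \o X \o G') (g i)) (g i)) E sre_of_real.
have cE : c = rc (sre c).
  apply: (cvg_uniq (V := K^o) c2g).
  have -> : series (fun n => dot ((G \o X \o G') (g n)) (g n)) =
      fun n => rc (series (fun n => b n * sre (dot (X (g n)) (g n))) n).
    by apply/funext => n; rewrite /series /= rmorph_sum /=; apply: eq_bigr => i _; exact: E.
  apply/(@nm_cvgP R k K^o) => d d0; move/cvgrPdistC_lt/(_ d d0) : c2g'.
  by apply: filterS => n; rewrite -rmorphB /= nm_of_real.
exists (sre c); split => //; first by rewrite -cE -GG.
have bnd N : `|series (fun n => b n * sre (dot (X (g n)) (g n))) N| <= C * tn Y.
  have [C0'|x0] := C0; last first.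
    rewrite /series /= big1 ?normr0; last first.
      move=> i _; have /eqP := x0 (g i); rewrite nm_eq0 => /eqP ->.
      by rewrite dot0r sre0 mulr0.
    have <- : 0 = tn Y; last by rewrite mulr0.
    apply: EFin_inj; rewrite -bsum eseries0// => i _ _.
    have /eqP := x0 (g i); rewrite nm_eq0 => /eqP gi.
    by rewrite (eigenbasis0 eY gi) normr0.
  apply: le_trans (ler_norm_sum _ _ _) _.
  apply: le_trans (ler_wpM2l C0' (b_le N)); rewrite mulr_sumr; apply: ler_sum => n _.
  rewrite normrM mulrC ler_wpM2r// (le_trans (sre_dot_le dot_norm _ _))//.
  have h1 := bX.2 (g n); have h2 := ons_nm_le1 dot_norm (onb_ons og) n.
  have h3 := nm_ge0 (g n); have h4 := nm_ge0 (X (g n)).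
  have h5 : nm (X (g n)) * nm (g n) <= C * nm (g n) * nm (g n) by rewrite ler_wpM2r.
  apply: le_trans h5 _; rewrite -mulrA ler_piMr// mulr_ile1//.
rewrite ler_norml; apply/andP; split.
  by apply: (cvgr_to_ge c2g'); near=> m; have := bnd m; rewrite ler_norml => /andP[].
by apply: (cvgr_to_le c2g'); near=> m; have := bnd m; rewrite ler_norml => /andP[].
Unshelve. all: by end_near. Qed.

(** The symmetrized rank-one operator: self-adjoint and real-bilinear in x and y, so that a
    functional on self-adjoint operators induces a symmetric real form. *)
Definition rank2 x y : H -> H := fun z => dot z y *: x + dot z x *: y.

Lemma rank1_compact x y : compact_op (fun z => dot z y *: x).
Proof.
apply/compact_op_ultra; split.
  by move=> c u v; rewrite dotDl dotZl scalerDl scalerA.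
move=> F FU F1.
have /cvg_ex[c Fc] : cvg ((fun z => dot z y) @ F).
  apply: (@scalar_bounded_ultra R k _ F _ _ (nm y)); apply: filterS F1 => z /= z1.
  by apply: le_trans (cauchy_schwarz dot_norm _ _) _; rewrite ler_piMl ?nm_ge0.
apply/cvg_ex; exists (c *: x); apply/nm_cvgP => d d0.
have x0 : 0 < nm x + 1 by rewrite ltr_wpDl ?nm_ge0.
move/(@nm_cvgP R k K^o)/(_ (d / (nm x + 1))) : Fc; rewrite divr_gt0// => /(_ isT).
apply: filterS => z; rewrite ltr_pdivlMr// => h; rewrite -scalerBl nmZ.
by apply: le_lt_trans h; rewrite ler_wpM2l ?nm_ge0// lerDl.
Qed.

Lemma rank2_compact x y : compact_op (rank2 x y).
Proof. exact: compact_opD (rank1_compact x y) (rank1_compact y x). Qed.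

Lemma rank2_selfadjoint x y : selfadjoint dot (rank2 x y).
Proof.
move=> u v; rewrite /rank2 dotDl dotDr !dotZl !dotZr addrC.
by rewrite -![scalar_conj R k _]dotC; congr (_ + _); rewrite mulrC.
Qed.

Lemma rank2_trace_class x y : trace_class dot (rank2 x y) /\ tn (rank2 x y) <= 2 * (nm x * nm y).
Proof.
apply: quad_bound_trace_class; [exact: rank2_compact|exact: rank2_selfadjoint|].
have [->|x0] := eqVneq x 0.
  move=> h oh N; rewrite big1 ?nm0 ?mul0r ?mulr0// => n _.
  by rewrite /rank2 scaler0 dot0r scale0r addr0 dot0l sre0 normr0.
have [->|y0] := eqVneq y 0.
  move=> h oh N; rewrite big1 ?nm0 ?mulr0// => n _.
  by rewrite /rank2 scaler0 dot0r scale0r addr0 dot0l sre0 normr0.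
have nx : 0 < nm x by rewrite lt_def nm_eq0 x0 nm_ge0.
have ny : 0 < nm y by rewrite lt_def nm_eq0 y0 nm_ge0.
(* This r balances 2 s t <= r s^2 + t^2 / r: summed by Bessel, the right side becomes r |x|^2 +
   |y|^2 / r = 2 |x| |y|. *)
move=> h oh N; pose r := nm y / nm x; have r0 : 0 < r by rewrite divr_gt0.
have -> : 2 * (nm x * nm y) = r * nm x ^+ 2 + r^-1 * nm y ^+ 2.
  by rewrite /r; field; rewrite !gt_eqF.
apply: (@le_trans _ _ (r * (\sum_(0 <= n < N) nm (dot x (h n)) ^+ 2) +
                       r^-1 * (\sum_(0 <= n < N) nm (dot y (h n)) ^+ 2))); last first.
  by rewrite lerD// ler_wpM2l ?invr_ge0 ?(ltW r0)// (bessel dot_norm (onb_ons oh)).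
rewrite !mulr_sumr -big_split /=; apply: ler_sum => n _.
rewrite /rank2 dotDl !dotZl.
apply: le_trans (sre_le_nm _) _; apply: le_trans (nmD _ _) _.
rewrite !nmM (nm_dotC dot (h n) y) (nm_dotC dot (h n) x).
move: (nm (dot x (h n))) (nm (dot y (h n))) => s t.
have := sqr_ge0 (r * s - t) => h1.
have -> : r * s ^+ 2 + r^-1 * t ^+ 2 = t * s + s * t + r^-1 * (r * s - t) ^+ 2.
  by field; rewrite gt_eqF.
by rewrite lerDl mulr_ge0 ?invr_ge0 ?(ltW r0).
Qed.

End TraceClass.

(** * The Hahn-Banach theorem *)

Section HahnBanach.
Context (R : realType) (k : scalar_kind).
Local Notation K := (scalar_field R k).
Local Notation rc := (of_real R k).
Context (U : lmodType K) (V : set U).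
Hypothesis VD : forall x y, V x -> V y -> V (x + y).
Hypothesis VZ : forall (r : R) x, V x -> V (rc r *: x).
Implicit Types (x y : U) (p d : U -> R).

(** Relative to [V], a real subspace of a module over the possibly complex field; functionals are
    still total functions on U. *)
Definition sublinear_on p := (forall x y, V x -> V y -> p (x + y) <= p x + p y) /\
  (forall (t : R) x, 0 <= t -> V x -> p (rc t *: x) = t * p x).

Let VN x : V x -> V (- x).
Proof. by move=> /(VZ (-1)); rewrite rmorphN rmorph1 scaleN1r. Qed.

Let sub0 p x : sublinear_on p -> V x -> p 0 = 0.
Proof. by move=> [_ pZ] Vx; rewrite -(scale0r x) -(rmorph0 rc) pZ// mul0r. Qed.

Let subN p x : sublinear_on p -> V x -> - p (- x) <= p x.
Proof.
move=> sp Vx; rewrite lerNl -subr_ge0 opprK -(sub0 sp Vx) -[X in p X](addNr x).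
exact: sp.1 (VN Vx) Vx.
Qed.

(** For p sublinear, the greatest sublinear functional below p whose value at - y is at most - p
    y. *)
Let slope p y x : R := inf [set p (x + rc t *: y) - t * p y | t in [set t : R | 0 <= t]].

Let slope_lb p y x : sublinear_on p -> V x -> V y ->
  lbound [set p (x + rc t *: y) - t * p y | t in [set t : R | 0 <= t]] (- p (- x)).
Proof.
move=> sp Vx Vy _ [t /= t0 <-]; rewrite lerBrDr addrC lerBlDr -sp.2//.
rewrite -[X in p X <= _](addrK x) (addrC _ x).
by apply: sp.1; [apply: VD => //; exact: VZ|exact: VN].
Qed.

Let slope_le p y x t : sublinear_on p -> V x -> V y -> 0 <= t ->
  slope p y x <= p (x + rc t *: y) - t * p y.
Proof.
move=> sp Vx Vy t0; apply: ge_inf; last by exists t.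
by exists (- p (- x)); exact: slope_lb.
Qed.

Let slope_ge p y x m : (forall t : R, 0 <= t -> m <= p (x + rc t *: y) - t * p y) ->
  m <= slope p y x.
Proof.
move=> h; apply: lb_le_inf; last by move=> _ [t t0 <-]; exact: h.
by exists (p (x + rc 0 *: y) - 0 * p y), 0 => /=.
Qed.

Let slope_le_id p y x : sublinear_on p -> V x -> V y -> slope p y x <= p x.
Proof.
move=> sp Vx Vy; apply: le_trans (slope_le sp Vx Vy (lexx 0)) _.
by rewrite rmorph0 scale0r addr0 mul0r subr0.
Qed.

Let slopeN p y : sublinear_on p -> V y -> slope p y (- y) <= - p y.
Proof.
move=> sp Vy; apply: le_trans (slope_le sp (VN Vy) Vy ler01) _.
by rewrite rmorph1 scale1r addNr (sub0 sp Vy) mul1r sub0r.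
Qed.

Let slope_sublinear p y : sublinear_on p -> V y -> sublinear_on (slope p y).
Proof.
move=> sp Vy; split=> [x x' Vx Vx'|t x t0 Vx].
  apply/ler_addgt0Pr => eps eps0; have e2 : 0 < eps / 2 by rewrite divr_gt0.
  have inf_ex z : V z -> exists2 t, 0 <= t & p (z + rc t *: y) - t * p y < slope p y z + eps / 2.
    move=> Vz; have [|_ [t /= t0 <-] h] :=
        @inf_adherent _ [set p (z + rc t *: y) - t * p y | t in [set t : R | 0 <= t]] _ e2.
      split; last by exists (- p (- z)); exact: slope_lb.
      by exists (p (z + rc 0 *: y) - 0 * p y), 0 => /=.
    by exists t.
  have [t t0 ht] := inf_ex x Vx; have [t' t'0 ht'] := inf_ex x' Vx'.
  apply: le_trans (slope_le sp (VD Vx Vx') Vy (addr_ge0 t0 t'0)) _.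
  have := sp.1 _ _ (VD Vx (VZ t Vy)) (VD Vx' (VZ t' Vy)).
  rewrite rmorphD scalerDl addrACA /=; lra.
have [->|tn0] := eqVneq t 0.
  rewrite rmorph0 scale0r mul0r; apply/eqP; rewrite eq_le; apply/andP; split.
    have V0 : V 0 by rewrite -(scale0r y) -(rmorph0 rc); exact: VZ.
    by apply: le_trans (slope_le_id sp V0 Vy) _; rewrite (sub0 sp Vy).
  by apply: slope_ge => s s0; rewrite add0r sp.2// subrr.
have tpos : 0 < t by rewrite lt_def tn0.
(* One inequality for all positive factors suffices: applied to t^-1 it gives the converse. *)
have half (s : R) z : 0 < s -> V z -> slope p y (rc s *: z) <= s * slope p y z.
  move=> s0 Vz; rewrite -ler_pdivrMl//; apply: slope_ge => r r0.
  rewrite ler_pdivrMl//; apply: le_trans (slope_le sp (VZ s Vz) Vy (mulr_ge0 (ltW s0) r0)) _.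
  by rewrite rmorphM /= -scalerA -scalerDr sp.2 ?(ltW s0)//;
      [rewrite mulrBr mulrA|apply: VD => //; exact: VZ].
apply/eqP; rewrite eq_le half//=.
have := half t^-1 (rc t *: x); rewrite invr_gt0 => /(_ tpos (VZ t Vx)).
by rewrite scalerA -rmorphM /= mulVf// rmorph1 scale1r ler_pdivlMl.
Qed.

(* A sublinear functional p that is minimal among those below d is additive:
   [slope p y] is sublinear and below p, so p (- y) <= slope p y (- y) <= - p y.
   Starting from [slope d y0] forces p y0 >= d y0. *)
Lemma hahn_banach d y0 : sublinear_on d -> V y0 -> exists p,
  [/\ forall x y, V x -> V y -> p (x + y) = p x + p y,
      forall (t : R) x, V x -> p (rc t *: x) = t * p x,
      forall x, V x -> p x <= d x & d y0 <= p y0].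
Proof.
move=> sd Vy0; pose d' := slope d y0.
have sd' : sublinear_on d' by exact: slope_sublinear.
pose T := {p : U -> R | sublinear_on p /\ forall x, V x -> p x <= d' x}.
pose t0 : T := exist _ d' (conj sd' (fun x _ => lexx _)).
(* The order is reversed, so that the maximal element supplied by Zorn is a minimal functional. *)
pose Rel (p q : T) : bool := `[< forall x, V x -> sval q x <= sval p x >].
have [| | |[p [sp pd']] pmax] := @ZL_preorder T t0 Rel.
- by move=> p; apply/asboolP.
- move=> p q r /asboolP pq /asboolP qr; apply/asboolP => x Vx.
  exact: le_trans (qr x Vx) (pq x Vx).
- move=> A Atot; have [[a Aa]|A0] := pselect (exists a, A a); last first.
    by exists t0 => s As; exfalso; apply: A0; exists s.
  pose vals x := [set sval (q : T) x | q in A].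
  have lb x : V x -> has_inf (vals x).
    move=> Vx; split; first by exists (sval a x), a.
    exists (- d' (- x)) => _ [[q [sq qd]] /= Aq <-].
    by apply: le_trans (subN sq Vx); rewrite lerN2 qd//; exact: VN.
  (* The pointwise infimum of a chain is again subadditive: of two members nearly optimal at x and
     at y, the smaller is nearly optimal at both. *)
  pose m x := inf (vals x).
  have m_le q x : A q -> V x -> m x <= sval q x.
    by move=> Aq Vx; apply: ge_inf; [exact: (lb x Vx).2|exists q].
  have m_ge x c : (forall q, A q -> c <= sval q x) -> c <= m x.
    move=> h; apply: lb_le_inf; first by exists (sval a x), a.
    by move=> _ [q Aq <-]; exact: h.
  have sm : sublinear_on m.
    split=> [x y Vx Vy|t x t_ge0 Vx].
      apply/ler_addgt0Pr => eps eps0; have e2 : 0 < eps / 2 by rewrite divr_gt0.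
      have [_ [q Aq <-] hq] := inf_adherent e2 (lb x Vx).
      have [_ [r Ar <-] hr] := inf_adherent e2 (lb y Vy).
      rewrite -/(m x) -/(m y) in hq hr.
      have [s [As [sx sy]]] : exists s, A s /\ sval s x <= sval q x /\ sval s y <= sval r y.
        have [/asboolP h|/asboolP h] := Atot q r Aq Ar.
          by exists r; split=> //; split => //; exact: h.
        by exists q; split=> //; split => //; exact: h.
      have h1 := m_le s _ As (VD Vx Vy); have h2 := (svalP s).1.1 x y Vx Vy.
      apply: le_trans h1 _; apply: le_trans h2 _; apply: le_trans (lerD sx sy) _.
      by rewrite [eps]splitr addrACA ltW// ltrD.
    have half (s : R) z : 0 < s -> V z -> m (rc s *: z) <= s * m z.
      move=> s0 Vz; rewrite -ler_pdivrMl//; apply: m_ge => q Aq.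
      rewrite ler_pdivrMl// -(svalP q).1.2 ?(ltW s0)//.
      by apply: m_le => //; exact: VZ.
    have [->|tn0] := eqVneq t 0.
      rewrite rmorph0 scale0r mul0r; apply/eqP; rewrite eq_le; apply/andP; split.
        have V0 : V 0 by rewrite -(scale0r x) -(rmorph0 rc); exact: VZ.
        by apply: le_trans (m_le a _ Aa V0) _; rewrite (sub0 (svalP a).1 Vx).
      by apply: m_ge => q Aq; rewrite (sub0 (svalP q).1 Vx).
    have tpos : 0 < t by rewrite lt_def tn0.
    apply/eqP; rewrite eq_le half//=.
    have := half t^-1 (rc t *: x); rewrite invr_gt0 => /(_ tpos (VZ t Vx)).
    by rewrite scalerA -rmorphM /= mulVf// rmorph1 scale1r ler_pdivlMl.
  have md x : V x -> m x <= d' x.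
    by move=> Vx; apply: le_trans (m_le a x Aa Vx) ((svalP a).2 x Vx).
  by exists (exist _ m (conj sm md)) => q Aq; apply/asboolP => x Vx; exact: m_le.
have pN y : V y -> p (- y) = - p y.
  move=> Vy; apply/eqP; rewrite eq_le; apply/andP; split; last first.
    by have := subN sp (VN Vy); rewrite opprK.
  have ss := slope_sublinear sp Vy.
  have sd'' x : V x -> slope p y x <= d' x.
    by move=> Vx; apply: le_trans (slope_le_id sp Vx Vy) (pd' x Vx).
  have /asboolP/(_ _ (VN Vy)) /= h := pmax (exist _ (slope p y) (conj ss sd''))
    (asboolT (fun x Vx => slope_le_id sp Vx Vy)).
  exact: le_trans h (slopeN sp Vy).
exists p; split.
- move=> x y Vx Vy; apply/eqP; rewrite eq_le sp.1//=.
  have := sp.1 _ _ (VD Vx Vy) (VN Vy); by rewrite addrK pN// lerBrDr.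
- move=> t x Vx; have [t_ge0|t_lt0] := leP 0 t; first exact: sp.2.
  rewrite -[t]opprK rmorphN scaleNr pN; last exact: VZ.
  by rewrite sp.2 ?oppr_ge0 ?(ltW t_lt0)// !mulNr.
- by move=> x Vx; apply: le_trans (pd' x Vx) (slope_le_id sd Vx Vy0).
- rewrite -lerN2 -pN//; apply: le_trans (pd' _ (VN Vy0)) _.
  exact: slopeN.
Qed.

End HahnBanach.

(** * Real linear spans *)

Section RealSpan.
Context (R : realType) (k : scalar_kind).
Local Notation K := (scalar_field R k).
Local Notation rc := (of_real R k).
Context (U : lmodType K) (I : Type) (v : I -> U).

Lemma real_span_gen i : real_span v (v i).
Proof.
exists 1%N, (fun=> 1), (fun=> i); split=> [j|]; first exact: real1.
by rewrite big_ord1 scale1r.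
Qed.

Lemma real_span0 : real_span v 0.
Proof.
(* [I] may be empty, so the index function on ['I_0] is defined by absurdity. *)
exists 0%N, (fun=> 1),
  (fun j : 'I_0 => match j with Ordinal m lt_m => False_rect I (notF lt_m) end).
by split=> [[]//|]; rewrite big_ord0.
Qed.

Lemma real_spanD x y : real_span v x -> real_span v y -> real_span v (x + y).
Proof.
move=> [n [c [i [cR ->]]]] [m [c' [i' [cR' ->]]]].
exists (n + m)%N, (fun j => match fintype.split j with inl a => c a | inr b => c' b end),
  (fun j => match fintype.split j with inl a => i a | inr b => i' b end); split.
  by move=> j; case: (fintype.split j).
rewrite big_split_ord /=; congr (_ + _); apply: eq_bigr => j _.
  by rewrite (unsplitK (inl j)).
by rewrite (unsplitK (inr j)).
Qed.

Lemma real_spanZ (r : R) x : real_span v x -> real_span v (rc r *: x).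
Proof.
move=> [n [c [i [cR ->]]]]; exists n, (fun j => rc r * c j), i; split.
  by move=> j; rewrite realM// of_real_real.
by rewrite scaler_sumr; apply: eq_bigr => j _; rewrite scalerA.
Qed.

Lemma real_span_ind (Q : set U) : Q 0 -> (forall x y, Q x -> Q y -> Q (x + y)) ->
  (forall (r : R) x, Q x -> Q (rc r *: x)) -> (forall i, Q (v i)) ->
  real_span v `<=` Q.
Proof.
move=> Q0 QD QZ Qv _ [n [c [i [cR ->]]]].
elim/big_ind : _ => // j _; rewrite -(of_real_sre (cR j)); exact: QZ.
Qed.

End RealSpan.

(** * Functionals continuous for the trace norm *)

Section Representation.
Context (R : realType) (k : scalar_kind).
Local Notation K := (scalar_field R k).
Local Notation cj := (scalar_conj R k).
Local Notation rc := (of_real R k).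
Context (H : completeNormedModType K) (dot : {dot H for @scalar_conj R k}).
Context (dot_norm : norm_from_dot dot) (H_separable : separable_space H).
Implicit Types (x y z u v : H) (c : K) (a b : nat -> R) (e f g h : nat -> H).
Implicit Types (A B P S T X Y Z : H -> H).

(** [scalar_riesz] gives the coefficient c n along each basis vector. Testing F on the partial sums
    of c n e n yields the bound M^2 for the sum of the |c n|^2, and Riesz-Fischer assembles u. *)
Lemma real_riesz (F : H -> R) M : 0 <= M -> (forall x y, F (x + y) = F x + F y) ->
  (forall (r : R) x, F (rc r *: x) = r * F x) -> (forall x, `|F x| <= M * nm x) ->
  exists2 u, nm u <= M & forall x, F x = sre (dot x u).
Proof.
move=> M0 FD FZ FM; have [e oe] := onb_exists dot_norm H_separable.
have F0 : F 0 = 0 by rewrite -(scale0r 0) -(rmorph0 rc) FZ mul0r.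
have Fsum N (w : nat -> H) : F (\sum_(0 <= i < N) w i) = \sum_(0 <= i < N) F (w i).
  by apply: (big_morph F); [exact: FD|exact: F0].
have exc n : exists c, (forall d, F (d *: e n) = sre (d * cj c)) /\ (e n = 0 -> c = 0).
  have [en|en] := eqVneq (e n) 0.
    exists 0; split => // d; rewrite en scaler0 F0 rmorph0 mulr0 sre0 //.
  have [c hc] := @scalar_riesz R k (fun d => F (d *: e n))
    (fun d d' => etrans (congr1 F (scalerDl (e n) d d')) (FD _ _))
    (fun r d => etrans (congr1 F (esym (scalerA (rc r) d (e n)))) (FZ _ _)).
  by exists c; split => // /eqP; rewrite (negbTE en).
have [c hc] := choice exc.
have cb N : \sum_(0 <= i < N) nm (c i) ^+ 2 <= M ^+ 2.
  set q := \sum_(0 <= i < N) _.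
  have qE : F (\sum_(0 <= i < N) c i *: e i) = q.
    by rewrite Fsum; apply: eq_bigr => i _; rewrite (hc i).1 nm_sqr.
  have h1 := FM (\sum_(0 <= i < N) c i *: e i).
  have h2 := ons_nm_sum_le dot_norm (onb_ons oe) c N.
  have q0 : 0 <= q by apply: sumr_ge0 => i _; exact: sqr_ge0.
  rewrite qE (ger0_norm q0) in h1; rewrite -/q in h2.
  have h3 : q ^+ 2 <= M ^+ 2 * q.
    apply: (@le_trans _ _ ((M * nm (\sum_(0 <= i < N) c i *: e i)) ^+ 2)).
      by rewrite ler_pXn2r ?nnegrE// mulr_ge0 ?nm_ge0.
    by rewrite exprMn ler_wpM2l ?sqr_ge0.
  have [->|qn0] := eqVneq q 0; first exact: sqr_ge0.
  by move: h3; rewrite [q ^+ 2]expr2 ler_pM2r// lt_def qn0.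
have [u [_ ue un]] := riesz_fischer dot_norm (onb_ons oe) cb.
exists u; first by move: un; rewrite ler_pXn2r ?nnegrE ?nm_ge0.
have uE n : dot u (e n) = c n.
  rewrite ue; have [en|->] := (onb_ons oe).2 n; last by rewrite mulr1.
  by rewrite (hc n).2// mul0r.
move=> x; have ex := onb_expand dot_norm oe (x := x).
have Fs : (fun n => F (series (fun n => dot x (e n) *: e n) n)) @ \oo --> F x.
  apply/cvgrPdistC_lt => d d0; have M1 : 0 < M + 1 by rewrite ltr_wpDl.
  move/nm_cvgP/(_ (d / (M + 1))) : ex; rewrite divr_gt0// => /(_ isT).
  apply: filterS => n; rewrite ltr_pdivlMr// => h.
  have -> : F (series (fun n => dot x (e n) *: e n) n) - F x =
            F (series (fun n => dot x (e n) *: e n) n - x).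
    rewrite FD; congr (_ + _); set z := x.
    have -> : - z = rc (-1) *: z by rewrite rmorphN rmorph1 scaleN1r.
    by rewrite FZ mulN1r.
  by apply: le_lt_trans (FM _) _; apply: le_lt_trans h; rewrite mulrC ler_wpM2l ?nm_ge0// lerDl.
apply: (cvg_unique (@Rhausdorff R) Fs).
have -> : (fun n => F (series (fun n => dot x (e n) *: e n) n)) =
          fun n => sre (dot (series (fun n => dot x (e n) *: e n) n) u).
  apply/funext => n; rewrite /series /= Fsum dot_suml sre_sum; apply: eq_bigr => i _.
  by rewrite (hc i).1 dotZl (dotC dot (e i) u) uE.
exact: (sre_cvg (dot_cvgl dot_norm (y := u) ex)).
Qed.

Lemma sre_dot_inj u v : (forall x, sre (dot x u) = sre (dot x v)) -> u = v.
Proof.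
move=> h; apply/eqP; rewrite -subr_eq0 -nm_eq0 -sqrf_eq0 -(sre_dotxx dot_norm).
by rewrite dotBr sreB h subrr.
Qed.

Lemma sre_mul_inj (s t : K) : (forall c, sre (c * s) = sre (c * t)) -> s = t.
Proof.
move=> h; apply/eqP; rewrite -subr_eq0 -nm_eq0 -sqrf_eq0 nm_sqr mulrC.
by rewrite mulrBr sreB h subrr.
Qed.

(* The hypothesis relating [c *: x] and [cj c *: y] upgrades the real-linear
   operator given by Riesz' theorem to a linear one. *)
Lemma bilinear_operator (B : H -> H -> R) M : 0 <= M -> (forall x y, B x y = B y x) ->
  (forall x y z, B x (y + z) = B x y + B x z) ->
  (forall x (r : R) y, B x (rc r *: y) = r * B x y) ->
  (forall c x y, B (c *: x) y = B x (cj c *: y)) ->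
  (forall x y, `|B x y| <= M * nm x * nm y) ->
  exists X, [/\ bounded_by M X, selfadjoint dot X & forall x y, B x y = sre (dot y (X x))].
Proof.
move=> M0 BC BD BZ Bc BM.
have exX x : exists u, nm u <= M * nm x /\ forall y, B x y = sre (dot y u).
  have [|u un uE] := @real_riesz (B x) (M * nm x) (mulr_ge0 M0 (nm_ge0 x)) (BD x) (BZ x).
    by move=> y; exact: BM.
  by exists u.
have [X hX] := choice exX; have XE x y : B x y = sre (dot y (X x)) by exact: (hX x).2.
have lX : linear X.
  move=> c x y; apply: sre_dot_inj => z.
  by rewrite -XE BC BD -(BC (c *: x)) -(BC y) Bc !XE dotDr sreD dotZl dotZr.
exists X; split => //; first by split => // x; exact: (hX x).1.
move=> x y; apply: sre_mul_inj => c; rewrite -!dotZl.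
by rewrite -XE BC XE (linZ lX) sre_dotC.
Qed.

Section Range.
Variables (P : H -> H) (posP : positive_op dot P) (cP : compact_op P).
Let W : set H := closure (range P).
Let V := selfadjoint_trace_class_in dot W.

Lemma closure_range_linear c x y : W x -> W y -> W (c *: x + y).
Proof.
have [e [l [C [eP l0 sC bP SE]]]] := op_sqrt_spectral dot_norm H_separable posP cP.
move=> /(closure_range_eigen dot_norm _ eP bP) Wx /(closure_range_eigen dot_norm _ eP bP) Wy.
apply/(closure_range_eigen dot_norm _ eP bP) => n ln.
by rewrite dotDl dotZl Wx// Wy// mulr0 addr0.
Qed.

Lemma closure_range0 : W 0.
Proof.
have [e [l [C [eP l0 sC bP SE]]]] := op_sqrt_spectral dot_norm H_separable posP cP.
by apply/(closure_range_eigen dot_norm _ eP bP) => n _; rewrite dot0l.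
Qed.

Lemma closure_rangeD x y : W x -> W y -> W (x + y).
Proof. by move=> Wx Wy; rewrite -[x]scale1r; exact: closure_range_linear. Qed.

Lemma closure_rangeZ c x : W x -> W (c *: x).
Proof.
by move=> Wx; rewrite -[_ *: _]addr0; apply: closure_range_linear => //; exact: closure_range0.
Qed.

Lemma sa_trace_classD Y Z : V Y -> V Z -> V (Y + Z).
Proof.
move=> [tY sY WY] [tZ sZ WZ]; split.
- by have [] := trace_classD dot_norm H_separable sY tY sZ tZ.
- exact: selfadjointD.
- by move=> _ [x _ <-]; apply: closure_rangeD; [apply: WY|apply: WZ]; exists x.
Qed.

Lemma sa_trace_classZ (r : R) Y : V Y -> V (rc r *: Y).
Proof.
move=> [tY sY WY]; split.
- by have [] := trace_classZ dot_norm H_separable r sY tY.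
- exact: selfadjointZ.
- by move=> _ [x _ <-]; apply: closure_rangeZ; apply: WY; exists x.
Qed.

Lemma rank2_sa_trace_class x y : W x -> W y -> V (rank2 dot x y).
Proof.
move=> Wx Wy; split.
- by have [] := rank2_trace_class dot_norm H_separable x y.
- exact: rank2_selfadjoint.
- by move=> _ [z _ <-]; apply: closure_rangeD; exact: closure_rangeZ.
Qed.

Lemma sa_trace_class0 : V 0.
Proof.
have := sa_trace_classZ 0 (rank2_sa_trace_class closure_range0 closure_range0).
by rewrite rmorph0 scale0r.
Qed.

Lemma sa_trace_classN Y : V Y -> V (- Y).
Proof. by move=> /(sa_trace_classZ (-1)); rewrite rmorphN rmorph1 scaleN1r. Qed.

Lemma eigenvector_range Y g b n : V Y -> eigenbasis dot Y g b -> b n != 0 -> W (g n).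
Proof.
move=> [tY sY WY] eY bn.
have -> : g n = rc (b n)^-1 *: Y (g n).
  by case: eY => _ -> _; rewrite scalerA -rmorphM /= mulVf// rmorph1 scale1r.
by apply: closure_rangeZ; apply: WY; exists (g n).
Qed.

(** The first N terms of the spectral expansion; the division by 2 compensates [rank2 dot x x],
    which is twice the rank-one operator of x. *)
Definition eigen_trunc g b N : H -> H :=
  \sum_(0 <= n < N) rc (b n / 2) *: rank2 dot (g n) (g n).

Lemma eigen_trunc_sa_trace_class Y g b N : V Y -> eigenbasis dot Y g b -> V (eigen_trunc g b N).
Proof.
move=> VY eY; rewrite /eigen_trunc; elim/big_ind : _ => [|Z Z'|n _].
- exact: sa_trace_class0.
- exact: sa_trace_classD.
have [->|bn] := eqVneq (b n) 0; first by rewrite mul0r rmorph0 scale0r; exact: sa_trace_class0.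
by apply: sa_trace_classZ; apply: rank2_sa_trace_class; exact: eigenvector_range VY eY bn.
Qed.

Lemma eigen_truncE g b N z :
  eigen_trunc g b N z = \sum_(0 <= n < N) (rc (b n) * dot z (g n)) *: g n.
Proof.
rewrite /eigen_trunc fct_sumE; apply: eq_bigr => n _.
rewrite /rank2 -[LHS]/(rc (b n / 2) *: (dot z (g n) *: g n + dot z (g n) *: g n)).
by rewrite -scalerDl scalerA mulrDr -mulrDl -rmorphD -splitr.
Qed.

(** The difference has the same eigenbasis, with the first N eigenvalues replaced by 0, so its trace
    norm is the tail of the convergent series of the |b n|. *)
Lemma tn_eigen_tail Y g b : V Y -> eigenbasis dot Y g b ->
  (fun N => tn dot (Y - eigen_trunc g b N)) @ \oo --> (0 : R).
Proof.
move=> VY eY; have [tY sY _] := VY; have og := eigenbasis_onb eY.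
have [_ bcvg _] := trace_norm_tn dot_norm sY tY eY.
have E N : tn dot (Y - eigen_trunc g b N) = tn dot Y - series (fun n => `|b n|) N.
  have VD := sa_trace_classD VY (sa_trace_classN (eigen_trunc_sa_trace_class N VY eY)).
  have [tD sD _] := VD.
  pose b' m := if (m < N)%N then 0 else b m.
  have eD : eigenbasis dot (Y - eigen_trunc g b N) g b'.
    split=> // [m|m gm]; last by rewrite /b' (eigenbasis0 eY gm); case: ifP.
    apply: (onb_ext og) => j; rewrite !fctE eigen_truncE dotBl.
    case: (eY) => _ -> _; rewrite (ons_dot_sum (onb_ons og)) !dotZl /b'.
    have [->|mj] := eqVneq m j; last first.
      by rewrite ((onb_ons og).1 m j mj) !mulr0 mul0r; case: ifP; rewrite subr0.
    rewrite -mulrA (ons_dotxx (onb_ons og)).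
    by case: ifP => _; rewrite ?subrr ?rmorph0 ?mul0r// subr0.
  have [_ Dcvg _] := trace_norm_tn dot_norm sD tD eD.
  apply: (cvg_unique (@Rhausdorff R) Dcvg).
  pose proof (cvgB bcvg (cvg_cst (series (fun n => `|b n|) N))) as hb; move: hb.
  apply: cvg_trans; apply: near_eq_cvg; exists N => // m /= Nm.
  rewrite !fctE /= /series /= (big_cat_nat (leq0n N) Nm) /= addrAC subrr add0r.
  rewrite (big_cat_nat (leq0n N) Nm) /= [X in _ = X + _]big_nat.
  rewrite [X in _ = X + _]big1 ?add0r; last first.
    by move=> i /andP[_ iN]; rewrite /b' iN normr0.
  by apply: eq_big_nat => i /andP[Ni _]; rewrite /b' ltnNge Ni.
rewrite (_ : (fun N => _) = (fun N => tn dot Y - series (fun n => `|b n|) N)); last exact/funext.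
by pose proof (cvgB (cvg_cst (tn dot Y)) bcvg) as hb; rewrite subrr in hb; exact: hb.
Qed.

(* X is read off the quadratic form sending x to phi of the rank-one operator
   of x; the spectral expansion of Y then gives phi Y = Tr (Y X). *)
Lemma functional_trace (phi : (H -> H) -> R) :
  (forall Y Z, V Y -> V Z -> phi (Y + Z) = phi Y + phi Z) ->
  (forall (r : R) Y, V Y -> phi (rc r *: Y) = r * phi Y) ->
  (forall Y, V Y -> `|phi Y| <= tn dot Y) ->
  exists X, [/\ bounded_op X, selfadjoint dot X, forall v, W (X v) &
    forall Y, V Y -> has_trace dot (Y \o X) (rc (phi Y))].
Proof.
move=> phiD phiZ phi_le.
have [e [l [C [eP l0 sC bP SE]]]] := op_sqrt_spectral dot_norm H_separable posP cP.
have oe := eigenbasis_onb eP.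
(* [Q] is the orthogonal projection on [W]. Composing with it defines the form on all of H, whereas
   phi is controlled only on operators with range in [W]; it also forces the range of X into [W]. *)
pose w n : R := if l n == 0 then 0 else 1.
have w1 n : `|w n| <= 1 by rewrite /w; case: ifP; rewrite ?normr0 ?normr1.
pose Q := diag dot e w; have [lQ Q1] : bounded_by 1 Q := diag_bounded dot_norm oe w1.
have {}Q1 x : nm (Q x) <= nm x by have := Q1 x; rewrite mul1r.
have QW x : W (Q x).
  apply/(closure_range_eigen dot_norm _ eP bP) => n ln.
  by rewrite (dot_diag dot_norm oe w1) /w ln eqxx rmorph0 mul0r.
have Qid x : W x -> Q x = x.
  move=> /(closure_range_eigen dot_norm _ eP bP) Wx; apply: (onb_ext oe) => n.
  rewrite (dot_diag dot_norm oe w1) /w; case: eqP => [ln|]; last by rewrite rmorph1 mul1r.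
  by rewrite rmorph0 mul0r Wx.
have Qe n : l n = 0 -> Q (e n) = 0.
  by move=> ln; rewrite /Q (diag_basis dot_norm oe w1) /w ln eqxx rmorph0 scale0r.
(* Halving makes B x x the value of phi on the rank-one operator of Q x, and the bound 2 |x| |y| on
   the trace norm of [rank2] gives B norm at most 1. *)
pose B x y := phi (rank2 dot (Q x) (Q y)) / 2.
have phi0 : phi 0 = 0.
  by rewrite -(scale0r (0 : H -> H)) -(rmorph0 rc) phiZ ?mul0r//; exact: sa_trace_class0.
have r2W x y : V (rank2 dot (Q x) (Q y)) by exact: rank2_sa_trace_class.
have r2C x y : rank2 dot x y = rank2 dot y x by apply/funext => z; rewrite /rank2 addrC.
have [||||| X [bX sX XE]] := @bilinear_operator B 1 ler01.
- by move=> x y; rewrite /B r2C.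
- move=> x y z; rewrite /B -mulrDl -phiD//; congr (phi _ / 2).
  by apply/funext => t; rewrite /rank2 !fctE (linD lQ) dotDr scalerDl scalerDr addrACA.
- move=> x r y; rewrite /B mulrA -phiZ//; congr (phi _ / 2).
  apply/funext => t; rewrite /rank2 -[RHS]/(rc r *: (dot t (Q y) *: Q x + dot t (Q x) *: Q y)).
  rewrite (linZ lQ) dotZr conj_of_real scalerDr !scalerA.
  by rewrite [dot t (Q x) * _]mulrC.
- move=> c x y; rewrite /B; congr (phi _ / 2).
  apply/funext => t; rewrite /rank2 !(linZ lQ) !dotZr conjK !scalerA.
  by rewrite mulrC [_ * dot t (Q x)]mulrC.
- move=> x y; rewrite /B normrM [`|2^-1|]ger0_norm// ler_pdivrMr//.
  apply: le_trans (phi_le _ (r2W x y)) _.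
  have [_ h] := rank2_trace_class dot_norm H_separable (Q x) (Q y).
  apply: le_trans h _; rewrite mul1r mulrC ler_wpM2r//.
  by apply: ler_pM; rewrite ?nm_ge0.
have WX v : W (X v).
  apply/(closure_range_eigen dot_norm _ eP bP) => n ln.
  apply: sre_mul_inj => c; rewrite mulr0 -(conjK c) -dotZr sre_dotC -XE /B (linZ lQ) Qe// scaler0.
  rewrite (_ : rank2 dot (Q v) 0 = 0); first by rewrite phi0 mul0r sre0.
  by apply/funext => t; rewrite /rank2 dot0r scale0r scaler0 addr0.
exists X; split => //; first by apply/bounded_opP; exists 1.
move=> Y VY; have [tY sY WY] := VY.
have [g [b eY]] := spectral dot_norm H_separable (trace_class_compact tY) sY.
have [t [ht tcvg _]] := trace_class_pairing dot_norm sY tY eY bX sX.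
suff -> : phi Y = t by [].
apply/eqP; rewrite -subr_eq0 -normr_eq0 eq_le normr_ge0 andbT.
have phiT N : phi (eigen_trunc g b N) = series (fun n => b n * sre (dot (X (g n)) (g n))) N.
  elim: N => [|N IH]; first by rewrite /eigen_trunc /series /= !big_geq.
  rewrite seriesSr -IH /eigen_trunc big_nat_recr //= -/(eigen_trunc g b N).
  have [bn|bn] := eqVneq (b N) 0; first by rewrite bn !mul0r rmorph0 scale0r !addr0.
  have WgN := eigenvector_range VY eY bn.
  rewrite phiD ?phiZ//; first last.
  - by apply: sa_trace_classZ; exact: rank2_sa_trace_class.
  - exact: eigen_trunc_sa_trace_class VY eY.
  - exact: rank2_sa_trace_class.
  by rewrite sre_dotC -XE /B Qid// mulrAC mulrA.
(* |phi Y - t| is at most the trace norm of the remainder plus |phi (truncation) - t|; both tend to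
   0, since phi of the truncations gives the partial sums converging to t. *)
pose proof (cvgD (tn_eigen_tail VY eY) (cvg_norm (cvgB tcvg (cvg_cst t)))) as hl.
rewrite subrr normr0 addr0 in hl; apply: (cvgr_to_ge hl); near=> N.
rewrite !fctE /= -phiT.
have VT := eigen_trunc_sa_trace_class N VY eY.
have -> : phi Y - t = phi (Y - eigen_trunc g b N) + (phi (eigen_trunc g b N) - t).
  have -> : phi (Y - eigen_trunc g b N) = phi Y - phi (eigen_trunc g b N).
    rewrite phiD//; last exact: sa_trace_classN.
    congr (_ + _); have -> : - eigen_trunc g b N = rc (-1) *: eigen_trunc g b N.
      by rewrite rmorphN rmorph1 scaleN1r.
    by rewrite phiZ// mulN1r.
  by rewrite addrA subrK.
apply: le_trans (ler_normD _ _) _; rewrite lerD2r; apply: phi_le.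
by apply: sa_trace_classD => //; exact: sa_trace_classN.
Unshelve. all: by end_near. Qed.

End Range.

End Representation.

(** * Extreme points *)

Section ExtremePoints.
Context (R : realType) (k : scalar_kind).
Local Notation K := (scalar_field R k).
Local Notation cj := (scalar_conj R k).
Local Notation rc := (of_real R k).
Context (H : completeNormedModType K) (dot : {dot H for @scalar_conj R k}).
Context (dot_norm : norm_from_dot dot) (H_separable : separable_space H).
Context (p : R) (q : \bar R) (pq : conjugate p q).
Context (I : Type) (A : I -> H -> H) (b : I -> K).
Hypothesis A_schatten : forall i, schatten dot p%:E (A i).
Hypothesis A_selfadjoint : forall i, selfadjoint dot (A i).
Context (P : H -> H) (P_feasible : feasible_set dot q A b P).
Implicit Types (x y z u v : H) (X Y Z : H -> H).

Let S := op_sqrt dot P.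
Let W : set H := closure (range P).
Let V := selfadjoint_trace_class_in dot W.
Let E := real_span (fun i => S \o A i \o S).

Let posP : positive_op dot P. Proof. by case: P_feasible. Qed.
Let Pq : schatten dot q P. Proof. by case: P_feasible. Qed.
Let cP : compact_op P. Proof. exact: schatten_compact Pq. Qed.
Let sS : selfadjoint dot S. Proof. exact: sqrt_selfadjoint. Qed.
Let lS : linear S. Proof. exact: (sqrt_linear dot_norm H_separable posP cP). Qed.

Lemma conjugate_ge1 r : q = r%:E -> 1 <= r.
Proof. by case: pq => [[_ ->]//|[r' [-> _ r1 _]] [<-]]; exact: ltW. Qed.

(** A vector of [W] orthogonal to the range of S is 0. This kills X (S x), and then X v for every v
    by self-adjointness of X. *)
Lemma sandwich_eq0 X : selfadjoint dot X -> (forall v, W (X v)) ->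
  (forall x, S (X (S x)) = 0) -> X = 0.
Proof.
move=> sX WX h.
have XS x : X (S x) = 0.
  apply: (closure_range_eq0 dot_norm H_separable posP cP (WX _)) => y.
  by have := sS (X (S x)) y; rewrite h dot0l => <-.
apply/funext => v; apply: (closure_range_eq0 dot_norm H_separable posP cP (WX _)) => y.
by rewrite sX XS dot0r.
Qed.

(** The condition |r| M <= 1 bounds the perturbation by P as a form, so the new operator lies
    between 0 and 2 P; [schatten_le] then keeps it in the Schatten class. *)
Lemma perturb_feasible X M r : bounded_by M X -> selfadjoint dot X ->
  (forall i, trace dot (S \o A i \o S \o X) = 0) -> r != 0 -> `|r| * M <= 1 ->
  feasible_set dot q A b (P + (fun x => rc r *: (S \o X \o S) x)).
Proof.
move=> bX sX tr0 r0 rM.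
have [e0 oe0] := onb_exists dot_norm H_separable.
have [_ sP P0] := posP; have [_ qN] := conjugate_gt0 pq.
have [N N0 bS] := sqrt_bounded dot_norm H_separable posP cP.
set D := S \o X \o S; set B := P + _.
have sD : selfadjoint dot D := adjoint_comp (adjoint_comp sS sX) sS.
have cD : compact_op D.
  apply: (compact_op_compr _ bS); apply: (compact_op_compr _ bX).
  exact: sqrt_compact.
have cB : compact_op B by apply: compact_opD => //; exact: compact_opZ.
have sB : selfadjoint dot B by apply: selfadjointD => //; exact: selfadjointZ.
have BE x : sre (dot (B x) x) = nm (S x) ^+ 2 + r * sre (dot (X (S x)) (S x)).
  rewrite (nm_sqrt dot_norm H_separable posP cP) /B !fctE dotDl sreD dotZl sreZ.
  by rewrite /D /= sS.
have Xle x : `|r * sre (dot (X (S x)) (S x))| <= nm (S x) ^+ 2.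
  rewrite normrM; apply: (@le_trans _ _ (`|r| * (M * nm (S x) ^+ 2))).
    rewrite ler_wpM2l//; apply: le_trans (sre_dot_le dot_norm _ _) _.
    by rewrite expr2 mulrA ler_wpM2r ?nm_ge0//; exact: bX.2.
  by rewrite mulrA ler_piMl ?sqr_ge0.
have B0 x : 0 <= dot x (B x).
  rewrite selfadjoint_ge0// BE; have := Xle x; rewrite ler_norml => /andP[h _].
  by rewrite -lerBlDl sub0r.
have B2 x : sre (dot (B x) x) <= 2 * sre (dot (P x) x).
  rewrite BE -(nm_sqrt dot_norm H_separable posP cP) mulr_natl mulr2n lerD2l.
  exact: le_trans (ler_norm _) (Xle x).
have Bq : schatten dot q B.
  exact: (schatten_le dot_norm conjugate_ge1 qN H_separable sP P0 Pq).
have posB : positive_op dot B.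
  by split => //; apply/bounded_opP; exact: compact_op_bounded.
split => // i.
have [tB hB] := schatten_has_trace dot_norm H_separable pq (A_schatten i) (A_selfadjoint i) Bq sB.
have [tP hP] := schatten_has_trace dot_norm H_separable pq (A_schatten i) (A_selfadjoint i) Pq sP.
have [t ht tD] :=
  sandwich_trace dot_norm H_separable pq (A_schatten i) (A_selfadjoint i) Pq posP bX sX.
have t0 : t = 0 by rewrite -(tr0 i) (traceE oe0 ht).
(* Tr (D A_i) exists because D is a multiple of the difference of two operators of Schatten class q;
   this is where r is inverted. *)
have hD := has_traceZ (rc r^-1) (has_traceD hB (has_traceN hP)).
have /tD : has_trace dot (D \o A i) (rc r^-1 * (tB - tP)).
  suff -> : D \o A i = fun x => rc r^-1 *: (B \o A i + - (P \o A i)) x by [].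
  apply/funext => x; rewrite /B !fctE /= addrAC subrr add0r scalerA -rmorphM /=.
  by rewrite mulVf// rmorph1 scale1r.
rewrite t0 => /eqP; rewrite mulf_eq0 of_real_eq0 invr_eq0 (negbTE r0) /= subr_eq0 => /eqP BP.
rewrite (traceE oe0 hB) BP -(traceE oe0 hP).
by case: P_feasible.
Qed.

Lemma extreme_no_perturbation : extreme_point (feasible_set dot q A b) P ->
  ~ exists X, [/\ bounded_op X, selfadjoint dot X, X <> 0, range X `<=` W &
     forall i, trace dot (S \o A i \o S \o X) = 0].
Proof.
move=> [_ ext] [X [/bounded_opP[M M0 bX] sX X0 XW tr0]]; apply: ext.
(* The added 1 allows M = 0; P is the midpoint of the points with parameters r and - r. *)
pose r := (M + 1)^-1; have M1 : 0 < M + 1 by rewrite ltr_wpDl.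
have r0 : 0 < r by rewrite invr_gt0.
have rM : `|r| * M <= 1.
  by rewrite gtr0_norm// /r mulrC ler_pdivrMr// mul1r lerDl.
pose D := S \o X \o S.
exists (rc 2^-1), (P + (fun x => rc r *: D x)), (P + (fun x => rc (- r) *: D x)); split.
- by rewrite of_real_gt0 -(rmorph1 rc) of_real_lt invr_gt0 ltr0n invf_lt1 ?ltr1n ?ltr0n.
- by apply: perturb_feasible bX sX tr0 _ rM; rewrite gt_eqF.
- by apply: perturb_feasible bX sX tr0 _ _; rewrite ?normrN// oppr_eq0 gt_eqF.
- move=> /addrI h; apply: X0; apply: sandwich_eq0 => // [v|x]; first by apply: XW; exists v.
  have /eqP := congr1 (@^~ x) h; rewrite /= rmorphN scaleNr -addr_eq0 -scalerDl -rmorphD /=.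
  rewrite scaler_eq0 of_real_eq0 => /orP[|/eqP//].
  by rewrite gt_eqF// addr_gt0.
- apply/funext => x; rewrite !fctE -(rmorph1 rc) -rmorphB /=.
  have -> : 1 - 2^-1 = 2^-1 :> R by field.
  rewrite -scalerDr; set d := D x.
  have -> : P x + rc r *: d + (P x + rc (- r) *: d) = rc 2 *: P x.
    by rewrite addrACA rmorphN scaleNr subrr addr0 rmorph_nat scaler_nat mulr2n.
  by rewrite scalerA -rmorphM mulVf ?pnatr_eq0// rmorph1 scale1r.
Qed.

Lemma no_perturbation_extreme :
  (~ exists X, [/\ bounded_op X, selfadjoint dot X, X <> 0, range X `<=` W &
     forall i, trace dot (S \o A i \o S \o X) = 0]) ->
  extreme_point (feasible_set dot q A b) P.
Proof.
move=> noX; split=> // -[a [p1 [p2 [/andP[a0 a1] [pos1 q1 tr1] [pos2 q2 tr2] p12 PE]]]].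
have [e0 oe0] := onb_exists dot_norm H_separable.
pose r := sre a; have aE : a = rc r by rewrite of_real_sre ?gtr0_real.
have r0 : 0 < r by rewrite -(of_real_gt0 k) -aE.
have r1 : 0 < 1 - r by rewrite subr_gt0 -(of_real_lt k) -aE rmorph1.
have c1 := schatten_compact q1; have c2 := schatten_compact q2.
have [_ s1 ge1] := pos1; have [_ s2 ge2] := pos2.
pose D := p1 - p2.
have sD : selfadjoint dot D by apply: selfadjointD => //; exact: selfadjointN.
have quadP x : sre (dot (P x) x) = r * sre (dot (p1 x) x) + (1 - r) * sre (dot (p2 x) x).
  rewrite PE !fctE aE -(rmorph1 rc) -rmorphB dotDl sreD.
  by rewrite !dotZl !sreZ.
have g1 x : 0 <= sre (dot (p1 x) x) by rewrite -selfadjoint_ge0.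
have g2 x : 0 <= sre (dot (p2 x) x) by rewrite -selfadjoint_ge0.
have le1 x : sre (dot (p1 x) x) <= r^-1 * sre (dot (P x) x).
  rewrite ler_pdivlMl// quadP lerDl mulr_ge0 ?(ltW r1)//.
have le2 x : sre (dot (p2 x) x) <= (1 - r)^-1 * sre (dot (P x) x).
  rewrite ler_pdivlMl// quadP lerDr mulr_ge0 ?(ltW r0)//.
have ri : 0 <= r^-1 by rewrite invr_ge0 ltW.
have ri' : 0 <= (1 - r)^-1 by rewrite invr_ge0 ltW.
(* The constants are those by which P dominates p1 and p2 as forms. *)
have Dle x y : nm (dot (D x) y) <= (r^-1 + (1 - r)^-1) * nm (S x) * nm (S y).
  rewrite /D !fctE dotBl; apply: le_trans (nmD _ _) _; rewrite nmN !mulrDl.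
  by apply: lerD; apply: positive_form_le.
have [C1 C10 b1] := compact_op_bounded c1; have [C2 C20 b2] := compact_op_bounded c2.
have bD : bounded_by (C1 + nm (-1 : K) * C2) D.
  have -> : D = p1 + (fun x => -1 *: p2 x) by apply/funext => x; rewrite !fctE scaleN1r.
  by apply: bounded_add => //; exact: bounded_scale.
have [X [bX sX WX DE]] := sandwich_factor dot_norm H_separable posP cP (addr_ge0 ri ri') bD sD Dle.
apply: noX; exists X; split => //.
- by apply/bounded_opP; exists (r^-1 + (1 - r)^-1) => //; exact: addr_ge0.
- move=> X0; apply: p12; apply/eqP; rewrite -subr_eq0; apply/eqP; rewrite -/D DE X0.
  by apply/funext => x; exact: (lin0 lS).
- by move=> _ [x _ <-]; exact: WX.
move=> i.
have [t1 h1] := schatten_has_trace dot_norm H_separable pq (A_schatten i) (A_selfadjoint i) q1 s1.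
have [t2 h2] := schatten_has_trace dot_norm H_separable pq (A_schatten i) (A_selfadjoint i) q2 s2.
have [t ht tD] :=
  sandwich_trace dot_norm H_separable pq (A_schatten i) (A_selfadjoint i) Pq posP bX sX.
have /tD : has_trace dot (S \o X \o S \o A i) (t1 - t2).
  by rewrite -DE; exact: has_traceD h1 (has_traceN h2).
rewrite -(traceE oe0 h1) -(traceE oe0 h2) tr1 tr2 subrr (traceE oe0 ht) => <-.
by [].
Qed.

(** With S A_i S = (G' S)^* (G S), each |<S A_i S h_n, h_n>| is at most |G S h_n|^2 + |G' S h_n|^2.
    The sums of these squares are the same in all bases, which yields a [quad_bound]. *)
Lemma sandwich_sa_trace_class i : V (S \o A i \o S).
Proof.
have [N N0 bS] := sqrt_bounded dot_norm H_separable posP cP.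
have sT : selfadjoint dot (S \o A i \o S) := adjoint_comp (adjoint_comp sS (A_selfadjoint i)) sS.
split => //; last by move=> _ [x _ <-]; exact: closure_range_sqrt.
have cT : compact_op (S \o A i \o S).
  apply: (compact_op_compr _ bS); apply: compact_op_compl bS.
  exact: schatten_compact (A_schatten i).
have [f [a [G [G' [eA [sG sG'] GG _ GS_hs]]]]] :=
  sandwich_hs dot_norm H_separable pq (A_schatten i) (A_selfadjoint i) Pq posP.
have [h0 oh0] := onb_exists dot_norm H_separable.
have [hG hG'] := GS_hs h0 oh0.
pose M := fine (hs (G \o S) h0) + fine (hs (G' \o S) h0).
have hs_fin (U : H -> H) h : (hs U h < +oo)%E -> hs U h \is a fin_num.
  by move=> hU; rewrite ge0_fin_numE//; apply: nneseries_ge0 => n _ _; rewrite lee_fin sqr_ge0.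
have := @quad_bound_trace_class R k H dot dot_norm H_separable (S \o A i \o S) M cT sT.
case=> // h oh N'.
apply: (@le_trans _ _ (\sum_(0 <= n < N') (nm ((G \o S) (h n)) ^+ 2 + nm ((G' \o S) (h n)) ^+ 2))).
  apply: ler_sum => n _; rewrite /= sS -GG /= sG'.
  apply: le_trans (sre_dot_le dot_norm _ _) _.
  move: (nm_ge0 (G (S (h n)))) (nm_ge0 (G' (S (h n)))).
  move: (nm (G _)) (nm (G' _)) => s t s0 t0.
  have := sqr_ge0 (s - t); rewrite sqrrB => ?; nra.
rewrite big_split /= lerD// -lee_fin fineK ?hs_fin//.
  rewrite (hs_indep dot_norm (adjoint_comp sG sS) oh0 oh).
  by apply: sum_le_nneseries => n; exact: sqr_ge0.
rewrite (hs_indep dot_norm (adjoint_comp sG' sS) oh0 oh).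
by apply: sum_le_nneseries => n; exact: sqr_ge0.
Qed.

Lemma span_sa_trace_class : E `<=` V.
Proof.
apply: real_span_ind => [||r Y|i].
- exact: sa_trace_class0.
- exact: sa_trace_classD.
- exact: sa_trace_classZ.
- exact: sandwich_sa_trace_class.
Qed.

Lemma rank1_trace u v : has_trace dot (fun z => dot z u *: v) (dot v u).
Proof.
move=> e oe.
have -> : series (fun n => dot (dot (e n) u *: v) (e n)) =
          fun n => dot (series (fun n => dot v (e n) *: e n) n) u.
  apply/funext => n; rewrite /series /= dot_suml; apply: eq_bigr => i _.
  by rewrite !dotZl mulrC.
exact: (dot_cvgl dot_norm (y := u) (onb_expand dot_norm oe (x := v))).
Qed.
Arguments rank1_trace : clear implicits.

(** Tr (Z X) vanishes on the span, hence Tr (Y X) = 0 on all of [V], since |Tr (Y X)| is at most M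
    times the trace norm of Y. Testing on [rank2 dot x x] gives <x, X x> = 0 for x in [W], so X
    vanishes on [W]; as X maps into [W], |X v|^2 = <v, X (X v)> = 0. *)
Lemma dense_no_perturbation : trace_norm_dense_in dot E V ->
  ~ exists X, [/\ bounded_op X, selfadjoint dot X, X <> 0, range X `<=` W &
     forall i, trace dot (S \o A i \o S \o X) = 0].
Proof.
move=> [EV dense] [X [/bounded_opP[M M0 bX] sX X0 XW tr0]]; apply: X0.
have [e0 oe0] := onb_exists dot_norm H_separable; have lX := bX.1.
have ZX0 Z : E Z -> has_trace dot (Z \o X) 0.
  move: Z; apply: real_span_ind.
  - have := has_traceZ 0 (rank1_trace 0 0); rewrite mul0r.
    by congr (has_trace _ _ _); apply/funext => z; rewrite scale0r.
  - by move=> Y Z hY hZ; have := has_traceD hY hZ; rewrite addr0.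
  - by move=> r Y hY; have := has_traceZ (rc r) hY; rewrite mulr0.
  move=> i; have [t ht _] :=
    sandwich_trace dot_norm H_separable pq (A_schatten i) (A_selfadjoint i) Pq posP bX sX.
  by rewrite -(tr0 i) (traceE oe0 ht).
have VX0 Y t : V Y -> has_trace dot (Y \o X) t -> t = 0.
  move=> VY ht; apply/eqP; rewrite -nm_eq0 eq_le nm_ge0 andbT.
  apply/ler_addgt0Pl => eps eps0; rewrite addr0.
  have M1 : 0 < M + 1 by rewrite ltr_wpDl.
  have [|Z EZ] := dense Y VY (rc (eps / (M + 1))).
    by rewrite of_real_gt0 divr_gt0.
  have VD : V (Y - Z) by apply: sa_trace_classD => //; apply: sa_trace_classN => //; exact: EV.
  have [tD sD _] := VD.
  have [g [b' eD]] := spectral dot_norm H_separable (trace_class_compact tD) sD.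
  have [tnE _ _] := trace_norm_tn dot_norm sD tD eD.
  rewrite tnE of_real_lt ltr_pdivlMr// => tn_lt.
  have [t' [ht' _ t'_le]] := trace_class_pairing dot_norm sD tD eD bX sX.
  have := has_traceD ht (has_traceN (ZX0 Z EZ)); rewrite subr0 => ht2.
  have -> : t = rc t' by apply: (has_trace_unique oe0 ht2 ht').
  rewrite nm_of_real; apply: le_trans t'_le _; apply: le_trans (ltW tn_lt).
  by rewrite mulrC ler_wpM2l ?tn_ge0// lerDl.
have quad0 x : W x -> dot x (X x) = 0.
  move=> Wx; have h := rank1_trace (X x) x.
  have : has_trace dot (rank2 dot x x \o X) (dot x (X x) + dot x (X x)).
    have := has_traceD h h; congr (has_trace _ _ _); apply/funext => z.
    by rewrite /rank2 !fctE /= sX.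
  move=> /VX0; rewrite -mulr2n.
  move=> /(_ (rank2_sa_trace_class dot_norm H_separable posP cP Wx Wx)) /eqP.
  by rewrite mulrn_eq0 /= => /eqP.
have WX v : W (X v) by apply: XW; exists v.
have XW0 x : W x -> X x = 0.
  (* Polarization at x + X x: the cross terms add up to 2 |X x|^2. *)
  move=> Wx; apply: (dotxx_eq0 dot_norm); have := quad0 (x + X x).
  move=> /(_ (closure_rangeD dot_norm H_separable posP cP Wx (WX x))).
  rewrite (linD lX) dotDl !dotDr !quad0// add0r addr0 -sX -mulr2n => /eqP.
  by rewrite mulrn_eq0 /= => /eqP.
apply/funext => v; apply: (dotxx_eq0 dot_norm).
by rewrite sX XW0// dot0r.
Qed.

(** Hahn-Banach is applied to the trace-norm distance to the span. A linear functional below this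
    distance is bounded by the trace norm and vanishes on the span, and at a point [Y0] far from the
    span it is at least the distance, hence nonzero. The operator X representing it contradicts the
    hypothesis. *)
Lemma no_perturbation_dense :
  (~ exists X, [/\ bounded_op X, selfadjoint dot X, X <> 0, range X `<=` W &
     forall i, trace dot (S \o A i \o S \o X) = 0]) ->
  trace_norm_dense_in dot E V.
Proof.
move=> noX; split; first exact: span_sa_trace_class.
move=> Y0 VY0 eps eps0; apply: contrapT => far; apply: noX.
have [e0 oe0] := onb_exists dot_norm H_separable.
have epsE : rc (sre eps) = eps by rewrite of_real_sre ?gtr0_real.
have E0 : E 0 by exact: real_span0.
have saD' := sa_trace_classD dot_norm H_separable posP cP.
have saZ' := sa_trace_classZ dot_norm H_separable posP cP.
have saN' := sa_trace_classN dot_norm H_separable posP cP.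
have VB Y Z : V Y -> E Z -> V (Y - Z).
  by move=> VY EZ; apply: saD' => //; apply: saN'; exact: span_sa_trace_class.
have tnD Y Z : V Y -> V Z -> tn dot (Y + Z) <= tn dot Y + tn dot Z.
  by move=> [tY sY _] [tZ sZ _]; have [] := trace_classD dot_norm H_separable sY tY sZ tZ.
have tnZ (r : R) Y : V Y -> tn dot (rc r *: Y) <= `|r| * tn dot Y.
  by move=> [tY sY _]; have [] := trace_classZ dot_norm H_separable r sY tY.
have tn0 Y : V Y -> 0 <= tn dot Y by move=> [tY sY _]; exact: tn_ge0.
pose dist Y := inf [set tn dot (Y - Z) | Z in E].
have dist_le Y Z : V Y -> E Z -> dist Y <= tn dot (Y - Z).
  move=> VY EZ; apply: ge_inf; last by exists Z.
  by exists 0 => _ [Z' EZ' <-]; apply: tn0; exact: VB.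
have dist_ge Y m : (forall Z, E Z -> m <= tn dot (Y - Z)) -> m <= dist Y.
  move=> h; apply: lb_le_inf; first by exists (tn dot (Y - 0)), 0.
  by move=> _ [Z EZ <-]; exact: h.
have dist_tn Y : V Y -> dist Y <= tn dot Y.
  by move=> VY; have := dist_le Y 0 VY E0; rewrite subr0.
have dist_sub : @sublinear_on R k (H -> H) V dist.
  split=> [Y Y' VY VY'|t Y t_ge0 VY].
    apply/ler_addgt0Pr => d d0; have d2 : 0 < d / 2 by rewrite divr_gt0.
    have ex U : V U -> exists2 Z, E Z & tn dot (U - Z) < dist U + d / 2.
      move=> VU; have [|_ [Z EZ <-] h] := @inf_adherent _ [set tn dot (U - Z) | Z in E] _ d2.
        split; first by exists (tn dot (U - 0)), 0.
        by exists 0 => _ [Z' EZ' <-]; apply: tn0; exact: VB.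
      by exists Z.
    have [Z EZ hZ] := ex Y VY; have [Z' EZ' hZ'] := ex Y' VY'.
    apply: le_trans (dist_le _ _ (saD' _ _ VY VY') (real_spanD EZ EZ')) _.
    have -> : Y + Y' - (Z + Z') = (Y - Z) + (Y' - Z') by rewrite opprD addrACA.
    apply: le_trans (tnD _ _ (VB _ _ VY EZ) (VB _ _ VY' EZ')) _.
    by rewrite [d]splitr addrACA ltW// ltrD.
  have half (s : R) U : 0 < s -> V U -> dist (rc s *: U) <= s * dist U.
    move=> s0 VU; rewrite -ler_pdivrMl//; apply: dist_ge => Z EZ.
    rewrite ler_pdivrMl//; apply: le_trans (dist_le _ _ (saZ' s _ VU) (real_spanZ s EZ)) _.
    rewrite -scalerBr; apply: le_trans (tnZ _ _ (VB _ _ VU EZ)) _.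
    by rewrite (gtr0_norm s0).
  have [->|tn_0] := eqVneq t 0.
    rewrite rmorph0 scale0r mul0r; apply/eqP; rewrite eq_le; apply/andP; split.
      have V0 : V 0 by exact: span_sa_trace_class.
      apply: le_trans (dist_tn _ V0) _.
      by have := tnZ 0 _ V0; rewrite rmorph0 scale0r normr0 mul0r.
    by apply: dist_ge => Z EZ; apply: tn0; apply: VB => //; exact: span_sa_trace_class.
  have tpos : 0 < t by rewrite lt_def tn_0.
  apply/eqP; rewrite eq_le half//=.
  have := half t^-1 (rc t *: Y); rewrite invr_gt0 => /(_ tpos (saZ' t _ VY)).
  by rewrite scalerA -rmorphM /= mulVf// rmorph1 scale1r ler_pdivlMl.
have [phi [phiD phiZ phi_le phi_ge]] := hahn_banach saD' saZ' dist_sub VY0.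
have phiN Y : V Y -> phi (- Y) = - phi Y.
  move=> VY; have -> : - Y = rc (-1) *: Y by rewrite rmorphN rmorph1 scaleN1r.
  by rewrite phiZ// mulN1r.
have tnN Y : V Y -> tn dot (- Y) <= tn dot Y.
  move=> VY; have := tnZ (-1) Y VY; rewrite normrN1 mul1r rmorphN rmorph1.
  by rewrite scaleN1r.
have phi_abs Y : V Y -> `|phi Y| <= tn dot Y.
  move=> VY; rewrite ler_norml; apply/andP; split; last first.
    exact: le_trans (phi_le Y VY) (dist_tn Y VY).
  rewrite lerNl -phiN//; apply: le_trans (tnN Y VY).
  by apply: le_trans (phi_le _ (saN' _ VY)) (dist_tn _ (saN' _ VY)).
have phi_E Z : E Z -> phi Z <= 0.
  move=> EZ; apply: le_trans (phi_le _ (span_sa_trace_class EZ)) _.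
  apply: le_trans (dist_le _ _ (span_sa_trace_class EZ) EZ) _; rewrite subrr.
  by have := tnZ 0 _ (span_sa_trace_class E0); rewrite rmorph0 scale0r normr0 mul0r.
have phi_E0 Z : E Z -> phi Z = 0.
  move=> EZ; apply/eqP; rewrite eq_le phi_E//= -oppr_le0 -phiN; last exact: span_sa_trace_class.
  apply: phi_E; have -> : - Z = rc (-1) *: Z by rewrite rmorphN rmorph1 scaleN1r.
  exact: real_spanZ.
have [X [bX sX WX hX]] := functional_trace dot_norm H_separable posP cP phiD phiZ phi_abs.
exists X; split => //; last 2 first.
- by move=> _ [v _ <-]; exact: WX.
- move=> i; rewrite (traceE oe0 (hX _ (sandwich_sa_trace_class i))) phi_E0 ?rmorph0//.
  exact: (real_span_gen (fun i => S \o A i \o S)).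
move=> X0; have dY0 : sre eps <= dist Y0.
  apply: dist_ge => Z EZ; rewrite leNgt; apply/negP => h; apply: far; exists Z => //.
  have [tD sD _] := VB _ _ VY0 EZ.
  have [g [b' eD]] := spectral dot_norm H_separable (trace_class_compact tD) sD.
  have [tnE _ _] := trace_norm_tn dot_norm sD tD eD.
  by rewrite tnE -epsE of_real_lt.
have sreps : 0 < sre eps by rewrite -(of_real_gt0 k) epsE.
have : phi Y0 = 0; last first.
  by move=> h; move: (lt_le_trans sreps (le_trans dY0 phi_ge)); rewrite h ltxx.
apply: (@of_real_inj R k); rewrite rmorph0.
have := hX _ VY0; rewrite X0 => /(has_trace_unique oe0); apply.
have := has_traceZ 0 (rank1_trace 0 0); rewrite mul0r.
congr (has_trace _ _ _); apply/funext => z; rewrite scale0r /=.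
have [tY sY _] := VY0.
by rewrite (lin0 (trace_class_compact tY).1).
Qed.

End ExtremePoints.

Unset Implicit Arguments.
Set Strict Implicit.
Set Printing Implicit Defensive.

Theorem theorem3p3 (R : realType) (k : scalar_kind)
    (H : completeNormedModType (scalar_field R k))
    (dot : {dot H for @scalar_conj R k})
    (dot_norm : norm_from_dot dot)
    (H_separable : separable_space H)
    (p : R) (q : \bar R) (p_ge1 : 1 <= p)
    (pq_conj : ((p^-1)%:E + q^-1 = 1)%E)
    (I : Type) (A : I -> H -> H) (b : I -> scalar_field R k)
    (A_schatten : forall i, schatten dot p%:E (A i))
    (A_selfadjoint : forall i, selfadjoint dot (A i))
    (P : H -> H) (P_feasible : feasible_set dot q A b P) :
  let rtP := op_sqrt dot P in
  let stmt1 := extreme_point (feasible_set dot q A b) P in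
  let stmt2 :=
    ~ exists X : H -> H,
        [/\ bounded_op X, selfadjoint dot X, X <> 0,
            range X `<=` closure (range P) &
            forall i, trace dot (rtP \o A i \o rtP \o X) = 0] in
  let stmt3 :=
    trace_norm_dense_in dot (real_span (fun i => rtP \o A i \o rtP))
      (selfadjoint_trace_class_in dot (closure (range P))) in
  (stmt1 <-> stmt2) /\ (stmt2 <-> stmt3).
Proof.
have pq := conjugateP p_ge1 pq_conj.
split; split.
- exact: (extreme_no_perturbation dot_norm H_separable pq A_schatten A_selfadjoint P_feasible).
- exact: (no_perturbation_extreme dot_norm H_separable pq A_schatten A_selfadjoint P_feasible).
- exact: (no_perturbation_dense dot_norm H_separable pq A_schatten A_selfadjoint P_feasible).
- exact: (dense_no_perturbation dot_norm H_separable pq A_schatten A_selfadjoint P_feasible).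
Qed.
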